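(* Let $p\ge2$, $\alpha\in(0,2)$ and let $X_N$ be a symmetric random tensor of order $p$ and dimension $N$ with i.i.d. entries (up to symmetry) in the domain of attraction of an $\alpha$-stable law, with tail-balance parameter $\theta\in[0,1]$. For $B>0$ let $\tilde A_N^B$ be the normalized contraction of the centered, normalized truncated tensor $T_N^B$, and let $\mu_{\tilde A_N^B}$ be its empirical spectral distribution. Then: 1. For each fixed $B>0$, $\mu_{\tilde A_N^B}$ converges weakly in probability, as $N\to\infty$, to a probability measure $\mu^B$ which is uniquely determined by its moments and has unbounded support. 2. The measures $\mu^B$ converge weakly to a limiting probability measure $\mu_{\alpha,\theta}$ as $B\to\infty$. In general the odd limiting moments (the odd moments of $\mu^B$) depend on $\theta$; in the symmetric-tail case $\theta=1/2$, all odd moments vanish and the limiting law is symmetric.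
   Context: Setting: $X_N=(X_{i_1,\dots,i_p})_{1\le i_1,\dots,i_p\le N}$ is real, invariant under permutation of indices, and $X_{i_1,\dots,i_p}=x_{i_1,\dots,i_p}$ for $i_1\le\cdots\le i_p$, where $(x_{\mathbf{i}})$ is an infinite array of i.i.d. real random variables, indexed by $1\le i_1\le\cdots\le i_p<\infty$, with law not depending on $N$. It is assumed that $\mathbb{P}(|x_{\mathbf{i}}|\ge u)=L(u)u^{-\alpha}$ for a slowly varying function $L$, and that $\theta:=\lim_{t\to\infty}\mathbb{P}(x_{\mathbf{i}}>t)/\mathbb{P}(|x_{\mathbf{i}}|>t)\in[0,1]$ exists. Put $a_n=\inf\{u:\mathbb{P}(|x_{\mathbf{i}}|\ge u)\le 1/n\}$. For $B>0$, $X_N^B$ is the tensor with entries $X_{i_1,\dots,i_p}\mathbf{1}_{|X_{i_1,\dots,i_p}|\le B a_{N^{p-1}}}$ and $T_N^B=a_{N^{p-1}}^{-1}X_N^B-\mathbb{E}[a_{N^{p-1}}^{-1}X_N^B]$. The normalized contraction is the $N\times N$ real symmetric matrix $$(\tilde A_N^B)_{a,b}=\frac{1}{\sqrt{M_2\,(p-2)!}}\sum_{j_1,\dots,j_{p-2}=1}^N (T_N^B)_{a,b,j_1,\dots,j_{p-2}},\qquad M_2=\lim_{N\to\infty}N^{p-1}\mathbb{E}[(T_N^B)_{1,\dots,p}^2]=\frac{\alpha}{2-\alpha}B^{2-\alpha}.$$ The empirical spectral distribution of a real symmetric $N\times N$ matrix is the uniform probability measure on its eigenvalues. *)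

(* Defs.v *)
From HB Require Import structures.
From mathcomp Require Import all_boot all_order all_algebra finmap.
From mathcomp Require Import complex.
From mathcomp Require Import all_classical all_reals all_analysis.

Set Implicit Arguments.
Unset Strict Implicit.
Unset Printing Implicit Defensive.

Import Order.TTheory GRing.Theory Num.Theory.
Import numFieldNormedType.Exports.

Local Open Scope classical_set_scope.
Local Open Scope ring_scope.

Section laws_on_the_line.
Context {R : realType}.
Implicit Types (mu nu : probability R R).

Definition weak_cvg {I : Type} (F : set_system I)
    (m : I -> {measure set R -> \bar R}) (l : {measure set R -> \bar R}) :=
  forall f : R -> R, continuous f -> bounded_fun f ->
    (\int[m i]_y f y) @[i --> F] --> \int[l]_y f y.

Definition weak_cvg_in_probability d (T : measurableType d)
    (P : probability T R) (m : nat -> T -> {measure set R -> \bar R})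
    (l : {measure set R -> \bar R}) :=
  forall f : R -> R, continuous f -> bounded_fun f ->
  forall e : R, 0 < e ->
    P [set w | e < `|\int[m N w]_y f y - \int[l]_y f y|] @[N --> \oo]
      --> 0%E.

Definition moment (k : nat) mu : R := \int[mu]_y (y ^+ k).

Definition finite_moments mu :=
  forall k : nat, mu.-integrable setT (fun y => (y ^+ k)%:E).

Definition moment_determinate mu :=
  finite_moments mu /\
  forall nu, finite_moments nu -> (forall k, moment k nu = moment k mu) ->
    forall A, measurable A -> nu A = mu A.

Definition law_support mu : set R :=
  [set y | forall U : set R, open U -> U y -> (0 < mu U)%E].

Definition symmetric_law mu :=
  forall A : set R, measurable A -> mu (-%R @^-1` A) = mu A.

Definition slowly_varying (L : R -> R) :=
  [/\ forall u, 0 < u -> 0 < L u,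
      measurable_fun (`]0, +oo[ : set R) L &
      forall c, 0 < c -> (L (c * u) / L u) @[u --> +oo] --> (1 : R)].

Definition heavy_tailed (alpha theta : R) nu :=
  (exists2 L : R -> R, slowly_varying L &
    forall u : R, 0 < u -> nu [set y : R | u <= `|y|] = (L u * u `^ (- alpha))%:E) /\
  (fine (nu [set y : R | t < y]) / fine (nu [set y : R | t < `|y|])) @[t --> +oo]
    --> theta.

Definition tail_quantile nu (n : nat) : R :=
  inf [set u : R | (nu [set y : R | (u <= `|y|)%R] <= (n%:R^-1)%:E)%E].

End laws_on_the_line.

Section empirical_spectral_distribution.
Context {R : realType}.

(* The library's spectral theorem is for normal matrices over a numClosedField,
   so a real symmetric matrix is diagonalised over R[i], where its eigenvalues
   are real and are listed with multiplicity; see [char_poly_eigenvalues]. *)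
Definition eigenvalues N (A : 'M[R]_N) : seq R :=
  [seq complex.Re (spectral_diag (map_mx (real_complex R) A) ord0 i)
  | i <- enum 'I_N].

Lemma char_poly_eigenvalues N (A : 'M[R]_N) : A^T = A ->
  char_poly A = \prod_(l <- eigenvalues A) ('X - l%:P).
Proof.
move=> symA; pose C := map_mx (real_complex R) A.
have hermC : C \is hermsymmx.
  apply/is_hermitianmxP; rewrite expr0 scale1r.
  apply/matrixP => i j; rewrite !mxE -[in LHS]symA mxE.
  by apply/esym/CrealP/complex_realP; exists (A j i).
have /mxOverP realD := hermitian_spectral_diag_real hermC.
have /orthomx_spectralP defC := hermitian_normalmx hermC.
have chC : char_poly C = char_poly (diag_mx (spectral_diag C)).
  rewrite /char_poly /char_poly_mx.
  set V := map_mx polyC (spectralmx C).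
  set W := map_mx polyC (invmx (spectralmx C)).
  have WV : W *m V = 1%:M.
    by rewrite -map_mxM mulVmx ?spectral_unit// map_mx1.
  have -> : 'X%:M - map_mx polyC C =
      W *m ('X%:M - map_mx polyC (diag_mx (spectral_diag C))) *m V.
    rewrite mulmxBr mulmxBl scalar_mxC -[_ *m W *m V]mulmxA WV mulmx1.
    by rewrite [in LHS]defC !map_mxM.
  by rewrite !det_mulmx mulrAC -det_mulmx WV det1 mul1r.
apply: (map_poly_inj (real_complex R)).
rewrite map_char_poly -/C rmorph_prod /= /eigenvalues big_map big_enum /= chC.
rewrite char_poly_trig ?diag_mx_is_trig//.
apply: eq_bigr => i _; rewrite mxE eqxx mulr1n rmorphB /= map_polyX map_polyC.
by congr ('X - _%:P); rewrite /= RRe_real// realD.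
Qed.

Definition esd N (A : 'M[R]_N) : {measure set R -> \bar R} :=
  mscale (N%:R^-1)%:nng (msum (fun k => \d_((eigenvalues A)`_k)) N).

End empirical_spectral_distribution.

Section independent_array.
Context {R : realType} d (T : measurableType d) (P : probability T R).

Definition mutually_independent (I : choiceType) (D : set I)
    (x : I -> {RV P >-> R}) :=
  forall (J : {fset I}) (A : I -> set R),
    [set` J] `<=` D -> (forall i, measurable (A i)) ->
    P (\bigcap_(i in [set` J]) (x i @^-1` A i)) =
      (\prod_(i <- J) fine (P (x i @^-1` A i)))%:E.

(* Multi-indices i_1 <= ... <= i_p are sequences of length p; indices start at
   0 instead of 1. *)
Definition sorted_indices (p : nat) : set (seq nat) :=
  [set s | size s = p /\ sorted leq s].

(* The values of x outside [sorted_indices p] are never used. *)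
Definition iid_array (p : nat) (nu : probability R R)
    (x : seq nat -> {RV P >-> R}) :=
  mutually_independent (sorted_indices p) x /\
  forall s, sorted_indices p s ->
    forall A, measurable A -> distribution P (x s) A = nu A.

End independent_array.

Section contraction.
Context {R : realType} d (T : measurableType d) (P : probability T R).
Variables (p : nat) (nu : probability R R) (x : seq nat -> {RV P >-> R}).
Variable B : R.

Definition tensor (i : seq nat) : T -> R := x (sort leq i).

Definition scaling (N : nat) : R := tail_quantile nu (N ^ (p - 1)).

Definition truncated (N : nat) (i : seq nat) (w : T) : R :=
  if `|tensor i w| <= B * scaling N then tensor i w else 0.

Definition centered (N : nat) (i : seq nat) (w : T) : R :=
  (scaling N)^-1 * truncated N i w
  - fine 'E_P[fun w' => (scaling N)^-1 * truncated N i w'].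

(* This limit exists and equals alpha / (2 - alpha) * B `^ (2 - alpha). *)
Definition M2 : R :=
  lim ((N%:R ^+ (p - 1) * fine 'E_P[fun w => centered N (iota 0 p) w ^+ 2])
    @[N --> \oo]).

Definition contraction_mx (N : nat) (w : T) : 'M[R]_N :=
  \matrix_(a < N, b < N)
    ((Num.sqrt (M2 * ((p - 2)`!)%:R))^-1 *
     \sum_(j : (p - 2).-tuple 'I_N)
       centered N [seq val k | k <- [:: a, b & j]] w).

End contraction.

(* Main.v *)
(* The proof is by the method of moments.  With n = N^(p-1), regular variation
   (Karamata) shows that the centred truncated entry y satisfies n E y^m ->
   alpha/(m-alpha) B^(m-alpha) (theta + (-1)^m (1-theta)) for m >= 2, while
   E y = 0.  Expanding N^-1 tr A^k over closed walks of k hyperedges, only the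
   hypertree-like walks survive in expectation; two walks sharing a hyperedge
   lose a vertex, so the variance vanishes.  The limiting k-th moments grow at
   most like C^k k!, which makes the Hamburger problem determinate: a bounded
   continuous f can be squeezed between polynomials f = Q +- W with the moment
   functional of W small.  Existence of the limit law follows from positivity of
   the moment functional, itself a limit of expected traces of finite atomic
   models.  Walks around a star give even moments larger than those of any
   bounded law, and a single walk of length three detects theta when p >= 3.

   The same atomic models bound the mass of the limit law away from 0 by a
   multiple of B^(-alpha (2 - s) / 2) for some s in (alpha, 2): since M2 grows
   like B^(2 - alpha), the limit in part 2 is the Dirac mass at 0. *)
Require Import Defs.
From HB Require Import structures.
From mathcomp Require Import all_boot all_order all_algebra finmap.
From mathcomp Require Import fingroup perm complex.
From mathcomp Require Import all_classical all_reals all_analysis.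
From mathcomp Require Import measurable_realfun.
From mathcomp Require Import ring lra zify.
Import Order.TTheory GRing.Theory Num.Theory.
Import numFieldNormedType.Exports.
Set Implicit Arguments.
Unset Strict Implicit.
Unset Printing Implicit Defensive.
Local Open Scope classical_set_scope.
Local Open Scope ring_scope.

(** * Polynomial approximation under factorial moment growth *)

(** Squeezing with respect to the moment functional alone, before any measure is known, serves three
    purposes: it makes the upper extension of the functional linear (existence), it separates laws
    (determinacy), and it transfers trace convergence to test functions. It rests on a substitution:
    the Taylor polynomials of sin (s y) converge in the functional as soon as 2 s C < 1, and a
    bounded continuous f is close to a polynomial in sin (s y) up to an error of order s^2 y^2. The
    obstacle to positivity is centring: the moment sequence to be realised vanishes at order 1,
    whereas discretisations of the asymmetric measure behind its other terms have a nonzero mean.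
    One further atom repairs this, with rate 2^i and position of order 2^-i: it cancels the first
    moment and disappears from all higher ones as i grows. Its absolute moment of order s disappears
    too when s > 1, which together with alpha < s < 2 leads to s = (alpha + 2) / 2. Throughout p = q
    + 2, dimensions are written N + 1, and n = (N + 1)^(q + 1). *)

Section Weierstrass.
Context {R : realType}.
Implicit Types (f : R -> R) (g : nat -> R).

(** The value at x is the mean of g (S) for S binomial with parameters n and x, conditioned on the
    first toss. With this recursion linearity, monotonicity and the first two moments come by
    induction, without binomial coefficients. *)
Fixpoint bernstein n g : {poly R} :=
  if n is n'.+1 then 'X * bernstein n' (g \o S) + (1 - 'X) * bernstein n' g
  else (g 0%N)%:P.

Lemma bernstein_rec n g x : (bernstein n.+1 g).[x] =
  x * (bernstein n (g \o S)).[x] + (1 - x) * (bernstein n g).[x].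
Proof. by rewrite /= !hornerE. Qed.

Lemma bernstein_linear n g g' a x :
  (bernstein n (fun k => a * g k + g' k)).[x] =
  a * (bernstein n g).[x] + (bernstein n g').[x].
Proof.
elim: n g g' => [|n IH] g g'; first by rewrite /= !hornerC.
by rewrite !bernstein_rec (IH (g \o S) (g' \o S)) IH; ring.
Qed.

Lemma bernstein_const n a x : (bernstein n (fun=> a)).[x] = a.
Proof.
elim: n => [|n IH]; first by rewrite /= hornerC.
by rewrite bernstein_rec [_ \o S](_ : _ = (fun=> a))// IH; ring.
Qed.

Lemma bernstein_id n x : (bernstein n (fun k => k%:R)).[x] = n%:R * x.
Proof.
elim: n => [|n IH]; first by rewrite /= hornerC mul0r.
have E : (fun k => k%:R : R) \o S = (fun k => 1 * k%:R + 1).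
  by apply/funext => k /=; rewrite mul1r -natr1.
by rewrite bernstein_rec E bernstein_linear bernstein_const IH -natr1; ring.
Qed.

Lemma bernstein_sqr n x : (bernstein n (fun k => k%:R ^+ 2)).[x] =
  n%:R * x + n%:R * (n%:R - 1) * x ^+ 2.
Proof.
elim: n => [|n IH]; first by rewrite /= hornerC !mul0r addr0 expr0n.
have E : (fun k => k%:R ^+ 2 : R) \o S =
    (fun k => 1 * k%:R ^+ 2 + (2 * k%:R + 1)).
  by apply/funext => k /=; rewrite -natr1; ring.
rewrite bernstein_rec E !bernstein_linear bernstein_const bernstein_id IH.
by rewrite -natr1; ring.
Qed.

Lemma bernstein_le n g g' x : 0 <= x <= 1 ->
  (forall k, (k <= n)%N -> g k <= g' k) ->
  (bernstein n g).[x] <= (bernstein n g').[x].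
Proof.
move=> /andP[x0 x1]; elim: n g g' => [|n IH] g g' gg'.
  by rewrite /= !hornerC gg'.
rewrite !bernstein_rec lerD// ler_wpM2l// ?subr_ge0// IH// => k kn.
  exact: gg'.
by apply: gg'; rewrite ltnW.
Qed.

Lemma bernstein_variance n x : (0 < n)%N ->
  (bernstein n (fun k => (k%:R / n%:R - x) ^+ 2)).[x] = x * (1 - x) / n%:R.
Proof.
move=> n0; have n0' : n%:R != 0 :> R by rewrite pnatr_eq0 -lt0n.
have -> : (fun k => (k%:R / n%:R - x) ^+ 2) =
    (fun k => n%:R ^- 2 * k%:R ^+ 2 + (- (2 * x / n%:R) * k%:R + x ^+ 2)).
  by apply/funext => k; field.
rewrite !bernstein_linear bernstein_sqr bernstein_id bernstein_const.
by field.
Qed.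

Lemma exists_div_le (c e : R) : 0 <= c -> 0 < e ->
  exists2 n : nat, (0 < n)%N & c / n%:R <= e.
Proof.
move=> c0 e0; have ce0 : 0 <= c / e by rewrite divr_ge0// ltW.
have ce := archi_boundP ce0.
exists (Num.Def.archi_bound (c / e)).
  by rewrite -(ltr_nat R) (le_lt_trans ce0).
rewrite ler_pdivrMr ?(le_lt_trans ce0)// mulrC -ler_pdivrMr//.
exact: ltW.
Qed.

(** Bernstein's proof. By uniform continuity the error is dominated by e / 2 plus a quadratic in k /
    n - x, and the binomial variance of k / n is at most 1 / n. *)
Lemma weierstrass01 f (e : R) : {within `[0, 1], continuous f} -> 0 < e ->
  exists q : {poly R}, forall x : R, 0 <= x <= 1 -> `|f x - q.[x]| <= e.
Proof.
move=> cf e0.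
have e20 : 0 < e / 2 by rewrite divr_gt0.
have cK : compact (`[0, 1] : set R) by exact: segment_compact.
have [M0 fM0] : exists M : R, forall x : R, 0 <= x <= 1 -> `|f x| <= M.
  have [M [_ HM]] := compact_bounded (continuous_compact cf cK).
  exists (M + 1) => x x01; apply: (HM (M + 1)); first by rewrite ltrDl.
  by exists x => //=; rewrite in_itv.
(* Uniform continuity by contradiction: pairs at distance below 1 / (n + 1) on which f varies by
   more than e / 2 accumulate at a point l, where continuity fails. *)
have [d d0 fd] : exists2 d : R, 0 < d & forall x y : R, 0 <= x <= 1 ->
    0 <= y <= 1 -> `|x - y| < d -> `|f x - f y| <= e / 2.
  apply: contrapT => nd.
  have P (n : nat) : exists z : R * R, [/\ 0 <= z.1 <= 1, 0 <= z.2 <= 1,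
      `|z.1 - z.2| < n.+1%:R^-1 & e / 2 < `|f z.1 - f z.2|].
    apply: contrapT => nP; apply: nd; exists n.+1%:R^-1 => // x y x01 y01 xy.
    rewrite leNgt; apply/negP => efxy; apply: nP.
    by exists (x, y).
  have [z zP] := choice P.
  have [l l01 lc] : exists2 l : R, 0 <= l <= 1 & cluster (fst \o z @ \oo) l.
    have [|l [/= l01 cl]] := cK (fst \o z @ \oo) _.
      by exists 0%N => // n _ /=; have [] := zP n; rewrite in_itv.
    by exists l => //; move: l01; rewrite /= in_itv.
  have fl : f x @[x --> within `[0, 1] (nbhs l)] --> f l.
    by have := cf l; rewrite /continuous_at/= nbhs_subspace_in//= in_itv.
  have e40 : 0 < e / 4 by rewrite divr_gt0.
  have /nbhs_ballP[r /= r0 rP] : nbhs l [set x | 0 <= x <= 1 -> `|f l - f x| < e / 4].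
    move/cvgrPdist_lt : fl => /(_ _ e40); rewrite near_withinE.
    by apply: filterS => x + x01; apply; rewrite /= in_itv.
  have r20 : 0 < r / 2 by rewrite divr_gt0.
  have [n [nl nr]] : exists n, `|l - (z n).1| < r / 2 /\ n.+1%:R^-1 < r / 2.
    have Hn : \forall n \near \oo, n.+1%:R^-1 < r / 2.
      exact: near_infty_natSinv_lt (PosNum r20).
    have [y [/= [n Pn <-] yl]] := lc [set (z n).1 | n in [set n | n.+1%:R^-1 < r / 2]]
        (ball l (r / 2))
        (@filterS _ _ _ _ _ (fun n Hn => ex_intro2 _ _ n Hn erefl) Hn)
        (nbhsx_ballx l _ r20).
    by exists n; split.
  have [z1 z2 z12 zf] := zP n.
  have A1 : `|f l - f (z n).1| < e / 4.
    by apply: rP => //; rewrite /ball/= (lt_trans nl)// ltr_pdivrMr// ltr_pMr// ltr1n.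
  have A2 : `|f l - f (z n).2| < e / 4.
    apply: rP => //; rewrite /ball/=.
    rewrite (_ : l - _ = (l - (z n).1) + ((z n).1 - (z n).2)); last by ring.
    by rewrite (le_lt_trans (ler_normD _ _))// [r in _ < r]splitr ltrD// (lt_trans z12).
  have : `|f (z n).1 - f (z n).2| < e / 2.
    rewrite (_ : _ - _ = (f l - f (z n).2) - (f l - f (z n).1)); last by ring.
    rewrite (le_lt_trans (ler_normB _ _))//.
    by rewrite (_ : e / 2 = e / 4 + e / 4) ?ltrD//; field.
  by rewrite ltNge ltW.
have M00 : 0 <= M0 by rewrite (le_trans _ (fM0 0 _))// lexx ler01.
(* Chosen so that c d^2 = 2 M0: the quadratic covers the oscillation of f when k / n is at distance
   at least d from x. *)
pose c := 2 * M0 / d ^+ 2.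
have c0 : 0 <= c by rewrite /c; apply: divr_ge0; [apply: mulr_ge0|exact: sqr_ge0].
have [n n0 cn] := exists_div_le c0 e20.
have nR0 : 0 < n%:R :> R by rewrite ltr0n.
exists (bernstein n (fun k => f (k%:R / n%:R))) => x x01.
have key k : (k <= n)%N ->
    `|f x - f (k%:R / n%:R)| <= c * (k%:R / n%:R - x) ^+ 2 + e / 2.
  move=> kn; have kn01 : 0 <= (k%:R / n%:R : R) <= 1.
    by rewrite divr_ge0//= ler_pdivrMr// mul1r ler_nat.
  have [xk|xk] := ltP `|x - k%:R / n%:R| d.
    by rewrite (le_trans (fd _ _ _ _ xk))// lerDr mulr_ge0// sqr_ge0.
  rewrite ler_wpDr ?(ltW e20)//; apply: (le_trans (ler_normB _ _)).
  rewrite (@le_trans _ _ (M0 + M0))// ?lerD ?fM0//.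
  rewrite (_ : M0 + M0 = c * d ^+ 2); last first.
    by rewrite /c; field; rewrite gt_eqF.
  by rewrite ler_wpM2l// -[leRHS]real_normK ?num_real// distrC ler_sqr ?nnegrE// ltW.
have up : f x - (bernstein n (fun k => f (k%:R / n%:R))).[x] <= e /\
   - (f x - (bernstein n (fun k => f (k%:R / n%:R))).[x]) <= e.
  have B : (bernstein n (fun k => c * (k%:R / n%:R - x) ^+ 2 + e / 2)).[x] <= e.
    rewrite bernstein_linear bernstein_variance// bernstein_const.
    rewrite [leRHS]splitr lerD2r (le_trans _ cn)// ler_wpM2l// ler_piMl ?invr_ge0//.
    by case/andP: x01 => x0 x1; rewrite mulr_ile1// ?subr_ge0// lerBlDr lerDl.
  have E a : a * (bernstein n (fun k => f (k%:R / n%:R))).[x] - a * f x =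
      (bernstein n (fun k => a * f (k%:R / n%:R) + (- (a * f x)))).[x].
    by rewrite (bernstein_linear _ _ (fun=> _)) bernstein_const.
  split; apply: le_trans B.
    rewrite (_ : _ - _ = (- 1) * (bernstein n (fun k => f (k%:R / n%:R))).[x] - (- 1) * f x); last by ring.
    rewrite E bernstein_le// => k kn; rewrite (le_trans _ (key k kn))//.
    by rewrite (le_trans _ (ler_norm _))// mulN1r mulN1r opprK addrC.
  rewrite (_ : - _ = 1 * (bernstein n (fun k => f (k%:R / n%:R))).[x] - 1 * f x); last by ring.
  rewrite E bernstein_le// => k kn; rewrite (le_trans _ (key k kn))//.
  by rewrite distrC (le_trans _ (ler_norm _))// !mul1r.
by rewrite ler_norml lerNl; case: up => -> ->.
Qed.

Lemma weierstrass f (a e : R) : continuous f -> 0 < a -> 0 < e ->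
  exists q : {poly R}, forall x, `|x| <= a -> `|f x - q.[x]| <= e.
Proof.
move=> cf a0 e0.
have cg : continuous (fun x => f (2 * a * x - a)).
  move=> x; apply: (@continuous_comp _ _ _ (fun x => 2 * a * x - a) f); last exact: cf.
  by apply: cvgB; [apply: cvgM; [exact: cvg_cst|exact: cvg_id]|exact: cvg_cst].
have [q qP] := weierstrass01 (continuous_subspaceT cg) e0.
exists (q \Po ((2 * a)^-1 *: 'X + 2^-1%:P)) => x xa.
rewrite horner_comp !hornerE.
have {1}-> : x = 2 * a * ((2 * a)^-1 * x + 2^-1) - a.
  by field; rewrite gt_eqF.
apply: qP; move: xa; rewrite ler_norml => /andP[xa1 xa2].
have -> : (2 * a)^-1 * x + 2^-1 = (x + a) / (2 * a) by field; rewrite gt_eqF.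
by rewrite divr_ge0 ?ler_pdivrMr//=; nra.
Qed.

End Weierstrass.

(** * Moment functionals on polynomials *)

Section linear_functional.
Context {R : realType}.
Implicit Types (m : nat -> R) (P Q W V : {poly R}).

(** The Riesz functional of the sequence m, defined whether or not m comes from a measure. *)
Definition Lin m Q : R := \sum_(i < size Q) Q`_i * m i.

Lemma LinE m Q n : (size Q <= n)%N -> Lin m Q = \sum_(i < n) Q`_i * m i.
Proof.
move=> Qn; rewrite /Lin (big_ord_widen _ (fun i => Q`_i * m i) Qn).
rewrite big_mkcond /=; apply: eq_bigr => i _.
by case: ltnP => // /(nth_default 0) ->; rewrite mul0r.
Qed.

Lemma LinD m P Q : Lin m (P + Q) = Lin m P + Lin m Q.
Proof.
pose n := maxn (size P) (size Q).
rewrite (@LinE m _ n) ?size_polyD// (@LinE m P n) ?leq_maxl//.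
rewrite (@LinE m Q n) ?leq_maxr// -big_split /=.
by apply: eq_bigr => i _; rewrite coefD mulrDl.
Qed.

Lemma LinZ m a Q : Lin m (a *: Q) = a * Lin m Q.
Proof.
rewrite (@LinE m _ (size Q)) ?size_scale_leq// /Lin mulr_sumr.
by apply: eq_bigr => i _; rewrite coefZ mulrA.
Qed.

Lemma LinN m Q : Lin m (- Q) = - Lin m Q.
Proof. by rewrite -scaleN1r LinZ mulN1r. Qed.

Lemma LinB m P Q : Lin m (P - Q) = Lin m P - Lin m Q.
Proof. by rewrite LinD LinN. Qed.

Lemma Lin0 m : Lin m 0 = 0.
Proof. by rewrite /Lin size_poly0 big_ord0. Qed.

Lemma LinXn m n : Lin m 'X^n = m n.
Proof.
rewrite /Lin size_polyXn big_ord_recr /= coefXn eqxx mul1r big1 ?add0r// => i _.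
by rewrite coefXn ltn_eqF ?mul0r// ltn_ord.
Qed.

Lemma LinC m a : Lin m a%:P = a * m 0%N.
Proof. by rewrite -mul_polyC mulr1 || rewrite -[a%:P]mulr1 mul_polyC -(expr0 'X) LinZ LinXn. Qed.

Lemma Lin_sum m (I : Type) (r : seq I) (F : I -> {poly R}) :
  Lin m (\sum_(i <- r) F i) = \sum_(i <- r) Lin m (F i).
Proof.
by elim/big_rec2 : _ => [|i y1 y2 _ IH]; rewrite ?Lin0// LinD IH.
Qed.

Lemma cvg_sum_seq (I J : Type) (F : set_system I) (FF : Filter F)
    (r : seq J) (u : J -> I -> R) (l : J -> R) :
  (forall j, u j i @[i --> F] --> l j) ->
  \sum_(j <- r) u j i @[i --> F] --> \sum_(j <- r) l j.
Proof.
move=> ul; elim: r => [|j r IH].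
  under eq_fun do rewrite big_nil.
  by rewrite big_nil; exact: cvg_cst.
under eq_fun do rewrite big_cons.
by rewrite big_cons; exact: cvgD.
Qed.

Lemma cvg_prod_seq (I J : Type) (F : set_system I) (FF : Filter F)
    (r : seq J) (u : J -> I -> R) (l : J -> R) :
  (forall j, u j i @[i --> F] --> l j) ->
  \prod_(j <- r) u j i @[i --> F] --> \prod_(j <- r) l j.
Proof.
move=> ul; elim: r => [|j r IH].
  under eq_fun do rewrite big_nil.
  by rewrite big_nil; exact: cvg_cst.
under eq_fun do rewrite big_cons.
by rewrite big_cons; exact: cvgM.
Qed.

Lemma cvg_Lin (I : Type) (F : set_system I) (FF : Filter F)
    (u : I -> nat -> R) m Q :
  (forall k, u i k @[i --> F] --> m k) -> Lin (u i) Q @[i --> F] --> Lin m Q.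
Proof.
move=> um; rewrite /Lin.
by apply: cvg_sum_seq => k; apply: cvgM; [exact: cvg_cst|exact: um].
Qed.

End linear_functional.

(** * Taylor bounds for sine and cosine *)

Section sine_remainder.
Context {R : realType}.
Implicit Types x : R.

Definition sinT n : {poly R} :=
  \sum_(i < n) ((-1) ^+ i / (i.*2.+1)`!%:R) *: 'X^(i.*2.+1).
Definition cosT n : {poly R} :=
  \sum_(i < n) ((-1) ^+ i / (i.*2)`!%:R) *: 'X^(i.*2).

Let fact_neq0 k : k`!%:R != 0 :> R.
Proof. by rewrite pnatr_eq0 -lt0n fact_gt0. Qed.

Let fact_div (a : R) k : a / k.+1`!%:R *+ k.+1 = a / k`!%:R.
Proof.
have z0 : k.+1%:R != 0 :> R by rewrite pnatr_eq0.
rewrite -mulr_natr factS natrM; move: z0 (fact_neq0 k).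
by move: k.+1%:R k`!%:R => z f z0 f0; field; rewrite z0 f0.
Qed.

Lemma deriv_sinT n : (sinT n)^`() = cosT n.
Proof.
rewrite raddf_sum; apply: eq_bigr => i _ /=.
rewrite derivZ derivXn /= -scalerMnr scalerMnl; congr (_ *: _).
exact: fact_div.
Qed.

Lemma deriv_cosT n : (cosT n.+1)^`() = - sinT n.
Proof.
rewrite raddf_sum big_ord_recl /= expr0 derivZ derivC scaler0 add0r -sumrN.
apply: eq_bigr => i _ /=.
rewrite derivZ doubleS derivXn /= -scalerMnr scalerMnl -scaleNr; congr (_ *: _).
by rewrite fact_div exprS mulN1r mulNr.
Qed.

Lemma le_of_derive (f g f' g' : R -> R) :
  (forall x : R, is_derive x (1 : R) f (f' x)) ->
  (forall x : R, is_derive x (1 : R) g (g' x)) ->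
  f 0 <= g 0 -> (forall x, 0 <= x -> f' x <= g' x) ->
  forall x, 0 <= x -> f x <= g x.
Proof.
move=> df dg fg0 fg' x x0.
have dh (y : R) : is_derive y (1 : R) (g - f) (g' y - f' y) by exact: is_deriveB.
have ch : continuous (g - f).
  by move=> y; apply/differentiable_continuous/derivable1_diffP; case: (dh y).
rewrite -subr_ge0 (le_trans (_ : 0 <= g 0 - f 0))// ?subr_ge0//.
apply: (@ger0_derive1_le_cc _ (g - f) 0 x _ _ _ 0 x); rewrite ?in_itv/= ?lexx ?x0//.
- move=> y; rewrite in_itv/= => /andP[y0 _].
  by rewrite derive1E (derive_val (is_derive := dh y)) subr_ge0 fg'// ltW.
- exact: continuous_subspaceT.
Qed.

(** Each remainder is, up to sign, the derivative of the next, and those that are integrated vanish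
    at 0; the bounds follow from one another by comparing derivatives on the positive half-line,
    starting from |cos| <= 1. *)
Lemma sin_cos_remainder n x : 0 <= x ->
  `|cos x - (cosT n).[x]| <= x ^+ n.*2 / n.*2`!%:R /\
  `|sin x - (sinT n).[x]| <= x ^+ n.*2.+1 / n.*2.+1`!%:R.
Proof.
have dX k (y : R) : is_derive y (1 : R) (fun x : R => x ^+ k.+1 / k.+1`!%:R) (y ^+ k / k`!%:R).
  have -> : (fun x : R => x ^+ k.+1 / k.+1`!%:R) = horner (k.+1`!%:R^-1 *: 'X^(k.+1)).
    by apply/funext => z; rewrite !hornerE mulrC.
  apply: is_derive_eq; rewrite derivZ derivXn /= !hornerE hornerMn hornerXn.
  by rewrite [LHS]mulrC mulrnAl fact_div.
have dN (g g' : R -> R) : (forall y : R, is_derive y (1 : R) g (g' y)) ->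
   forall y : R, is_derive y (1 : R) (fun z => - g z) (- g' y).
  by move=> dg y; exact: is_deriveN.
have dS k (y : R) : is_derive y (1 : R) (fun z => sin z - (sinT k).[z]) (cos y - (cosT k).[y]).
  by rewrite -deriv_sinT; apply: is_deriveB.
have dC k (y : R) : is_derive y (1 : R) (fun z => cos z - (cosT k.+1).[z]) (- (sin y - (sinT k).[y])).
  have -> : - (sin y - (sinT k).[y]) = - sin y - (cosT k.+1)^`().[y].
    by rewrite deriv_cosT hornerN opprB opprK addrC.
  exact: is_deriveB.
have S0 k : (sinT k).[0] = 0.
  by rewrite horner_sum big1// => i _; rewrite !hornerE exprS mul0r mulr0.
have C0 k : (cosT k.+1).[0] = 1.
  rewrite horner_sum big_ord_recl big1 ?addr0; last first.
    by move=> i _; rewrite hornerZ hornerXn expr0n mulr0.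
  by rewrite /= expr0 fact0 divr1 scale1r hornerC.
elim: n x => [|n IH] x x0.
  have c1 y : 0 <= y -> `|cos y - (cosT 0).[y]| <= y ^+ 0.*2 / 0.*2`!%:R.
    move=> _; rewrite /cosT big_ord0 horner0 subr0.
    by rewrite expr0 fact0 divr1 cos_max.
  split; first exact: c1.
  have b y : 0 <= y -> - (y ^+ 0 / 0`!%:R) <= cos y - (cosT 0).[y] <= y ^+ 0 / 0`!%:R.
    by move=> /c1; rewrite ler_norml.
  rewrite ler_norml; apply/andP; split.
    rewrite lerNl; apply: (le_of_derive (dN _ _ (dS 0%N)) (dX 0%N)) => //.
      by rewrite S0 sin0 subr0 oppr0 expr0n mul0r.
    by move=> y /b /andP[]; rewrite lerNl.
  apply: (le_of_derive (dS 0%N) (dX 0%N)) => //.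
    by rewrite S0 sin0 subr0 expr0n mul0r.
  by move=> y /b /andP[].
have c1 y : 0 <= y -> `|cos y - (cosT n.+1).[y]| <= y ^+ n.+1.*2 / n.+1.*2`!%:R.
  move=> y0; have b z : 0 <= z ->
     - (z ^+ n.*2.+1 / n.*2.+1`!%:R) <= sin z - (sinT n).[z] <= z ^+ n.*2.+1 / n.*2.+1`!%:R.
    by move=> /IH[_]; rewrite ler_norml.
  rewrite ler_norml doubleS; apply/andP; split.
    rewrite lerNl; apply: (le_of_derive (dN _ _ (dC n)) (dX n.*2.+1)) => //.
      by rewrite C0 cos0 subrr oppr0 expr0n mul0r.
    by move=> z /b /andP[]; rewrite opprK.
  apply: (le_of_derive (dC n) (dX n.*2.+1)) => //.
    by rewrite C0 cos0 subrr expr0n mul0r.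
  by move=> z /b /andP[]; rewrite lerNl.
split; first exact: c1.
have b y : 0 <= y -> - (y ^+ n.+1.*2 / n.+1.*2`!%:R) <= cos y - (cosT n.+1).[y] <= y ^+ n.+1.*2 / n.+1.*2`!%:R.
  by move=> /c1; rewrite ler_norml.
rewrite ler_norml; apply/andP; split.
  rewrite lerNl; apply: (le_of_derive (dN _ _ (dS n.+1)) (dX n.+1.*2)) => //.
    by rewrite S0 sin0 subr0 oppr0 expr0n mul0r.
  by move=> y /b /andP[]; rewrite lerNl.
apply: (le_of_derive (dS n.+1) (dX n.+1.*2)) => //.
  by rewrite S0 sin0 subr0 expr0n mul0r.
by move=> y /b /andP[].
Qed.

Lemma sin_remainder n x :
  `|sin x - (sinT n).[x]| <= `|x| ^+ n.*2.+1 / n.*2.+1`!%:R.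
Proof.
have [x0|x0] := leP 0 x; first by rewrite (ger0_norm x0); case: (sin_cos_remainder n x0).
have -> : sin x - (sinT n).[x] = - (sin (- x) - (sinT n).[- x]).
  have -> : (sinT n).[- x] = - (sinT n).[x].
    rewrite !horner_sum -sumrN; apply: eq_bigr => i _; rewrite !hornerE.
    by rewrite !exprS -mul2n !exprM sqrrN mulNr mulrN.
  by rewrite sinN; ring.
rewrite normrN (ltr0_norm x0); case: (@sin_cos_remainder n (- x)) => //.
by rewrite oppr_ge0 ltW.
Qed.

End sine_remainder.

Section clamp.
Context {R : realType}.
Implicit Types a b u v : R.

Definition clamp a b u : R := Num.max a (Num.min u b).

Lemma clamp_itv a b u : a <= b -> a <= clamp a b u <= b.
Proof. by move=> ab; rewrite /clamp le_max lexx/= ge_max ab ge_min lexx orbT. Qed.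

Lemma clamp_id a b u : a <= u <= b -> clamp a b u = u.
Proof. by move=> /andP[au ub]; rewrite /clamp min_l// max_r. Qed.

Lemma clamp_le a b u : u <= a -> clamp a b u = a.
Proof. by move=> ua; rewrite /clamp max_l// ge_min ua. Qed.

Lemma clamp_ge a b u : a <= b -> b <= u -> clamp a b u = b.
Proof. by move=> ab bu; rewrite /clamp min_r// max_r. Qed.

Lemma continuous_clamp a b : continuous (clamp a b).
Proof.
move=> u.
have c1 : {for u, continuous (fun=> a : R^o)} by exact: cvg_cst.
have c2 : {for u, continuous (fun=> b : R^o)} by exact: cvg_cst.
have c3 : {for u, continuous (id : R -> R^o)} by exact: cvg_id.
exact: (continuous_max c1 (continuous_min c3 c2)).
Qed.

End clamp.

(** * Squeezing bounded continuous functions between polynomials *)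

Section polynomial_squeeze.
Context {R : realType}.
Variables (m : nat -> R) (C : R).
Hypothesis (C0 : 0 < C) (growth : forall k, `|m k| <= C ^+ k * k`!%:R).
Implicit Types (f g : R -> R) (Q W V : {poly R}).

(* The approximation must survive multiplication by any nonnegative polynomial
   V: this is what makes the class closed under products. *)
Definition squeezable f := forall V, (forall y, 0 <= V.[y]) ->
  forall e, 0 < e -> exists Q W,
    (forall y, `|f y - Q.[y]| <= W.[y]) /\ Lin m (V * W) <= e.

Lemma squeezable_poly Q : squeezable (horner Q).
Proof.
move=> V V0 e e0; exists Q, 0; split=> [y|]; first by rewrite subrr normr0 horner0.
by rewrite mulr0 Lin0 ltW.
Qed.

Lemma squeezableD f g : squeezable f -> squeezable g ->
  squeezable (fun y => f y + g y).
Proof.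
move=> sf sg V V0 e e0; have e20 : 0 < e / 2 by rewrite divr_gt0.
have [Q [W [fQ VW]]] := sf V V0 _ e20.
have [Q' [W' [gQ VW']]] := sg V V0 _ e20.
exists (Q + Q'), (W + W'); split=> [y|].
  rewrite !hornerD (_ : _ - _ = (f y - Q.[y]) + (g y - Q'.[y])); last by ring.
  by rewrite (le_trans (ler_normD _ _))// lerD.
by rewrite mulrDr LinD [leRHS]splitr lerD.
Qed.

(** Decompose u g - Q Q' = u (g - Q') + Q' (u - Q). Since |Q'| <= 1 + Q'^2, the factor u is squeezed
    with the weight V (1 + Q'^2), which is where the freedom of V is used; the other error only
    costs the bound K of u. *)
Lemma squeezableM (u g : R -> R) (K : R) : (forall y, `|u y| <= K) -> squeezable u ->
  squeezable g -> squeezable (fun y => u y * g y).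
Proof.
move=> uK su sg V V0 e e0; have e20 : 0 < e / 2 by rewrite divr_gt0.
have K0 : 0 <= K by rewrite (le_trans _ (uK 0)).
have K10 : 0 < K + 1 by rewrite ltr_wpDl.
have eK : 0 < e / 2 / (K + 1) by rewrite divr_gt0.
have [Q' [W' [gQ VW']]] := sg V V0 _ eK.
have V1 y : 0 <= (V * (1 + Q' ^+ 2)).[y].
  by rewrite !hornerE mulr_ge0// addr_ge0// sqr_ge0.
have [Q [W [uQ VW]]] := su _ V1 _ e20.
exists (Q * Q'), ((K + 1) *: W' + (1 + Q' ^+ 2) * W); split=> [y|].
  rewrite hornerM (_ : _ - _ = u y * (g y - Q'.[y]) + Q'.[y] * (u y - Q.[y])); last by ring.
  rewrite (le_trans (ler_normD _ _))// !normrM hornerD hornerZ hornerM lerD//.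
    by rewrite ler_pM// (le_trans (uK y))// lerDl.
  rewrite ler_pM// !hornerE; have := sqr_ge0 (`|Q'.[y]| - 1).
  by rewrite -[Q'.[y] ^+ 2]real_normK ?num_real//; have := normr_ge0 Q'.[y]; nra.
rewrite mulrDr mulrA -scalerAr LinD LinZ [leRHS]splitr lerD//.
by rewrite mulrC -ler_pdivlMr.
Qed.

Lemma squeezable_horner (u : R -> R) (K : R) Q : (forall y, `|u y| <= K) -> squeezable u ->
  squeezable (fun y => Q.[u y]).
Proof.
move=> uK su; elim/poly_ind: Q => [|Q c IH].
  have := @squeezable_poly 0; congr (squeezable _).
  by apply/funext => y; rewrite !horner0.
have -> : (fun y => (Q * 'X + c%:P).[u y]) =
    (fun y => u y * Q.[u y] + (c%:P).[y]).
  by apply/funext => y; rewrite !hornerE mulrC.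
by apply: squeezableD; [exact: squeezableM su IH|exact: squeezable_poly].
Qed.

(** The Taylor remainder is majorised by s^(2n) / (2n)! y^(2n) (1 + s^2 y^2), a polynomial.
    Factorial growth of m and (2n + i)! <= 2^(2n + i) (2n)! i! make (2n)! cancel, leaving (2 s
    C)^(2n) times a constant. *)
Lemma squeezable_sin (s : R) : 0 < s -> 2 * s * C < 1 ->
  squeezable (fun y => sin (s * y)).
Proof.
move=> s0 sC V V0 e e0.
pose V' := V * (1 + s ^+ 2 *: 'X^2).
(* Bounds the contribution of the weight [V'] uniformly in n; only the factor (2 s C)^(2n) depends
   on n. *)
pose b := \sum_(i < size V') `|V'`_i| * ((2 * C) ^+ i * i`!%:R).
have b0 : 0 <= b.
  by apply: sumr_ge0 => i _; rewrite !mulr_ge0// exprn_ge0// mulr_ge0// ltW.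
have sC0 : 0 <= 2 * s * C by rewrite !mulr_ge0// ltW.
have [n nb] : exists n, (2 * s * C) ^+ n.*2 * b <= e.
  have : (2 * s * C) ^+ n @[n --> \oo] --> (0 : R).
    by apply: cvg_expr; rewrite ger0_norm.
  have eb : 0 < e / (b + 1) by rewrite divr_gt0// ltr_wpDl.
  move=> /cvgrPdist_le /(_ _ eb)[n _ /(_ n.*2)]; rewrite /= -addnn leq_addr.
  move=> /(_ isT); rewrite sub0r normrN ger0_norm ?exprn_ge0// => H.
  exists n; rewrite -addnn (le_trans (ler_wpM2r b0 H))// mulrAC ler_pdivrMr ?ltr_wpDl//.
  by rewrite ler_pM2l// lerDl.
exists (sinT n \Po (s *: 'X)), ((s ^+ n.*2 / n.*2`!%:R) *: ('X^(n.*2) * (1 + s ^+ 2 *: 'X^2))).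
split=> [y|].
  have -> : (s ^+ n.*2 / n.*2`!%:R *: ('X^(n.*2) * (1 + s ^+ 2 *: 'X^2))).[y] =
      s ^+ n.*2 / n.*2`!%:R * (`|y| ^+ n.*2 * (1 + s ^+ 2 * y ^+ 2)).
    rewrite hornerZ hornerM hornerXn hornerD hornerZ hornerXn hornerC.
    by rewrite -normrX ger0_norm// -mul2n exprM exprn_ge0// sqr_ge0.
  rewrite horner_comp hornerZ hornerX (le_trans (sin_remainder _ _))//.
  rewrite factS natrM invfM exprS normrM (ger0_norm (ltW s0)) exprMn.
  have -> : s * `|y| * (s ^+ n.*2 * `|y| ^+ n.*2) * (n.*2.+1%:R^-1 / n.*2`!%:R) =
      s ^+ n.*2 / n.*2`!%:R * (`|y| ^+ n.*2 * (s * `|y| * n.*2.+1%:R^-1)).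
    by ring.
  rewrite ler_wpM2l ?divr_ge0 ?exprn_ge0 ?(ltW s0)// ler_wpM2l ?exprn_ge0//.
  have -> : y ^+ 2 = `|y| ^+ 2 by rewrite real_normK ?num_real.
  rewrite (@le_trans _ _ (s * `|y|))//.
    by rewrite ler_piMr ?mulr_ge0 ?(ltW s0)// invf_le1 ?ler1n.
  by have := sqr_ge0 (s * `|y| - 1); have := mulr_ge0 (ltW s0) (normr_ge0 y); nra.
rewrite -scalerAr LinZ mulrCA [X in Lin m X]mulrC -/V'.
rewrite (_ : Lin m _ = \sum_(i < size V') V'`_i * m (n.*2 + i)%N); last first.
  rewrite -[V' in LHS]coefK poly_def mulr_suml Lin_sum; apply: eq_bigr => i _.
  by rewrite -scalerAl -exprD LinZ LinXn addnC.
apply: le_trans nb; rewrite /b !mulr_sumr; apply: ler_sum => i _.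
rewrite mulrCA [leRHS]mulrCA (le_trans (ler_norm _))// normrM ler_wpM2l//.
rewrite normrM ger0_norm ?divr_ge0 ?exprn_ge0 ?(ltW s0)//.
rewrite (le_trans (ler_wpM2l _ (growth _)))// ?divr_ge0 ?exprn_ge0 ?(ltW s0)//.
have F : ((n.*2 + i)`!%:R : R) <= 2 ^+ (n.*2 + i) * n.*2`!%:R * i`!%:R.
  rewrite -natrX -!natrM ler_nat -mulnA.
  have := @bin_fact (n.*2 + i) n.*2 (leq_addr _ _); rewrite addKn => <-.
  rewrite leq_mul2r; apply/orP; right.
  by rewrite -[X in (_ <= X ^ _)%N]addn1 expnDn (bigD1 (inord n.*2 : 'I_(n.*2 + i).+1))//= inordK ?ltnS ?leq_addr// !exp1n !muln1 leq_addr.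
have f0 : 0 < n.*2`!%:R :> R by rewrite ltr0n fact_gt0.
apply: (@le_trans _ _ (s ^+ n.*2 / n.*2`!%:R * (C ^+ (n.*2 + i) * (2 ^+ (n.*2 + i) * n.*2`!%:R * i`!%:R)))).
  by rewrite ler_wpM2l ?divr_ge0 ?exprn_ge0 ?(ltW s0)// ler_wpM2l// exprn_ge0// ltW.
rewrite !exprMn !exprD le_eqVlt; apply/orP; left; apply/eqP.
by field; rewrite gt_eqF.
Qed.

(** Where |s y| <= 1/2, f is a continuous function h of sin (s y), and the Weierstrass theorem
    replaces h by a polynomial q. Elsewhere the error is bounded, hence at most a multiple of (2 s
    y)^2, whose image is of order s^2 because [m 2] does not depend on s. Finally q (sin (s y)) is
    squeezable. *)
Theorem polynomial_squeeze f (K e : R) : continuous f -> (forall y : R, `|f y| <= K) ->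
  0 < e -> exists Q W, (forall y, `|f y - Q.[y]| <= W.[y]) /\ Lin m W <= e.
Proof.
move=> cf fK e0.
have K0 : 0 <= K by rewrite (le_trans _ (fK 0)).
pose L := `|m 0%N| + 1.
have L0 : 0 < L by rewrite ltr_wpDl.
pose eta := Num.min 1 (e / (4 * L)).
have eta0 : 0 < eta by rewrite lt_min ltr01 divr_gt0// mulr_gt0.
pose D := 2 * K + 1; have D0 : 0 < D by rewrite ltr_wpDl// mulr_ge0.
pose t := e / (8 * D * (`|m 2%N| + 1)).
have t0 : 0 < t by rewrite divr_gt0// !mulr_gt0// ltr_wpDl.
(* The three bounds give in turn 2 s C <= 1/2, s^2 <= s, and a quadratic error of at most e / 2. *)
pose s := Num.min ((4 * C)^-1) (Num.min 1 t).
have s0 : 0 < s by rewrite !lt_min ltr01 t0 invr_gt0 !mulr_gt0.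
have sC : 2 * s * C < 1.
  apply: (@le_lt_trans _ _ (2 * (4 * C)^-1 * C)).
    by rewrite ler_pM2r// ler_pM2l// ge_min lexx.
  by rewrite (_ : _ * _ = 2^-1); [rewrite invf_lt1// ltr1n|field; rewrite gt_eqF].
(* Keeps the argument of arcsine inside (-1, 1), where it is continuous; nothing changes for |s y|
   <= 1/2 because |sin x| <= |x|. *)
pose cl : R -> R := clamp (- 2^-1) 2^-1.
have h2 : - 2^-1 <= 2^-1 :> R by rewrite lerNl; lra.
have clb u : -1 < cl u < 1.
  by have /andP[] := clamp_itv u h2; rewrite /cl; move: (clamp _ _ _) => z; lra.
have ccl : continuous cl by exact: continuous_clamp.
pose h u := f (asin (cl u) / s).
have ch : continuous h.
  move=> u; apply: (@continuous_comp _ _ _ (fun u => asin (cl u) / s) f); last exact: cf.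
  apply: cvgM; last exact: cvg_cst.
  apply: (@continuous_comp _ _ _ cl asin); first exact: ccl.
  exact/continuous_asin/clb.
have [q qh] := weierstrass ch (@ltr01 R) eta0.
have V1 y : 0 <= (1 : {poly R}).[y] by rewrite hornerC.
have e4 : 0 < e / 4 by rewrite divr_gt0.
have sin1 (y : R) : `|sin (s * y)| <= 1 by exact: sin_max.
have [Q [W [gQ VW]]] := squeezable_horner q sin1 (squeezable_sin s0 sC) V1 e4.
rewrite mul1r in VW.
have fg y : `|f y - q.[sin (s * y)]| <= eta + D * (4 * s ^+ 2 * y ^+ 2).
  have hq := qh _ (sin1 y).
  have [sy|sy] := leP `|s * y| 2^-1.
    suff <- : h (sin (s * y)) = f y.
      rewrite (le_trans hq)// lerDl; apply: mulr_ge0; first exact: ltW.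
      by apply: mulr_ge0; [apply: mulr_ge0; rewrite ?sqr_ge0|exact: sqr_ge0].
    have ub : `|sin (s * y)| <= 2^-1.
      have := sin_remainder 0 (s * y).
      rewrite /sinT big_ord0 horner0 subr0 double0 expr1 (_ : 1`! = 1)%N// divr1.
      by move=> /le_trans; apply.
    rewrite /h (_ : cl (sin (s * y)) = sin (s * y)); last first.
      by apply: clamp_id; rewrite -ler_norml.
    rewrite sinK; first by rewrite mulrAC mulfV ?mul1r ?gt_eqF.
    rewrite in_itv/= -ler_norml (le_trans sy)//.
    have := pi_ge2 R; move: (pi : R) => p p2; lra.
  apply: (@le_trans _ _ (K + (K + eta))).
    rewrite (le_trans (ler_normB _ _))// lerD//.
    rewrite (_ : q.[_] = h (sin (s * y)) - (h (sin (s * y)) - q.[sin (s * y)])); last by ring.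
    by rewrite (le_trans (ler_normB _ _))//; apply: lerD => //; exact: fK.
  have -> : 4 * s ^+ 2 * y ^+ 2 = (2 * `|s * y|) ^+ 2.
    by rewrite exprMn real_normK ?num_real//; ring.
  have : 1 <= (2 * `|s * y|) ^+ 2 by rewrite exprn_ege1//; lra.
  by rewrite /D; nra.
exists Q, ((eta%:P + (D * (4 * s ^+ 2)) *: 'X^2) + W); split=> [y|].
  rewrite (_ : f y - _ = (f y - q.[sin (s * y)]) + (q.[sin (s * y)] - Q.[y])); last by ring.
  rewrite hornerD (le_trans (ler_normD _ _))//; apply: lerD => //.
  by rewrite hornerD hornerC hornerZ hornerXn -mulrA fg.
rewrite !LinD LinC LinZ LinXn.
have A1 : eta * m 0%N <= e / 4.
  apply: (@le_trans _ _ (eta * L)).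
    by rewrite ler_pM2l// /L (le_trans (ler_norm _))// lerDl.
  apply: (@le_trans _ _ (e / (4 * L) * L)); last by rewrite le_eqVlt; apply/orP; left; apply/eqP; field; rewrite gt_eqF.
  by rewrite ler_pM2r// ge_min lexx orbT.
have A2 : D * (4 * s ^+ 2) * m 2%N <= e / 2.
  have s1 : s <= 1 by rewrite !ge_min lexx orbT.
  have st : s <= t by rewrite !ge_min lexx !orbT.
  have m2 : 0 < `|m 2%N| + 1 by rewrite ltr_wpDl.
  apply: (@le_trans _ _ (D * (4 * t) * (`|m 2%N| + 1))).
    apply: (@le_trans _ _ (D * (4 * s ^+ 2) * (`|m 2%N| + 1))).
      rewrite ler_wpM2l//; first by rewrite ltW// !mulr_gt0.
      by rewrite (le_trans (ler_norm _))// lerDl.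
    rewrite ler_pM2r// ler_pM2l// ler_pM2l// (le_trans _ st)//.
    by rewrite expr2 ler_piMl// ltW.
  rewrite /t le_eqVlt; apply/orP; left; apply/eqP; field.
  by rewrite !gt_eqF.
by lra.
Qed.

End polynomial_squeeze.

(** * The Hamburger moment problem *)

Section bounded_measurable.
Context {R : realType} d (T : measurableType d) (P : probability T R).
Implicit Types f g : T -> R.

Definition bdm f := measurable_fun setT f /\ exists K, forall x, `|f x| <= K.

Lemma bdm_integrable f : bdm f -> P.-integrable setT (EFin \o f).
Proof.
move=> [mf [K fK]]; apply: measurable_bounded_integrable => //.
  by rewrite [X in (X < _)%E](_ : _ = 1%E) ?ltry//; exact: probability_setT.
exists K; split; first exact: num_real.
by move=> x Kx y _ /=; rewrite (le_trans (fK y))// ltW.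
Qed.

Lemma bdm_cst c : bdm (fun=> c).
Proof. by split; [exact: measurable_cst|exists `|c|]. Qed.

Lemma bdmD f g : bdm f -> bdm g -> bdm (fun x => f x + g x).
Proof.
move=> [mf [K fK]] [mg [L gL]]; split; first exact: measurable_funD.
by exists (K + L) => x; rewrite (le_trans (ler_normD _ _))// lerD.
Qed.

Lemma bdmM f g : bdm f -> bdm g -> bdm (fun x => f x * g x).
Proof.
move=> [mf [K fK]] [mg [L gL]]; split; first exact: measurable_funM.
by exists (K * L) => x; rewrite normrM ler_pM.
Qed.

Lemma bdmZ c f : bdm f -> bdm (fun x => c * f x).
Proof. by apply: bdmM; exact: bdm_cst. Qed.

Lemma bdmB f g : bdm f -> bdm g -> bdm (fun x => f x - g x).
Proof.
move=> bf bg; rewrite (_ : (fun _ => _) = (fun x => f x + (-1) * g x)).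
  by apply: bdmD => //; exact: bdmZ.
by apply/funext => x; rewrite mulN1r.
Qed.

Lemma bdmX f k : bdm f -> bdm (fun x => f x ^+ k).
Proof.
move=> bf; elim: k => [|k IH].
  by rewrite (_ : (fun _ => _) = (fun=> 1)) //; exact: bdm_cst.
by under eq_fun do rewrite exprS; exact: bdmM.
Qed.

Lemma bdm_norm f : bdm f -> bdm (fun x => `|f x|).
Proof.
move=> [mf [K fK]]; split; first exact: measurableT_comp.
by exists K => x; rewrite normr_id.
Qed.

Lemma bdm_sum (I : Type) (r : seq I) (A : pred I) (F : I -> T -> R) :
  (forall i, A i -> bdm (F i)) -> bdm (fun x => \sum_(i <- r | A i) F i x).
Proof.
move=> bF; elim: r => [|i r IH].
  by under eq_fun do rewrite big_nil; exact: bdm_cst.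
under eq_fun do rewrite big_cons.
by case: (boolP (A i)) => // Ai; apply: bdmD => //; exact: bF.
Qed.

Lemma bdm_prod (I : eqType) (r : seq I) (F : I -> T -> R) :
  (forall i, i \in r -> bdm (F i)) -> bdm (fun x => \prod_(i <- r) F i x).
Proof.
elim: r => [|i r IH] bF.
  by under eq_fun do rewrite big_nil; exact: bdm_cst.
under eq_fun do rewrite big_cons.
apply: bdmM; first by apply: bF; rewrite mem_head.
by apply: IH => j jr; apply: bF; rewrite in_cons jr orbT.
Qed.

Lemma bdm_indic (A : set T) : measurable A -> bdm (\1_A : T -> R).
Proof.
move=> mA; split; first exact: measurable_indic.
by exists 1 => x; rewrite indicE; case: (x \in A); rewrite ?normr1 ?normr0.
Qed.

Lemma integral_bdmD f g : bdm f -> bdm g ->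
  \int[P]_x (f x + g x) = \int[P]_x f x + \int[P]_x g x.
Proof. by move=> bf bg; rewrite RintegralD//; exact: bdm_integrable. Qed.

Lemma integral_bdmZ c f : bdm f -> \int[P]_x (c * f x) = c * \int[P]_x f x.
Proof. by move=> bf; rewrite RintegralZl//; exact: bdm_integrable. Qed.

Lemma integral_bdmB f g : bdm f -> bdm g ->
  \int[P]_x (f x - g x) = \int[P]_x f x - \int[P]_x g x.
Proof. by move=> bf bg; rewrite RintegralB//; exact: bdm_integrable. Qed.

Lemma integral_cst1 c : \int[P]_x c = c.
Proof. rewrite Rintegral_cst// [X in fine X](_ : _ = 1%E) ?mulr1//; exact: probability_setT. Qed.

Lemma integral_bdm_sum (I : Type) (r : seq I) (A : pred I) (F : I -> T -> R) :
  (forall i, A i -> bdm (F i)) ->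
  \int[P]_x (\sum_(i <- r | A i) F i x) = \sum_(i <- r | A i) \int[P]_x F i x.
Proof.
move=> bF; elim: r => [|i r IH].
  by under eq_Rintegral do rewrite big_nil; rewrite big_nil integral_cst1.
under eq_Rintegral do rewrite big_cons; rewrite big_cons -IH.
case: (boolP (A i)) => // Ai; rewrite integral_bdmD//; first exact: bF.
exact: bdm_sum.
Qed.

Lemma le_integral_bdm f g : bdm f -> bdm g -> (forall x, f x <= g x) ->
  \int[P]_x f x <= \int[P]_x g x.
Proof. by move=> bf bg fg; apply: le_Rintegral => //; exact: bdm_integrable. Qed.

Lemma integral_bdm_dist f g e : bdm f -> bdm g ->
  (forall x, `|f x - g x| <= e) -> `|\int[P]_x f x - \int[P]_x g x| <= e.
Proof.
move=> bf bg fge; rewrite -integral_bdmB//.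
have bfg := bdmB bf bg.
rewrite (le_trans (le_normr_Rintegral _ (bdm_integrable bfg)))//.
rewrite -[leRHS]integral_cst1; apply: le_integral_bdm => //.
  exact: bdm_norm.
exact: bdm_cst.
Qed.

Lemma integral_indic1 (A : set T) : measurable A ->
  \int[P]_x (\1_A x) = fine (P A).
Proof. by move=> mA; rewrite /Rintegral integral_indic// setIT. Qed.

Lemma integral_bdm_ge0 f : (forall x, 0 <= f x) -> 0 <= \int[P]_x f x.
Proof. by move=> f0; apply: Rintegral_ge0. Qed.

End bounded_measurable.

Section ramp.
Context {R : realType}.
Implicit Types (x y e : R) (f g : R -> R).

Definition bcont f := continuous f /\ exists K, forall y, `|f y| <= K.

Lemma bcont_bdm f : bcont f -> bdm f.
Proof. by move=> [cf fK]; split => //; exact: continuous_measurable_fun. Qed.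

Lemma bcont_cst c : bcont (fun=> c).
Proof. by split; [move=> x; exact: cvg_cst|exists `|c|]. Qed.

Lemma bcont_lin c f g : bcont f -> bcont g -> bcont (fun y => c * f y + g y).
Proof.
move=> [cf [K fK]] [cg [L gL]]; split.
  by move=> y; apply: cvgD; [apply: cvgM; [exact: cvg_cst|exact: cf]|exact: cg].
exists (`|c| * K + L) => y; rewrite (le_trans (ler_normD _ _))// lerD//.
by rewrite normrM ler_wpM2l.
Qed.

(** Lies between the indicators of (-oo, x] and of (-oo, x + e], and is continuous: the link between
    distribution functions and continuous test functions. *)
Definition ramp x e y := clamp 0 1 ((x + e - y) / e).

Lemma ramp_itv x e y : 0 <= ramp x e y <= 1.
Proof. exact: clamp_itv. Qed.

Lemma ramp1 x e y : 0 < e -> y <= x -> ramp x e y = 1.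
Proof.
move=> e0 yx; apply: clamp_ge => //.
by rewrite ler_pdivlMr// mul1r; lra.
Qed.

Lemma ramp0 x e y : 0 < e -> x + e <= y -> ramp x e y = 0.
Proof.
move=> e0 yx; apply: clamp_le => //.
by rewrite ler_pdivrMr// mul0r; lra.
Qed.

Lemma bcont_ramp x e : bcont (ramp x e).
Proof.
split; last by exists 1 => y; rewrite ger0_norm; case/andP: (ramp_itv x e y).
move=> y; apply: (@continuous_comp _ _ _ (fun y => (x + e - y) / e) (clamp 0 1)).
  by apply: cvgM; [apply: cvgB; [exact: cvg_cst|exact: cvg_id]|exact: cvg_cst].
exact: continuous_clamp.
Qed.

Lemma ramp_le x e x' e' y : 0 < e -> 0 < e' -> x + e <= x' ->
  ramp x e y <= ramp x' e' y.
Proof.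
move=> e0 e'0 xx'; have [yx|yx] := leP y x'.
  by rewrite (ramp1 e'0)//; case/andP: (ramp_itv x e y).
by rewrite (ramp0 e0); [case/andP: (ramp_itv x' e' y)|rewrite (le_trans xx')// ltW].
Qed.

End ramp.

(** * Functionals determined by a distribution function *)

Section cdf_functional.
Context {R : realType}.
Implicit Types (f g : R -> R) (I : (R -> R) -> R) (F : R -> R).

(* F is only required to be squeezed between ramps, so it need not be
   right-continuous and I need not be an integral. *)
Definition functional_with_cdf I F :=
  [/\ forall c f g, bcont f -> bcont g ->
        I (fun y => c * f y + g y) = c * I f + I g,
      forall f g, bcont f -> bcont g -> (forall y, f y <= g y) -> I f <= I g,
      I (fun=> 1) = 1 &
      forall x e, 0 < e -> I (ramp x e) <= F (x + e) /\ F x <= I (ramp (x + e) e)].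

Lemma integral_functional (mu : probability R R) :
  functional_with_cdf (fun f => \int[mu]_y f y) (fun x => fine (mu `]-oo, x]%classic)).
Proof.
split.
- move=> c f g bf bg; have [bf' bg'] := (bcont_bdm bf, bcont_bdm bg).
  by rewrite integral_bdmD ?integral_bdmZ//; exact: bdmZ.
- by move=> f g bf bg fg; apply: le_integral_bdm => //; exact: bcont_bdm.
- exact: integral_cst1.
- move=> x e e0; have br z := bcont_bdm (bcont_ramp z e).
  have mI z : measurable (`]-oo, z]%classic : set R) by exact: measurable_itv.
  rewrite -!integral_indic1//; split; apply: le_integral_bdm => //.
  + exact: bdm_indic.
  + move=> y; rewrite indicE; have [yx|yx] := leP y (x + e).
      by rewrite mem_set ?in_itv//=; case/andP: (ramp_itv x e y).
    by rewrite ramp0 ?ler0n// ltW.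
  + exact: bdm_indic.
  + move=> y; rewrite indicE; have [yx|yx] := leP y x.
      by rewrite ramp1 ?lern1 ?leq_b1// (le_trans yx)// lerDl ltW.
    rewrite memNset ?in_itv/=; first by case/andP: (ramp_itv (x + e) e y).
    by apply/negP; rewrite -ltNge.
Qed.

Lemma functional_cst I F c : functional_with_cdf I F -> I (fun=> c) = c.
Proof.
move=> [Ilin _ I1 _].
have I0 : I (fun=> 0) = 0.
  have := Ilin 1 _ _ (bcont_cst 0) (bcont_cst 0).
  rewrite (_ : (fun _ => _ + _) = (fun=> 0)); last by apply/funext => ?; ring.
  lra.
have := Ilin c _ _ (bcont_cst 1) (bcont_cst 0).
rewrite (_ : (fun _ => _ + _) = (fun=> c)); last by apply/funext => ?; ring.
by rewrite I1 I0 mulr1 addr0.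
Qed.

Lemma functional_sum I F n (g : nat -> R -> R) c : functional_with_cdf I F ->
  (forall j, bcont (g j)) ->
  I (fun y => c + \sum_(j < n) g j y) = c + \sum_(j < n) I (g j).
Proof.
move=> IF bg; elim: n => [|n IH].
  rewrite big_ord0 addr0 -[RHS](functional_cst c IF); congr I.
  by apply/funext => y; rewrite big_ord0 addr0.
rewrite big_ord_recr addrA /= -IH addrC.
have [Ilin _ _ _] := IF.
rewrite -[I (g n)]mul1r -Ilin//; last first.
  elim: n {IH} => [|n IH].
    by under eq_fun do rewrite big_ord0 addr0; exact: bcont_cst.
  rewrite (_ : (fun _ => _) = (fun y => 1 * g n y + (c + \sum_(j < n) g j y))).
    exact: bcont_lin.
  by apply/funext => y; rewrite big_ord_recr /=; ring.
by congr I; apply/funext => y; rewrite big_ord_recr /=; ring.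
Qed.

Variables (I J : (R -> R) -> R) (F : R -> R).
Hypotheses (IF : functional_with_cdf I F) (JF : functional_with_cdf J F).
Hypothesis F01 : forall x, 0 <= F x <= 1.
Hypothesis Fmono : {homo F : x y / x <= y}.

Lemma clamp_telescope f (x : nat -> R) n y :
  (forall i, x i <= x i.+1) ->
  \sum_(j < n) (f (clamp (x j) (x j.+1) y) - f (x j)) =
  f (clamp (x 0%N) (x n) y) - f (x 0%N).
Proof.
move=> xS; have x0 k : x 0%N <= x k by elim: k => // k IH; exact: le_trans IH _.
elim: n => [|n IH].
  rewrite big_ord0 (_ : clamp _ _ _ = x 0%N) ?subrr//.
  by apply/eqP; rewrite eq_le andbC; exact: clamp_itv.
rewrite big_ord_recr /= IH; have [yx|yx] := leP y (x n).
  rewrite (clamp_le _ yx) subrr addr0 /clamp !min_l//.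
  exact: le_trans (xS n).
rewrite (clamp_ge (x0 n) (ltW yx)) addrC subrKA; congr (f _ - _).
by rewrite /clamp max_r ?max_r// le_min ?x0 ?xS ?(ltW yx) ?(le_trans (x0 n))// ltW.
Qed.

(** The increment is constant on either side of [a, b], so it lies between multiples of complements
    of ramps placed just right of b and just left of a; on F this costs one mesh h at each end. *)
Lemma functional_step K f a b h : functional_with_cdf K F ->
  continuous f -> {homo f : x y / x <= y} -> 0 < h -> b = a + h ->
  (f b - f a) * (1 - F (b + h)) <= K (fun y => f (clamp a b y) - f a)
    <= (f b - f a) * (1 - F (a - h)).
Proof.
move=> KF' cf nf h0 bah; have [Klin Kle K1 KF] := KF'.
have ab : a <= b by rewrite bah lerDl ltW.
have D0 : 0 <= f b - f a by rewrite subr_ge0 nf.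
have bd : bcont (fun y => f (clamp a b y) - f a).
  split.
    move=> y; apply: cvgB; last exact: cvg_cst.
    apply: (@continuous_comp _ _ _ (clamp a b) f); first exact: continuous_clamp.
    exact: cf.
  exists (f b - f a) => y; have /andP[ay yb] := clamp_itv y ab.
  by rewrite ger0_norm ?subr_ge0 ?nf// lerB// nf.
have br x e := bcont_ramp x e.
have Kr x e : K (fun y => - (f b - f a) * ramp x e y + (f b - f a)) =
    (f b - f a) * (1 - K (ramp x e)).
  rewrite Klin//; last exact: bcont_cst.
  by rewrite (functional_cst _ KF'); ring.
apply/andP; split.
  apply: (@le_trans _ _ ((f b - f a) * (1 - K (ramp b h)))).
    by rewrite ler_wpM2l// lerB//; case: (KF b h h0).
  rewrite -Kr; apply: Kle => //; first by apply: bcont_lin => //; exact: bcont_cst.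
  move=> y; have [yb|yb] := leP y b.
    by rewrite ramp1// mulr1 addNr subr_ge0 nf//; case/andP: (clamp_itv y ab).
  rewrite (clamp_ge ab (ltW yb)); have /andP[r0 _] := ramp_itv b h y.
  by rewrite mulNr gerDr oppr_le0 mulr_ge0.
have h20 : 0 < h / 2 by rewrite divr_gt0.
apply: (@le_trans _ _ ((f b - f a) * (1 - K (ramp (a - h + h / 2) (h / 2))))).
  rewrite -Kr; apply: Kle => //; first by apply: bcont_lin => //; exact: bcont_cst.
  move=> y; have [ya|ya] := leP a y.
    rewrite ramp0//; last by rewrite -addrA -splitr subrK.
    by rewrite mulr0 add0r lerB// nf//; case/andP: (clamp_itv y ab).
  rewrite (clamp_le _ (ltW ya)) subrr.
  have /andP[_ r1] := ramp_itv (a - h + h / 2) (h / 2) y.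
  by rewrite mulNr addrC subr_ge0 ler_piMr.
by rewrite ler_wpM2l// lerB//; case: (KF (a - h) (h / 2) h20).
Qed.

(** Along a grid of mesh h both functionals are trapped between the same Stieltjes sums. A cell
    contributes at most L h times an increment of F over three meshes, these increments sum to at
    most 3, and h is arbitrary. *)
Lemma functional_eq f a b L : continuous f -> {homo f : x y / x <= y} ->
  a < b -> (forall x y, a <= x -> x <= y -> y <= b -> f y - f x <= L * (y - x)) ->
  I (fun y => f (clamp a b y)) = J (fun y => f (clamp a b y)).
Proof.
move=> cf nf ab fL; apply/eqP; rewrite -subr_eq0 -normr_le0; apply/ler_addgt0Pl => e e0.
rewrite addr0.
have L0 : 0 <= L.
  have := fL a b (lexx _) (ltW ab) (lexx _).
  have : 0 <= f b - f a by rewrite subr_ge0 nf// ltW.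
  have : 0 < b - a by rewrite subr_gt0.
  by move: (f b - f a) (b - a) => u v; nra.
have LB : 0 <= 3 * L * (b - a) by rewrite !mulr_ge0// subr_ge0 ltW.
have [n n0 nE] := exists_div_le LB e0; apply: le_trans nE.
have nR : 0 < n%:R :> R by rewrite ltr0n.
pose h := (b - a) / n%:R; have h0 : 0 < h by rewrite divr_gt0// subr_gt0.
pose x (j : nat) := a + j%:R * h.
have xS j : x j.+1 = x j + h by rewrite /x -natr1; ring.
have xle j : x j <= x j.+1 by rewrite xS lerDl ltW.
have x0 : x 0%N = a by rewrite /x mul0r addr0.
have xn : x n = b by rewrite /x /h; field; rewrite gt_eqF.
have xmono i j : (i <= j)%N -> x i <= x j.
  by move=> ij; rewrite /x lerD2l ler_wpM2r ?ler_nat// ltW.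
have bd j : bcont (fun y => f (clamp (x j) (x j.+1) y) - f (x j)).
  split.
    move=> y; apply: cvgB; last exact: cvg_cst.
    apply: (@continuous_comp _ _ _ (clamp (x j) (x j.+1)) f); first exact: continuous_clamp.
    exact: cf.
  exists (f (x j.+1) - f (x j)) => y; have /andP[ay yb] := clamp_itv y (xle j).
  by rewrite ger0_norm ?subr_ge0 ?nf// lerB// nf.
have sumK K : functional_with_cdf K F -> K (fun y => f (clamp a b y)) =
    f a + \sum_(j < n) K (fun y => f (clamp (x j) (x j.+1) y) - f (x j)).
  move=> KF; rewrite -(functional_sum n (f a) KF bd); congr K.
  by apply/funext => y; rewrite (clamp_telescope f n y xle) x0 xn addrC subrK.
rewrite (sumK _ IF) (sumK _ JF) opprD addrACA subrr add0r -sumrB.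
pose G (j : nat) := F (a - h + j%:R * h).
have G01 j : 0 <= G j <= 1 by exact: F01.
have dGE i : \sum_(j < n) (G (j.+1 + i)%N - G (j + i)%N) <= 1.
  rewrite -(big_mkord xpredT (fun j => G (j.+1 + i)%N - G (j + i)%N)).
  rewrite (telescope_sumr (fun j => G (j + i)%N))//.
  by have /andP[? _] := G01 (0 + i)%N; have /andP[_ ?] := G01 (n + i)%N; lra.
apply: (@le_trans _ _ (\sum_(j < n) (L * h) * ((G (j.+1 + 2)%N - G (j + 2)%N) +
    (G (j.+1 + 1)%N - G (j + 1)%N) + (G (j.+1 + 0)%N - G (j + 0)%N)))).
  rewrite (le_trans (ler_norm_sum _ _ _))//; apply: ler_sum => j _.
  have /andP[I1 I2] := functional_step IF cf nf h0 (xS j).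
  have /andP[J1 J2] := functional_step JF cf nf h0 (xS j).
  have Gj : G (j.+1 + 2)%N = F (x j.+1 + h).
    by rewrite /G /x addn2 -!natr1; congr F; ring.
  have Gj0 : G (j + 0)%N = F (x j - h).
    by rewrite /G /x addn0; congr F; ring.
  rewrite !addn2 !addn1 !addn0; rewrite addn2 in Gj; rewrite addn0 in Gj0.
  rewrite (_ : _ + _ = G j.+3 - G j); last by ring.
  have D : f (x j.+1) - f (x j) <= L * h.
    rewrite (_ : h = x j.+1 - x j); last by rewrite xS; ring.
    by rewrite fL// -?x0 -?xn ?xmono.
  have D0 : 0 <= f (x j.+1) - f (x j) by rewrite subr_ge0 nf.
  have F3 : 0 <= G j.+3 - G j.
    by rewrite subr_ge0 Fmono// lerD2l ler_wpM2r ?(ltW h0)// ler_nat -addn3 leq_addr.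
  apply: (@le_trans _ _ ((f (x j.+1) - f (x j)) * (G j.+3 - G j))); last first.
    by rewrite ler_wpM2r.
  rewrite Gj Gj0 ler_norml; apply/andP; split; lra.
rewrite -mulr_sumr 2!big_split /=.
apply: (@le_trans _ _ (L * h * (1 + 1 + 1))).
  apply: ler_wpM2l; first by apply: mulr_ge0 => //; exact: ltW.
  by apply: lerD => //; apply: lerD.
by rewrite le_eqVlt; apply/orP; left; apply/eqP; rewrite /h; ring.
Qed.

End cdf_functional.

(** * Extension of a positive moment functional *)

Section moment_problem.
Context {R : realType}.
Variables (m : nat -> R) (C : R).
Hypotheses (C0 : 0 < C) (growth : forall k, `|m k| <= C ^+ k * k`!%:R).
Hypothesis m0 : m 0%N = 1.
Hypothesis Lin_ge0 : forall W : {poly R}, (forall y, 0 <= W.[y]) -> 0 <= Lin m W.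
Implicit Types (f g : R -> R) (Q W : {poly R}).

(** The upper envelope of M. Riesz's extension theorem. In general it is only sublinear; here
    [polynomial_squeeze] closes the gap to the lower envelope and makes it linear. *)
Definition upperLin f : R := inf [set Lin m W | W in [set W | forall y, f y <= W.[y]]].

Lemma Lin_le Q W : (forall y, Q.[y] <= W.[y]) -> Lin m Q <= Lin m W.
Proof.
move=> QW; rewrite -subr_ge0 -LinB; apply: Lin_ge0 => y.
by rewrite !hornerE subr_ge0.
Qed.

Lemma upperLin_le f W : bcont f -> (forall y, f y <= W.[y]) -> upperLin f <= Lin m W.
Proof.
move=> [cf [K fK]] fW; apply: ge_inf; last by exists W.
exists (Lin m (- K)%:P) => _ [V /= fV <-]; apply: Lin_le => y.
by rewrite hornerC (le_trans _ (fV y))//; have := fK y; rewrite ler_norml => /andP[].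
Qed.

Lemma upperLin_ge f Q : bcont f -> (forall y, Q.[y] <= f y) -> Lin m Q <= upperLin f.
Proof.
move=> [cf [K fK]] Qf; apply: lb_le_inf.
  exists (Lin m K%:P), K%:P => //= y; rewrite hornerC.
  by have := fK y; rewrite ler_norml => /andP[].
by move=> _ [V /= fV <-]; apply: Lin_le => y; exact: le_trans (fV y).
Qed.

Lemma upperLin_dist f Q W : bcont f -> (forall y, `|f y - Q.[y]| <= W.[y]) ->
  `|upperLin f - Lin m Q| <= Lin m W.
Proof.
move=> bf fQ; rewrite ler_norml; apply/andP; split.
  rewrite lerBrDl -LinB; apply: upperLin_ge => // y; rewrite !hornerE.
  by have := fQ y; rewrite ler_norml => /andP[]; lra.
rewrite lerBlDl -LinD; apply: upperLin_le => // y; rewrite !hornerE.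
by have := fQ y; rewrite ler_norml => /andP[]; lra.
Qed.

Lemma upperLin_linear c f g : bcont f -> bcont g ->
  upperLin (fun y => c * f y + g y) = c * upperLin f + upperLin g.
Proof.
move=> bf bg; have bfg := bcont_lin c bf bg.
apply/eqP; rewrite -subr_eq0 -normr_le0; apply/ler_addgt0Pl => e e0; rewrite addr0.
have [cf [K fK]] := bf; have [cg [K' gK]] := bg.
pose e' := e / (2 * (`|c| + 1)).
have c10 : 0 < `|c| + 1 by rewrite ltr_wpDl.
have e'0 : 0 < e' by rewrite divr_gt0// mulr_gt0.
have [Q [W [fQ We]]] := polynomial_squeeze C0 growth cf fK e'0.
have [Q' [W' [gQ We']]] := polynomial_squeeze C0 growth cg gK e'0.
have D1 := upperLin_dist bf fQ; have D2 := upperLin_dist bg gQ.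
have D3 : `|upperLin (fun y => c * f y + g y) - Lin m (c *: Q + Q')| <= Lin m (`|c| *: W + W').
  apply: upperLin_dist => // y; rewrite !hornerE.
  rewrite (_ : _ - _ = c * (f y - Q.[y]) + (g y - Q'.[y])); last by ring.
  by rewrite (le_trans (ler_normD _ _))// lerD// normrM ler_wpM2l.
rewrite !LinD !LinZ in D3.
have cW : `|c| * Lin m W <= `|c| * e' by rewrite ler_wpM2l.
have D4 : `|c * upperLin f - c * Lin m Q| <= `|c| * e'.
  by rewrite -mulrBr normrM ler_wpM2l// (le_trans D1).
have eE : e = 2 * ((`|c| + 1) * e').
  by rewrite /e'; field; rewrite gt_eqF.
rewrite mulrDl mul1r in eE.
move: D2 D3 D4; rewrite !ler_norml => /andP[? ?] /andP[? ?] /andP[? ?].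
by apply/andP; split; lra.
Qed.

Lemma upperLin_mono f g : bcont f -> bcont g -> (forall y, f y <= g y) ->
  upperLin f <= upperLin g.
Proof.
move=> bf [cg [K gK]] fg; apply: lb_le_inf.
  exists (Lin m K%:P), K%:P => //= y; rewrite hornerC.
  by have := gK y; rewrite ler_norml => /andP[].
by move=> _ [V /= gV <-]; apply: upperLin_le => // y; exact: le_trans (gV y).
Qed.

Lemma upperLin_cst c : upperLin (fun=> c) = c.
Proof.
have Lc a : Lin m a%:P = a by rewrite LinC m0 mulr1.
apply/eqP; rewrite eq_le; apply/andP; split.
  rewrite -[leRHS]Lc; apply: upperLin_le; first exact: bcont_cst.
  by move=> y; rewrite hornerC.
rewrite -[leLHS]Lc; apply: upperLin_ge; first exact: bcont_cst.
by move=> y; rewrite hornerC.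
Qed.

(** The value expected for the mass of (-oo, x]. The ramps still equal 1 on (x, x + e], which is
    what makes the infimum right-continuous. *)
Definition momentF (x : R) : R := inf [set upperLin (ramp (x + e) e) | e in [set e | 0 < e]].

Lemma momentF_ge0 x : 0 <= momentF x.
Proof.
apply: lb_le_inf; first by exists (upperLin (ramp (x + 1) 1)), 1 => //=.
move=> _ [e /= e0 <-]; rewrite -(upperLin_cst 0).
apply: upperLin_mono => [||y]; [exact: bcont_cst|exact: bcont_ramp|].
by case/andP: (ramp_itv (x + e) e y).
Qed.

Lemma momentF_le x e : 0 < e -> momentF x <= upperLin (ramp (x + e) e).
Proof.
move=> e0; apply: ge_inf; last by exists e.
exists 0 => _ [e' /= e'0 <-]; rewrite -(upperLin_cst 0).
apply: upperLin_mono => [||y]; [exact: bcont_cst|exact: bcont_ramp|].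
by case/andP: (ramp_itv (x + e') e' y).
Qed.

Lemma le_momentF x e : 0 < e -> upperLin (ramp x e) <= momentF (x + e).
Proof.
move=> e0; apply: lb_le_inf; first by exists (upperLin (ramp (x + e + 1) 1)), 1 => //=.
move=> _ [e' /= e'0 <-].
apply: upperLin_mono => [||y]; [exact: bcont_ramp|exact: bcont_ramp|].
by apply: ramp_le => //; rewrite lerDl ltW.
Qed.

Lemma momentF_adherent x e : 0 < e -> exists2 r, 0 < r &
  upperLin (ramp (x + r) r) < momentF x + e.
Proof.
move=> e0; have hi : has_inf [set upperLin (ramp (x + e) e) | e in [set e | 0 < e]].
  split; first by exists (upperLin (ramp (x + 1) 1)), 1 => //=.
  exists 0 => _ [e' /= e'0 <-]; rewrite -(upperLin_cst 0).
  apply: upperLin_mono => [||y]; [exact: bcont_cst|exact: bcont_ramp|].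
  by case/andP: (ramp_itv (x + e') e' y).
by have [_ [r /= r0 <-] H] := inf_adherent e0 hi; exists r.
Qed.

Lemma momentF_homo : {homo momentF : x y / x <= y}.
Proof.
move=> x y; rewrite le_eqVlt => /predU1P[->//|xy].
have e0 : 0 < (y - x) / 2 by rewrite divr_gt0// subr_gt0.
apply: le_trans (momentF_le x e0) _.
rewrite [leRHS](_ : _ = momentF (x + (y - x) / 2 + (y - x) / 2)); last by congr momentF; lra.
exact: le_momentF.
Qed.

Lemma momentF_right_continuous x : momentF @ x^'+ --> momentF x.
Proof.
apply/cvgrPdist_lt => e e0; have [r r0 rF] := momentF_adherent x e0.
near=> y.
have xy : x < y by near: y; exact: nbhs_right_gt.
have yr : y < x + r / 2 by near: y; apply: nbhs_right_lt; rewrite ltrDl divr_gt0.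
have r4 : 0 < r / 4 by rewrite divr_gt0.
have Fx := momentF_homo (ltW xy).
have := le_momentF (y + r / 4) r4.
have Fy : momentF y <= upperLin (ramp (x + r) r).
  apply: le_trans (momentF_le y r4) _.
  apply: upperLin_mono => [||z]; [exact: bcont_ramp|exact: bcont_ramp|].
  by apply: ramp_le => //; lra.
by rewrite distrC ger0_norm ?subr_ge0// ltrBlDl => _; exact: le_lt_trans rF.
Unshelve. all: by end_near. Qed.

Lemma momentF_le1 x : momentF x <= 1.
Proof.
apply: le_trans (momentF_le x ltr01) _; rewrite -[leRHS](upperLin_cst 1).
apply: upperLin_mono => [||y]; [exact: bcont_ramp|exact: bcont_cst|].
by case/andP: (ramp_itv (x + 1) 1 y).
Qed.

(** Chebyshev's inequality carried out inside the functional: the polynomial 4 y^2 / x^2 is at least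
    1 where |y| >= x / 2. *)
Lemma momentF_tail x : 0 < x -> momentF (- x) <= 4 * m 2%N / x ^+ 2 /\
  1 - 4 * m 2%N / x ^+ 2 <= momentF x.
Proof.
move=> x0; have x40 : 0 < x / 4 by rewrite divr_gt0.
have H y : x / 2 <= `|y| -> 1 <= 4 / x ^+ 2 * y ^+ 2.
  move=> xy; rewrite (_ : 4 / x ^+ 2 * y ^+ 2 = (2 * `|y| / x) ^+ 2).
    by rewrite exprn_ege1// ler_pdivlMr// mul1r; lra.
  by rewrite -[y ^+ 2]real_normK ?num_real//; field; rewrite gt_eqF.
have L4 : Lin m ((4 / x ^+ 2) *: 'X^2) = 4 * m 2%N / x ^+ 2.
  by rewrite LinZ LinXn mulrAC.
split.
  apply: le_trans (momentF_le _ x40) _; rewrite -L4; apply: upperLin_le.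
    exact: bcont_ramp.
  move=> y; rewrite hornerZ hornerXn; have [xy|xy] := leP (x / 2) `|y|.
    by apply: le_trans (H _ xy); case/andP: (ramp_itv (- x + x / 4) (x / 4) y).
  rewrite ramp0//; first by rewrite mulr_ge0 ?sqr_ge0// ltW// divr_gt0// exprn_gt0.
  by move: xy; rewrite ltr_norml => /andP[]; lra.
have x20 : 0 < x / 2 by rewrite divr_gt0.
have -> : x = x / 2 + x / 2 by lra.
apply: le_trans (le_momentF _ x20).
have -> : 1 - 4 * m 2%N / (x / 2 + x / 2) ^+ 2 = Lin m (1%:P - (4 / x ^+ 2) *: 'X^2).
  by rewrite LinB LinC m0 mulr1 L4 -splitr.
apply: upperLin_ge; first exact: bcont_ramp.
move=> y; rewrite hornerD hornerN hornerC hornerZ hornerXn.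
have /andP[r0 r1] := ramp_itv (x / 2) (x / 2) y.
have [xy|xy] := leP (x / 2) `|y|; first by have := H _ xy; lra.
rewrite ramp1//; first by rewrite gerBl mulr_ge0 ?sqr_ge0// ltW// divr_gt0// exprn_gt0.
by move: xy; rewrite ltr_norml => /andP[]; lra.
Qed.

Lemma momentF_cvg :
  momentF x @[x --> -oo] --> (0 : R) /\ momentF x @[x --> +oo] --> (1 : R).
Proof.
have m20 : 0 <= m 2%N.
  by rewrite -LinXn; apply: Lin_ge0 => y; rewrite hornerXn sqr_ge0.
have H e : 0 < e -> exists2 x, 0 < x & forall y, x <= y -> 4 * m 2%N / y ^+ 2 < e.
  move=> e0; exists (1 + 4 * m 2%N / e) => [|y xy].
    by rewrite ltr_pwDl// divr_ge0 ?mulr_ge0// ltW.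
  have q0 : 0 <= 4 * m 2%N / e by rewrite divr_ge0 ?mulr_ge0// ltW.
  have y1 : 1 <= y by lra.
  have y0 : 0 < y by lra.
  rewrite ltr_pdivrMr ?exprn_gt0// -ltr_pdivrMl// mulrC.
  rewrite (@lt_le_trans _ _ y)//; first lra.
  by rewrite expr2 ler_peMl// ltW.
split; apply/cvgrPdist_lt => e e0; have [x x0 xe] := H e e0.
  near=> y; have yx : y <= - x by near: y; apply: nbhs_ninfty_le; exact: num_real.
  have ny : 0 < - y by lra.
  rewrite sub0r normrN ger0_norm ?momentF_ge0//.
  have [+ _] := momentF_tail ny; rewrite opprK => /le_lt_trans; apply.
  by apply: xe; lra.
near=> y; have yx : x <= y by near: y; apply: nbhs_pinfty_ge; exact: num_real.
rewrite ger0_norm ?subr_ge0 ?momentF_le1//.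
have [_] := momentF_tail (lt_le_trans x0 yx); have := xe _ yx; lra.
Unshelve. all: by end_near. Qed.

Lemma upperLin_functional : functional_with_cdf upperLin momentF.
Proof.
split; [exact: upperLin_linear|exact: upperLin_mono|exact: upperLin_cst|].
by move=> x e e0; split; [exact: le_momentF|exact: momentF_le].
Qed.

End moment_problem.

Section probability_of_cdf.
Context {R : realType} (F : R -> R).
Hypotheses (Fnd : {homo F : x y / x <= y}) (Frc : forall x, F @ x^'+ --> F x)
  (F0 : F x @[x --> -oo] --> (0 : R)) (F1 : F x @[x --> +oo] --> (1 : R)).

#[local] HB.instance Definition _ := isCumulative.Build R _ R F Fnd Frc.
#[local] HB.instance Definition _ := isCumulativeBounded.Build R 0 1 F F0 F1.

(** The Lebesgue-Stieltjes measure lives on [measurableTypeR R]; its image under the identity is the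
    same measure seen as a law on [R]. *)
Lemma probability_of_cdf :
  exists mu : probability R R, forall x, fine (mu `]-oo, x]%classic) = F x.
Proof.
pose mu : probability (measurableTypeR R) R :=
  lebesgue_stieltjes_measure (F : cumulativeBounded 0 1).
pose X : measurableTypeR R -> R := idfun.
have mX : measurable_fun setT X by exact: measurable_id.
pose X' := HB.pack_for {mfun measurableTypeR R >-> R} X (isMeasurableFun.Build _ _ _ _ _ mX).
exists (distribution mu X') => x.
have := cdf_lebesgue_stieltjes_id (F : cumulativeBounded 0 1) x.
by rewrite /cdf /distribution /pushforward => /(congr1 fine).
Qed.

End probability_of_cdf.

Section finite_moments.
Context {R : realType} (mu : probability R R).
Hypothesis fm : finite_moments mu.
Implicit Types (f : R -> R) (Q W : {poly R}).

Lemma integral_horner Q : mu.-integrable setT (EFin \o horner Q) /\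
  \int[mu]_y Q.[y] = Lin (moment ^~ mu) Q.
Proof.
pose S n := \sum_(i < n) Q`_i *: 'X^i.
suff H n : mu.-integrable setT (EFin \o horner (S n)) /\
    \int[mu]_y (S n).[y] = \sum_(i < n) Q`_i * moment i mu.
  by have := H (size Q); rewrite /S -poly_def coefK.
elim: n => [|n [IH1 IH2]].
  rewrite /S !big_ord0; split.
    rewrite (_ : _ \o _ = cst 0%E); first exact: integrable0.
    by apply/funext => y /=; rewrite horner0.
  by under eq_Rintegral do rewrite horner0; rewrite integral_cst1.
have E : horner (S n.+1) = (fun y => (S n).[y] + Q`_n * y ^+ n).
  by apply/funext => y; rewrite /S big_ord_recr /= hornerD hornerZ hornerXn.
have iX : mu.-integrable setT (EFin \o (fun y => Q`_n * y ^+ n)).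
  by have := integrableZl measurableT Q`_n (fm n).
rewrite E; split; first by have := integrableD measurableT IH1 iX.
rewrite RintegralD// IH2 big_ord_recr /=; congr (_ + _).
by rewrite RintegralZl//; exact: fm.
Qed.

Lemma integral_squeeze f Q W : bcont f -> (forall y, `|f y - Q.[y]| <= W.[y]) ->
  `|\int[mu]_y f y - Lin (moment ^~ mu) Q| <= Lin (moment ^~ mu) W.
Proof.
move=> /bcont_bdm bf fQ; have [iQ <-] := integral_horner Q.
have [iW <-] := integral_horner W; have iF := bdm_integrable mu bf.
rewrite -RintegralB//; have iB := integrableB measurableT iF iQ.
rewrite (le_trans (le_normr_Rintegral _ iB))//; apply: le_Rintegral => //.
by have := integrable_norm iB.
Qed.

End finite_moments.

Section power_clamp.
Context {R : realType}.
Implicit Types (x y K : R) (k : nat).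

(** A nondecreasing piece of the power: for k > 0, y^k is pospow k y + (-1)^k pospow k (-y), and
    [functional_eq] applies to monotone Lipschitz functions. *)
Definition pospow k x : R := Num.max x 0 ^+ k.

Lemma pospow_homo k : {homo pospow k : x y / x <= y}.
Proof.
move=> x y xy.
have mxy : Num.max x 0 <= Num.max y 0 by rewrite ge_max !le_max xy lexx orbT.
by apply: lerXn2r; rewrite // nnegrE le_max lexx orbT.
Qed.

Lemma pospow_cont k : continuous (pospow k).
Proof.
move=> x; apply: (@continuous_comp _ _ _ (fun x => Num.max x 0) (fun y => y ^+ k)).
  have c1 : {for x, continuous (id : R -> R^o)} by exact: cvg_id.
  have c2 : {for x, continuous (fun=> 0 : R^o)} by exact: cvg_cst.
  exact: (continuous_max c1 c2).
exact: exprn_continuous.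
Qed.

Lemma pospow_lip k K x y : 0 <= K -> x <= y -> y <= K ->
  pospow k y - pospow k x <= k%:R * K ^+ k.-1 * (y - x).
Proof.
move=> K0 xy yK; pose u := Num.max x 0; pose v := Num.max y 0.
have u0 : 0 <= u by rewrite le_max lexx orbT.
have uv : u <= v by rewrite ge_max !le_max xy lexx orbT.
have vK : v <= K by rewrite ge_max yK.
have vu : v - u <= y - x.
  by rewrite /u /v; have [x0|x0] := leP x 0; have [y0|y0] := leP y 0; lra.
rewrite /pospow -/u -/v subrXX mulrC; apply: ler_pM => //; first by apply: sumr_ge0 => i _; rewrite mulr_ge0 ?exprn_ge0// (le_trans u0).
  by rewrite subr_ge0.
rewrite (@le_trans _ _ (\sum_(i < k) K ^+ k.-1))//; last first.
  by rewrite sumr_const card_ord mulr_natl.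
apply: ler_sum => i _.
have -> : K ^+ k.-1 = K ^+ (k.-1 - i) * K ^+ i.
  by rewrite -exprD subnK// -ltnS prednK// (leq_ltn_trans (leq0n i)).
by rewrite ler_pM ?exprn_ge0 ?(le_trans u0)// lerXn2r ?nnegrE ?(le_trans u0)// (le_trans uv).
Qed.

Lemma power_clampE k K y : (0 < k)%N ->
  clamp (- K) K y ^+ k = pospow k (clamp (- K) K y) + (-1) ^+ k * pospow k (- clamp (- K) K y).
Proof.
move=> k0; rewrite /pospow; move: (clamp _ _ _) => z; have [z0|z0] := leP 0 z.
  have -> : Num.max (- z) 0 = 0 by apply: max_r; rewrite oppr_le0.
  by rewrite expr0n (gtn_eqF k0) mulr0 addr0.
have -> : Num.max (- z) 0 = - z by apply: max_l; rewrite oppr_ge0 ltW.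
rewrite expr0n (gtn_eqF k0) add0r.
by rewrite -exprMn mulN1r opprK.
Qed.

Lemma bcont_power_clamp k K : 0 < K -> bcont (fun y => clamp (- K) K y ^+ k).
Proof.
move=> K0; split.
  move=> y; apply: (@continuous_comp _ _ _ (clamp (- K) K) (fun y => y ^+ k)).
    exact: continuous_clamp.
  exact: exprn_continuous.
exists (K ^+ k) => y; rewrite normrX lerXn2r ?nnegrE ?(ltW K0)// ler_norml.
by apply: clamp_itv; lra.
Qed.

(** Beyond K the error is at most 2 |y|^k, and the factor (|y| / K)^(k + 2) >= 1 raises this to the
    even order 2k + 2, whose moment then controls the truncation. *)
Lemma power_clamp_dist k K y : 0 < K ->
  `|clamp (- K) K y ^+ k - y ^+ k| <= (2 / K ^+ k.+2) * y ^+ k.+1.*2.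
Proof.
move=> K0; have nK : - K <= K by lra.
have [yK|yK] := leP `|y| K.
  rewrite clamp_id -?ler_norml// subrr normr0 mulr_ge0//.
    by rewrite ltW// divr_gt0// exprn_gt0.
  by rewrite -mul2n exprM exprn_ge0// sqr_ge0.
have y0 : 0 < `|y| by rewrite (lt_trans K0).
apply: (@le_trans _ _ (2 * `|y| ^+ k)).
  rewrite (le_trans (ler_normB _ _))// !normrX mulr_natl mulr2n lerD2r.
  rewrite lerXn2r ?nnegrE// (le_trans _ (ltW yK))// ler_norml; exact: clamp_itv.
rewrite -mulrA ler_pM2l// mulrC ler_pdivlMr ?exprn_gt0//.
have -> : y ^+ k.+1.*2 = `|y| ^+ k * `|y| ^+ k.+2.
  by rewrite -exprD addnS addnS addnn -normrX ger0_norm -?doubleS// -mul2n exprM exprn_ge0// sqr_ge0.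
by rewrite ler_wpM2l ?exprn_ge0// lerXn2r ?nnegrE// ltW.
Qed.

Lemma functional_power_eq I J F k K : functional_with_cdf I F ->
  functional_with_cdf J F -> (forall x, 0 <= F x <= 1) ->
  {homo F : x y / x <= y} -> 0 < K ->
  I (fun y => clamp (- K) K y ^+ k) = J (fun y => clamp (- K) K y ^+ k).
Proof.
move=> IF JF F01 Fh K0; case: k => [|k].
  rewrite [fun=> _](_ : _ = fun=> 1)//.
  by rewrite (functional_cst _ IF) (functional_cst _ JF).
have nKK : - K < K by lra.
have cn : continuous (fun y => - pospow k.+1 (- y)).
  move=> y; apply: cvgN.
  apply: (@continuous_comp _ _ _ (fun y => - y) (pospow k.+1)); last exact: pospow_cont.
  by apply: cvgN; exact: cvg_id.
have e1 := functional_eq IF JF F01 Fh (@pospow_cont k.+1) (@pospow_homo k.+1) nKK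
  (fun x y _ xy yK => pospow_lip k.+1 (ltW K0) xy yK).
have e2 : I (fun y => - pospow k.+1 (- clamp (- K) K y)) = J (fun y => - pospow k.+1 (- clamp (- K) K y)).
  apply: (functional_eq IF JF F01 Fh cn _ nKK (L := k.+1%:R * K ^+ k)).
    by move=> x y xy; rewrite lerN2 pospow_homo// lerN2.
  move=> x y xK xy yK; rewrite opprK addrC.
  rewrite (_ : y - x = - x - - y); last by ring.
  by apply: (pospow_lip k.+1 (ltW K0)); lra.
have bc f : continuous f -> {homo f : x y / x <= y} -> bcont (fun y => f (clamp (- K) K y)).
  move=> cf hf; split.
    move=> y; apply: (@continuous_comp _ _ _ (clamp (- K) K) f); last exact: cf.
    exact: continuous_clamp.
  exists (`|f (- K)| + `|f K|) => y; have /andP[c1 c2] := clamp_itv y (ltW nKK).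
  have := hf _ _ c1; have := hf _ _ c2.
  have := ler_norm (f K); have := ler_norm (- f (- K)); rewrite normrN.
  have := normr_ge0 (f K); have := normr_ge0 (f (- K)).
  by rewrite ler_norml => *; apply/andP; split; lra.
have -> : (fun y => clamp (- K) K y ^+ k.+1) = (fun y =>
    (- (-1) ^+ k.+1) * (- pospow k.+1 (- clamp (- K) K y)) + pospow k.+1 (clamp (- K) K y)).
  by apply/funext => y; rewrite power_clampE// mulrNN addrC.
have b1 := bc _ (@pospow_cont k.+1) (@pospow_homo k.+1).
have b2 : bcont (fun y => - pospow k.+1 (- clamp (- K) K y)).
  apply: (bc _ cn) => x y xy; by rewrite lerN2 pospow_homo// lerN2.
have [Il _ _ _] := IF; have [Jl _ _ _] := JF.
by rewrite Il// Jl// e1 e2.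
Qed.

End power_clamp.

Section moment_problem_solution.
Context {R : realType}.
Variables (m : nat -> R) (C : R).
Hypotheses (C0 : 0 < C) (growth : forall k, `|m k| <= C ^+ k * k`!%:R).
Hypothesis m0 : m 0%N = 1.
Hypothesis Lin_ge0 : forall W : {poly R}, (forall y, 0 <= W.[y]) -> 0 <= Lin m W.

(** The law is built from [momentF], but [upperLin] is not known to be integration against it. The
    two functionals share a distribution function, hence agree on truncated powers, and [upperLin]
    of a power truncated at K is within O(K^-(k + 2)) of [m k]. *)
Theorem moment_problem : exists mu : probability R R,
  finite_moments mu /\ forall k, moment k mu = m k.
Proof.
have [mu muF] := probability_of_cdf (momentF_homo m0 Lin_ge0)
  (momentF_right_continuous m0 Lin_ge0)
  (momentF_cvg m0 Lin_ge0).1 (momentF_cvg m0 Lin_ge0).2.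
exists mu.
have F01 x : 0 <= momentF m x <= 1.
  by rewrite (momentF_ge0 m0 Lin_ge0) (momentF_le1 m0 Lin_ge0).
have Jf := upperLin_functional C0 growth m0 Lin_ge0.
have If : functional_with_cdf (fun f => \int[mu]_y f y) (momentF m).
  have := integral_functional mu; congr functional_with_cdf.
  by apply/funext => x; rewrite muF.
have even_ge0 k : 0 <= m k.*2.
  rewrite -LinXn; apply: Lin_ge0 => y.
  by rewrite hornerXn -mul2n exprM exprn_ge0// sqr_ge0.
have eqK k K : 0 < K -> \int[mu]_y (clamp (- K) K y ^+ k) =
    upperLin m (fun y => clamp (- K) K y ^+ k).
  by move=> K0; exact: functional_power_eq If Jf F01 (momentF_homo m0 Lin_ge0) K0.
have distK k K : 0 < K ->
    `|\int[mu]_y (clamp (- K) K y ^+ k) - m k| <= 2 / K ^+ k.+2 * m k.+1.*2.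
  move=> K0; rewrite eqK//.
  have := upperLin_dist Lin_ge0 (bcont_power_clamp k K0)
    (Q := 'X^k) (W := (2 / K ^+ k.+2) *: 'X^(k.+1.*2)).
  rewrite LinZ !LinXn; apply => y; rewrite hornerZ !hornerXn.
  exact: power_clamp_dist.
have small k e : 0 < e -> exists2 n, (0 < n)%N & forall j, (n <= j)%N ->
    2 / j%:R ^+ k.+2 * m k.+1.*2 <= e.
  move=> e0; have c0 : 0 <= 2 * m k.+1.*2 by rewrite mulr_ge0.
  have [n n0 nE] := exists_div_le c0 e0; exists n => // j nj.
  have n0' : 0 < n%:R :> R by rewrite ltr0n.
  have j1 : 1 <= j%:R :> R by rewrite ler1n (leq_trans n0).
  apply: le_trans nE; rewrite mulrAC ler_wpM2l// lef_pV2 ?posrE ?exprn_gt0//; last exact: lt_le_trans j1.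
  apply: (@le_trans _ _ j%:R); first by rewrite ler_nat.
  by rewrite exprS ler_peMr ?exprn_ege1// (le_trans ler01 j1).
have mX k : measurable_fun setT (fun y : R => y ^+ k).
  by apply: continuous_measurable_fun; exact: exprn_continuous.
(* Even powers first, as extended integrals: monotone convergence gives their value and finiteness
   together, and integrability of all powers follows. *)
have intE k : (\int[mu]_y (y ^+ k.*2)%:E)%E = (m k.*2)%:E.
  pose g (n : nat) (y : R) := (clamp (- n.+1%:R) n.+1%:R y ^+ k.*2)%:E.
  have n0 (n : nat) : 0 < n.+1%:R :> R by [].
  have ge0 (z : R) : 0 <= z ^+ k.*2 by rewrite -mul2n exprM exprn_ge0// sqr_ge0.
  have L1 : (\int[mu]_y g n y)%E @[n --> \oo] --> (\int[mu]_y (y ^+ k.*2)%:E)%E.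
    have -> : (\int[mu]_y (y ^+ k.*2)%:E)%E = (\int[mu]_y (limn (g ^~ y)))%E.
      apply: eq_integral => y _; apply/esym/cvg_lim => //.
      have [N Ny] : exists N : nat, `|y| <= N%:R.
        by exists (Num.Def.archi_bound `|y|); rewrite ltW// archi_boundP.
      apply: (@cvg_near_cst _ _ _ _ _ (@eventually_filter)).
      exists N => // n /= Nn; rewrite /g clamp_id// -ler_norml (le_trans Ny)// ler_nat.
      exact: leq_trans Nn _.
    apply: cvg_monotone_convergence => //.
    - move=> n; apply/measurable_EFinP.
      by apply: (bcont_bdm (bcont_power_clamp k.*2 (n0 n))).1.
    - by move=> n y _; rewrite /g lee_fin.
    - move=> y _ i j ij; rewrite /g lee_fin -mul2n !exprM lerXn2r ?nnegrE ?sqr_ge0//.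
      rewrite -real_normK ?num_real// -[leRHS]real_normK ?num_real//.
      rewrite lerXn2r ?nnegrE//.
      have ij' : (i.+1%:R : R) <= j.+1%:R by rewrite ler_nat.
      move: (n0 i) (n0 j) ij'; move: (i.+1%:R) (j.+1%:R) => a b a0 b0 aleb.
      have [ya|ya] := leP `|y| a.
        by rewrite !clamp_id// -ler_norml// (le_trans ya).
      have : clamp (- a) a y = a \/ clamp (- a) a y = - a.
        move: ya; rewrite ltNge ler_norml negb_and -!ltNge => /orP[/ltW yy|/ltW yy].
          by right; rewrite clamp_le.
        by left; rewrite clamp_ge//; lra.
      have ac : a <= `|clamp (- b) b y|.
        have [yb|/ltW yb] := leP `|y| b; first by rewrite clamp_id -?ler_norml// ltW.
        have [y0|y0] := leP 0 y.
          rewrite ger0_norm// in yb; rewrite clamp_ge ?ger0_norm ?(ltW b0)//; lra.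
        rewrite ltr0_norm// in yb; rewrite clamp_le ?normrN ?ger0_norm ?(ltW b0)//; lra.
      by case=> ->; rewrite ?normrN (ger0_norm (ltW a0)).
  have L2 : (\int[mu]_y g n y)%E @[n --> \oo] --> (m k.*2)%:E.
    have E n : (\int[mu]_y g n y)%E = (\int[mu]_y (clamp (- n.+1%:R) n.+1%:R y ^+ k.*2))%:E.
      rewrite /Rintegral fineK//; apply: integrable_fin_num => //.
      exact: bdm_integrable (bcont_bdm (bcont_power_clamp k.*2 (n0 n))).
    under eq_fun do rewrite E.
    apply/fine_cvgP; split; first by apply: nearW.
    apply/cvgrPdist_le => e e0; have [n n1 nE] := small k.*2 e e0.
    exists n => // j /= nj; rewrite distrC (le_trans (distK _ _ (n0 j)))// nE//.
    exact: leqW.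
  exact: cvg_unique L1 L2.
have fm : finite_moments mu.
  move=> k; have i0 : mu.-integrable setT (fun y => (y ^+ k.*2)%:E).
    apply/integrableP; split; first exact/measurable_EFinP.
    rewrite (_ : (\int[mu]_x _)%E = (m k.*2)%:E) ?ltry// -intE.
    apply: eq_integral => y _; rewrite gee0_abs// lee_fin.
    by rewrite -mul2n exprM exprn_ge0// sqr_ge0.
  have i2 := integrableD measurableT (bdm_integrable mu (@bdm_cst _ _ _ 1)) i0.
  apply: le_integrable i2 => //; first by apply/measurable_EFinP.
  move=> y _; rewrite lee_fin normrX [leRHS]ger0_norm; last first.
    by rewrite addr_ge0// -mul2n exprM exprn_ge0// sqr_ge0.
  have -> : y ^+ k.*2 = (`|y| ^+ k) ^+ 2.
    by rewrite -exprM muln2 -normrX ger0_norm// -mul2n exprM exprn_ge0// sqr_ge0.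
  by move: (`|y| ^+ k) => z; have := sqr_ge0 (z - 1); nra.
split=> // k; apply/eqP; rewrite -subr_eq0 -normr_le0; apply/ler_addgt0Pl => e e0.
rewrite addr0; have e20 : 0 < e / 2 by rewrite divr_gt0.
have [n n0 nE] := small k _ e20.
have n0' : 0 < n%:R :> R by rewrite ltr0n.
have D1 := distK k _ n0'.
(* For arbitrary k the truncation error under mu is now controlled by an even moment already
   computed. *)
have D2 : `|moment k mu - \int[mu]_y (clamp (- n%:R) n%:R y ^+ k)| <= e / 2.
  apply: le_trans (nE n (leqnn n)).
  rewrite distrC.
  have := integral_squeeze fm (bcont_power_clamp k n0') (Q := 'X^k)
    (W := (2 / n%:R ^+ k.+2) *: 'X^(k.+1.*2)).
  rewrite LinZ !LinXn {2}/moment {2}/Rintegral intE; apply => y.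
  by rewrite hornerZ !hornerXn; exact: power_clamp_dist.
have D3 := le_trans D1 (nE n (leqnn n)).
rewrite (_ : _ - _ = (moment k mu - \int[mu]_y (clamp (- n%:R) n%:R y ^+ k)) +
   (\int[mu]_y (clamp (- n%:R) n%:R y ^+ k) - m k)); last by ring.
by rewrite (le_trans (ler_normD _ _))// [leRHS]splitr lerD.
Qed.

End moment_problem_solution.

(** * Uniqueness of the law with given moments *)

Section determinacy.
Context {R : realType}.

Lemma integral_eq_of_moments (mu nu : probability R R) C f : 0 < C ->
  (forall k, `|moment k mu| <= C ^+ k * k`!%:R) ->
  finite_moments mu -> finite_moments nu ->
  (forall k, moment k nu = moment k mu) -> bcont f ->
  \int[nu]_y f y = \int[mu]_y f y.
Proof.
move=> C0 growth fmu fnu mE bf; have [cf [K fK]] := bf.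
apply/eqP; rewrite -subr_eq0 -normr_le0; apply/ler_addgt0Pl => e e0; rewrite addr0.
have e20 : 0 < e / 2 by rewrite divr_gt0.
have [Q [W [fQ We]]] := polynomial_squeeze C0 growth cf fK e20.
have D1 := integral_squeeze fmu bf fQ; have D2 := integral_squeeze fnu bf fQ.
have E : moment ^~ nu = moment ^~ mu by apply/funext.
rewrite E in D2.
rewrite (_ : _ - _ = (\int[nu]_y f y - Lin (moment ^~ mu) Q) - (\int[mu]_y f y - Lin (moment ^~ mu) Q)); last by ring.
rewrite (le_trans (ler_normB _ _))// [leRHS]splitr lerD//.
  exact: le_trans D2 We.
exact: le_trans D1 We.
Qed.

Lemma eq_probability_cdf (mu nu : probability R R) :
  (forall x, mu `]-oo, x]%classic = nu `]-oo, x]%classic) ->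
  forall A, measurable A -> mu A = nu A.
Proof.
move=> E; pose g (n : nat) : set R := `]- n%:R, n%:R]%classic.
have Eoc a c : mu `]a, c]%classic = nu `]a, c]%classic.
  have [ac|ca] := leP a c; last first.
    by rewrite set_itv_ge ?measure0// bnd_simp -leNgt ltW.
  have D : `]a, c]%classic = `]-oo, c]%classic `\` `]-oo, a]%classic :> set R.
    apply/seteqP; split=> y; rewrite /= !in_itv/=.
      by move=> /andP[ay yc]; split=> //; apply/negP; rewrite -ltNge.
    by move=> [yc /negP]; rewrite -ltNge => ->.
  have s : `]-oo, c]%classic `&` `]-oo, a]%classic = `]-oo, a]%classic :> set R.
    by apply: setIidr => y /=; rewrite !in_itv/= => /le_trans; apply.
  have mI b : measurable (`]-oo, b]%classic : set R) by exact: measurable_itv.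
  have H (P : probability R R) : P `]a, c]%classic = (P `]-oo, c]%classic - P `]-oo, a]%classic)%E.
    by rewrite D measureD ?s// ltey_eq fin_num_measure.
  by rewrite !H !E.
apply: (measure_unique (@ocitv R) g) => //.
- exact: ocitvI.
- by move=> i; exact: is_ocitv.
- apply/seteqP; split=> // y _; exists (Num.Def.archi_bound `|y|) => //.
  by rewrite /g /= in_itv/= (ltW (_ : y < _)) ?andbT; [have := archi_boundP (normr_ge0 y); rewrite ltr_norml => /andP[]|have := archi_boundP (normr_ge0 y); rewrite ltr_norml => /andP[]].
- by move=> _ [[a c] _ <-]; exact: Eoc.
- by move=> k; rewrite ltey_eq fin_num_measure//; exact: measurable_itv.
Qed.

(** Equal moments give equal integrals of ramps, which compare the distribution functions at x and x
    + e; right-continuity lets e tend to 0. *)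
Theorem moments_determinate (mu : probability R R) C : 0 < C ->
  (forall k, `|moment k mu| <= C ^+ k * k`!%:R) -> finite_moments mu ->
  moment_determinate mu.
Proof.
move=> C0 growth fmu; split=> // nu fnu mE; apply: eq_probability_cdf => x.
have H (mu' nu' : probability R R) :
    (forall f, bcont f -> \int[nu']_y f y = \int[mu']_y f y) ->
    (mu' `]-oo, x]%classic <= nu' `]-oo, x]%classic)%E.
  move=> EI.
  have [_ _ _ I1] := integral_functional mu'.
  have [_ _ _ I2] := integral_functional nu'.
  have le (e : R) : 0 < e -> (mu' `]-oo, x]%classic <= nu' `]-oo, (x + e)%R]%classic)%E.
    move=> e0; have e20 : 0 < e / 2 by rewrite divr_gt0.
    have fin (P : probability R R) y : P `]-oo, y]%classic \is a fin_num.
      exact: fin_num_measure.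
    rewrite -(fineK (fin mu' x)) -(fineK (fin nu' (x + e))) lee_fin.
    have [_ A1] := I1 x _ e20; have [A2 _] := I2 (x + e / 2) _ e20.
    apply: le_trans A1 _; rewrite -EI; last exact: bcont_ramp.
    by apply: le_trans A2 _; rewrite -addrA -splitr.
  have mX : measurable_fun setT (idfun : R -> R) by exact: measurable_id.
  pose X := HB.pack_for {mfun R >-> R} (idfun : R -> R) (isMeasurableFun.Build _ _ _ _ _ mX).
  have rc := @cdf_right_continuous _ _ _ nu' (X : {RV nu' >-> R}) x.
  apply: (cvge_ge _ rc); near=> y; rewrite /cdf /distribution /pushforward /= preimage_id.
  have xy : 0 < y - x by rewrite subr_gt0; near: y; exact: nbhs_right_gt.
  by have := le _ xy; rewrite addrC subrK.
apply/eqP; rewrite eq_le; apply/andP; split.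
  by apply: H => f bf; rewrite (integral_eq_of_moments C0 growth fmu fnu mE bf).
by apply: H => f bf; rewrite (integral_eq_of_moments C0 growth fmu fnu mE bf).
Unshelve. all: by end_near. Qed.

End determinacy.

(** * Closed walks on hypergraphs *)

Section big_tuple_cat.
Context {R : realType} (T : finType).

Lemma big_tuple_cat D m n (F : seq T -> R) : D = (m + n)%N ->
  \sum_(t : D.-tuple T) F t =
  \sum_(x : m.-tuple T) \sum_(y : n.-tuple T) F (x ++ y).
Proof.
move=> ->; rewrite pair_big /=.
pose h (z : m.-tuple T * n.-tuple T) := cat_tuple z.1 z.2.
pose h' (t : (m + n).-tuple T) : m.-tuple T * n.-tuple T :=
  (tcast (minn_idPl (leq_addr n m)) (take_tuple m t),
   tcast (addKn m n) (drop_tuple m t)).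
rewrite (reindex h) //=; exists h' => [[x y] _|t _].
  congr pair; apply: val_inj; rewrite /= val_tcast /= ?take_size_cat ?drop_size_cat ?size_tuple//.
by apply: val_inj; rewrite /= !val_tcast /= cat_take_drop.
Qed.

Lemma ler_sum_inj (I J : finType) (h : I -> J) (F : J -> R) :
  injective h -> (forall j, 0 <= F j) -> \sum_i F (h i) <= \sum_j F j.
Proof.
move=> inj F0.
have -> : \sum_i F (h i) = \sum_(i in [set: I]%SET) F (h i).
  by apply: eq_bigl => i; rewrite inE.
rewrite -(big_imset F (A := [set: I]%SET)) /=; last first.
  by move=> x y _ _; exact: inj.
rewrite [leRHS](bigID (mem (h @: [set: I])%SET)) /= lerDl.
exact: sumr_ge0.
Qed.

End big_tuple_cat.

Section block_product.
Context {R : realType}.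
Implicit Types (tau M : nat -> R).

(** A hyperedge is a multiset of vertices, since the tensor is symmetric; sorting picks the
    representative that indexes the underlying independent entry. *)
Definition key (e : seq nat) := sort leq e.

Lemma key_eq e e' : (key e == key e') = perm_eq e e'.
Proof.
apply/eqP/idP => [|/perm_sortP]; last by apply; [exact: leq_total|exact: leq_trans|exact: anti_leq].
by move=> E; rewrite -(perm_sort leq e) -/(key e) E perm_sort.
Qed.

Lemma mem_key e x : (x \in key e) = (x \in e).
Proof. exact: mem_sort. Qed.

(** The expectation of the product of entries along a list of keys, for independent entries whose
    m-th moment is [tau m]. *)
Definition blockprod (K : eqType) tau (ks : seq K) : R :=
  \prod_(x <- undup ks) tau (count_mem x ks).

Variable K : eqType.
Implicit Types (ks : seq K).

Lemma blockprod_map (K' : eqType) tau (f : K -> K') ks : {in ks &, injective f} ->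
  blockprod tau (map f ks) = blockprod tau ks /\
  size (undup (map f ks)) = size (undup ks).
Proof.
move=> inj.
have inju : {in undup ks &, injective f}.
  by move=> x y; rewrite !mem_undup; exact: inj.
have pu : perm_eq (undup (map f ks)) (map f (undup ks)).
  apply: uniq_perm; rewrite ?undup_uniq ?map_inj_in_uniq ?undup_uniq// => z.
  by rewrite mem_undup; apply/mapP/mapP => -[x xs ->]; exists x => //; move: xs; rewrite mem_undup.
split; last by rewrite (perm_size pu) size_map.
rewrite /blockprod (perm_big _ pu) /= big_map; apply: eq_big_seq => x.
rewrite mem_undup => xs; congr tau; rewrite count_map; apply: eq_in_count => y ys /=.
by apply/eqP/eqP => [|->//]; exact: inj.
Qed.

Lemma prod_undup_count (F : K -> R) ks :
  \prod_(x <- ks) F x = \prod_(x <- undup ks) F x ^+ count_mem x ks.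
Proof. by rewrite -big_undup_iterop_count. Qed.

Lemma count_undup_gt0 ks x : x \in undup ks -> (0 < count_mem x ks)%N.
Proof. by rewrite mem_undup -has_pred1 has_count. Qed.

Lemma blockprod_scale a tau ks :
  blockprod (fun m => a ^+ m * tau m) ks = a ^+ size ks * blockprod tau ks.
Proof.
rewrite /blockprod big_split /=; congr (_ * _).
rewrite -(prod_undup_count (fun=> a)).
by elim: ks => [|x ks IH]; rewrite ?big_nil// big_cons IH exprS.
Qed.

Lemma blockprod_const c tau ks :
  blockprod (fun m => c * tau m) ks = c ^+ size (undup ks) * blockprod tau ks.
Proof.
rewrite /blockprod big_split /=; congr (_ * _).
by elim: (undup ks) => [|x s IH]; rewrite ?big_nil// big_cons IH exprS.
Qed.

Lemma eq_blockprod tau tau' ks : (forall m, (0 < m)%N -> tau m = tau' m) ->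
  blockprod tau ks = blockprod tau' ks.
Proof. by move=> E; apply: eq_big_seq => x /count_undup_gt0; exact: E. Qed.

Lemma blockprod_ge0 tau ks : (forall m, (0 < m)%N -> 0 <= tau m) ->
  0 <= blockprod tau ks.
Proof.
move=> t0; rewrite /blockprod big_seq; apply: prodr_ge0 => x /count_undup_gt0.
exact: t0.
Qed.

Lemma ler_norm_blockprod tau tau' ks :
  (forall m, (0 < m)%N -> `|tau m| <= tau' m) ->
  `|blockprod tau ks| <= blockprod tau' ks.
Proof.
move=> t; rewrite /blockprod normr_prod big_seq [leRHS]big_seq.
by apply: ler_prod => x /count_undup_gt0 c0; rewrite normr_ge0 t.
Qed.

Lemma blockprod_cat tau (ks ks' : seq K) : ~~ has (mem ks) ks' ->
  blockprod tau (ks ++ ks') = blockprod tau ks * blockprod tau ks' /\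
  size (undup (ks ++ ks')) = (size (undup ks) + size (undup ks'))%N.
Proof.
move=> /hasPn dis; rewrite /blockprod undup_cat.
have -> : [seq x <- undup ks | x \notin ks'] = undup ks.
  apply/all_filterP/allP => x; rewrite mem_undup => xk.
  by apply/negP => /dis; rewrite /= xk.
rewrite size_cat big_cat /=; split => //; congr (_ * _); apply: eq_big_seq => x; rewrite mem_undup count_cat => xk.
  suff -> : count_mem x ks' = 0%N by rewrite addn0.
  by apply/count_memPn/negP => /dis; rewrite /= xk.
suff -> : count_mem x ks = 0%N by [].
by apply/count_memPn; exact: dis.
Qed.

End block_product.

Lemma size_undup_cat (K : eqType) (s1 s2 : seq K) : size (undup (s1 ++ s2)) =
  (size (undup s1) + size (undup [seq x <- s2 | x \notin s1]))%N.
Proof.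
have -> : size (undup (s1 ++ s2)) = size (undup (s2 ++ s1)).
  by apply/perm_size/perm_undup => x; rewrite !mem_cat orbC.
by rewrite undup_cat size_cat addnC filter_undup.
Qed.

(** * Numbers of vertices and of distinct hyperedges of a walk *)

Section hedges.
Variable q : nat.

(* A walk visits vertices in blocks a, j_1, ..., j_q, u, j'_1, ..., j'_q, u', ...
   consecutive hyperedges are slices of length q + 2 sharing one vertex. *)
Fixpoint hedges k (s : seq nat) : seq (seq nat) :=
  if k is k'.+1 then take q.+2 s :: hedges k' (drop q.+1 s) else [::].

Definition keys k s := map key (hedges k s).

(** Each hyperedge adds q + 1 positions to the initial one; a closed walk carries its starting
    vertex at both ends. *)
Definition wsize k := (k * q.+1).+1.

Lemma size_keys k s : size (keys k s) = k.
Proof. by rewrite size_map; elim: k s => //= k IH s; rewrite IH. Qed.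

Lemma hedges_map g k s : hedges k (map g s) = map (map g) (hedges k s).
Proof. by elim: k s => //= k IH s; rewrite -map_take -map_drop IH. Qed.

Lemma mem_hedges k s e : e \in hedges k s -> {subset e <= s}.
Proof.
elim: k s => //= k IH s; rewrite in_cons => /predU1P[->|/IH H] x.
  exact: mem_take.
by move/H; exact: mem_drop.
Qed.

Lemma mem_keys k s e : e \in keys k s -> {subset e <= s}.
Proof. by move=> /mapP[e' /mem_hedges H ->] x; rewrite mem_key; exact: H. Qed.

(** Relative form, for a walk explored after known vertices c and known keys ks. When the first
    hyperedge is peeled off, a known or repeated key brings no fresh vertex and a fresh key at most
    q + 1, or q if it touches c; the indicator of contact with c carries this saving through the
    induction. *)
Lemma vertex_bound k (s c : seq nat) (ks : seq (seq nat)) : size s = wsize k ->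
  (forall e, e \in ks -> {subset e <= c}) ->
  (size (undup [seq x <- s | x \notin c]) + has (mem c) s <=
   1 + q.+1 * size (undup [seq e <- keys k s | e \notin ks]))%N.
Proof.
move=> sk ksc; elim: k s sk => [|k IH] s sk.
  case: s sk => [|u [|//]]//= _; rewrite muln0 addn0 orbF.
  by case: (u \in c).
pose s' := drop q.+1 s.
have ss : (q.+1 < size s)%N by rewrite sk /wsize mulSn ltnS leq_addr.
have sk' : size s' = wsize k by rewrite size_drop sk /wsize mulSn -addnS addKn.
have {IH} := IH s' sk'; set nv' := size _; set h' := has _ s'; set nw' := size _ => IH.
pose e := take q.+2 s; pose x := take q.+1 s.
have Es : s = x ++ s' by rewrite cat_take_drop.
have xe : {subset x <= e}.
  by move=> z; rewrite /x /e -(take_takel s (leqnSn q.+1)); exact: mem_take.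
(* The junction vertex, shared by the first hyperedge and the rest of the walk; it transmits contact
   with c when that hyperedge is known. *)
have [u us' ue] : exists2 u, u \in s' & u \in e.
  exists (nth 0%N s q.+1).
    by rewrite /s' -[X in nth _ _ X]addn0 -nth_drop mem_nth// sk'.
  by rewrite /e -(nth_take 0%N (ltnSn q.+1)) mem_nth// size_take; case: ifP.
have keysE : keys k.+1 s = key e :: keys k s' by [].
have filtE : [seq y <- s | y \notin c] = [seq y <- x | y \notin c] ++ [seq y <- s' | y \notin c].
  by rewrite -filter_cat -Es.
have hasE : has (mem c) s = has (mem c) x || h' by rewrite {1}Es has_cat.
rewrite keysE filtE hasE /=.
have [ek|ek] := boolP (key e \in ks).
  have ec : {subset e <= c} by move=> z ze; apply: (ksc _ ek); rewrite mem_key.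
  have -> : [seq y <- x | y \notin c] = [::].
    apply/eqP; rewrite -[_ == _]negbK -has_filter; apply/hasPn => y /xe /ec yc.
    by rewrite negbK.
  have H1 : h' = true by apply/hasP; exists u => //; exact: ec.
  by move: IH; rewrite /= H1 orbT.
rewrite /=.
have [ek'|ek'] := boolP (key e \in [seq e0 <- keys k s' | e0 \notin ks]).
  have es' : {subset e <= s'}.
    move: ek'; rewrite mem_filter => /andP[_ /mem_keys H] z ze.
    by apply: H; rewrite mem_key.
  have xs' : {subset x <= s'} by move=> z /xe /es'.
  have -> : has (mem c) x || h' = h'.
    apply/orb_idl => /hasP[y yx yc]; apply/hasP; exists y => //; exact: xs'.
  suff -> : size (undup ([seq y <- x | y \notin c] ++ [seq y <- s' | y \notin c])) = nv' by [].
  apply/perm_size/perm_undup => y; rewrite mem_cat !mem_filter.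
  by apply/orP/idP => [[/andP[-> /xs' ->]|]//|]; right.
rewrite /= -/nw' mulnS.
have nv : (size (undup ([seq y <- x | y \notin c] ++ [seq y <- s' | y \notin c])) <=
   size [seq y <- x | y \notin c] + nv')%N.
  rewrite undup_cat size_cat leq_add2r.
  by rewrite (leq_trans (size_subseq (filter_subseq _ _)))// size_undup.
have sx : size x = q.+1 by rewrite size_take; case: ltnP ss => // /leq_trans H /H; rewrite ltnn.
have [hx|hx] := boolP (has (mem c) x).
  have sf : (size [seq y <- x | y \notin c] <= q)%N.
    have := count_predC (mem c) x; rewrite sx => E.
    have -> : size [seq y <- x | y \notin c] = count (predC (mem c)) x.
      by rewrite size_filter; apply: eq_count.
    by move: hx E; rewrite has_count; lia.
  rewrite /=; move: nv sf IH; clear.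
  by move: (size _) (size _) (nat_of_bool h') (q.+1 * nw')%N => n1 n2 n3 n4; lia.
have sf : (size [seq y <- x | y \notin c] <= q.+1)%N.
  by rewrite -sx size_filter count_size.
rewrite /=; move: nv sf IH; clear.
by move: (size _) (size _) (nat_of_bool h') (q.+1 * nw')%N => n1 n2 n3 n4; lia.
Qed.

Lemma vertex_bound1 k (s : seq nat) : size s = wsize k ->
  (size (undup s) <= 1 + q.+1 * size (undup (keys k s)))%N.
Proof.
move=> sk; have H0 : forall e, e \in ([::] : seq (seq nat)) -> {subset e <= ([::] : seq nat)} by [].
have := vertex_bound sk H0.
have -> : [seq x <- s | x \notin ([::] : seq nat)] = s by apply/all_filterP/allP.
have -> : [seq e <- keys k s | e \notin ([::] : seq (seq nat))] = keys k s.
  by apply/all_filterP/allP.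
by apply: leq_trans; rewrite leq_addr.
Qed.

(** Unrelated walks with b distinct hyperedges in all could have 2 + (q + 1) b vertices; contact
    costs one. This missing vertex makes covariances vanish. *)
Lemma vertex_bound2 k (s : seq nat) k' (s' : seq nat) : size s = wsize k -> size s' = wsize k' ->
  has (mem s) s' ->
  (size (undup (s ++ s')) <= 1 + q.+1 * size (undup (keys k s ++ keys k' s')))%N.
Proof.
move=> sk sk' ss'; rewrite !size_undup_cat mulnDr.
have := @vertex_bound k' s' s (keys k s) sk' (fun e => @mem_keys k s e).
by rewrite ss'; have := vertex_bound1 sk; lia.
Qed.

End hedges.

(** * Walks up to relabelling of vertices *)

Section patterns.
Context {R : realType}.
Implicit Types (s : seq nat) (g : nat -> nat).

(** Canonical form up to injective relabelling: each vertex becomes the position of its first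
    occurrence. *)
Definition pat s := map (index^~ s) s.

Lemma pat_nth s : map (nth 0%N s) (pat s) = s.
Proof.
rewrite -map_comp -[RHS]map_id; apply/eq_in_map => x xs /=.
exact: nth_index.
Qed.

Lemma nth_pat_inj s : {in pat s &, injective (nth 0%N s)}.
Proof.
by move=> _ _ /mapP[x xs ->] /mapP[y ys ->]; rewrite !nth_index// => ->.
Qed.

Lemma index_map_in g s x : {in s &, injective g} -> x \in s ->
  index (g x) (map g s) = index x s.
Proof.
elim: s => //= y s IH inj; rewrite in_cons => xs.
have -> : (g y == g x) = (y == x).
  by apply/eqP/eqP => [|->//]; apply: inj; rewrite ?in_cons ?eqxx// xs.
case: eqP => // yx; congr S; apply: IH.
  by move=> a b a_s b_s; apply: inj; rewrite in_cons ?a_s ?b_s orbT.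
by case/predU1P : xs yx => // ->.
Qed.

Lemma pat_map g s : {in s &, injective g} -> pat (map g s) = pat s.
Proof.
by move=> inj; rewrite /pat -map_comp; apply/eq_in_map => x xs /=; exact: index_map_in.
Qed.

Lemma pat_pat s : pat (pat s) = pat s.
Proof. by rewrite -[in RHS](pat_nth s) pat_map//; exact: nth_pat_inj. Qed.

Variables (D N : nat).
Implicit Types (sigma : D.+1.-tuple 'I_D.+1).

Definition pattern_class sigma : {set D.+1.-tuple 'I_N.+1} :=
  [set s : D.+1.-tuple 'I_N.+1 | pat (map val s) == map val sigma].

(** The index set on the right does not depend on N, so limits can be taken term by term; tuples
    that are not patterns have an empty class. *)
Lemma sum_by_pattern (Phi : seq nat -> R) :
  (forall s g, {in s &, injective g} -> Phi (map g s) = Phi s) ->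
  \sum_(s : D.+1.-tuple 'I_N.+1) Phi (map val s) =
  \sum_(sigma : D.+1.-tuple 'I_D.+1) #|pattern_class sigma|%:R * Phi (map val sigma).
Proof.
move=> Phig.
pose pt (s : D.+1.-tuple 'I_N.+1) : D.+1.-tuple 'I_D.+1 :=
  map_tuple (fun x => inord (index x s)) s.
have ptE (s : D.+1.-tuple 'I_N.+1) : map val (pt s) = pat (map val s).
  rewrite /= -map_comp /pat -map_comp; apply/eq_in_map => x xs /=.
  rewrite inordK ?(index_map val_inj)//.
  by rewrite -[X in (_ < X)%N](size_tuple s) index_mem.
rewrite (partition_big pt xpredT)//=; apply: eq_bigr => sigma _.
rewrite mulr_natl -sumr_const; apply: eq_big => [s|s /eqP sE].
  rewrite inE -ptE; apply/eqP/eqP => [->//|]; move/inj_map => H.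
  by apply: val_inj; apply: H; exact: val_inj.
by rewrite -sE ptE -[in LHS](pat_nth (map val s)) Phig//; exact: nth_pat_inj.
Qed.

Lemma pattern_class0 sigma : pat (map val sigma) != map val sigma ->
  #|pattern_class sigma| = 0%N.
Proof.
move=> np; apply/eqP; rewrite cards_eq0; apply/eqP/setP => s; rewrite !inE.
apply/negP => /eqP E; move: np; rewrite -E pat_pat E eqxx//.
Qed.

Lemma pattern_class_le sigma :
  (#|pattern_class sigma| <= N.+1 ^ size (undup (map val sigma)))%N.
Proof.
pose d := size (undup (map val sigma)).
pose h (s : D.+1.-tuple 'I_N.+1) : d.-tuple 'I_N.+1 :=
  [tuple nth ord0 s (nth 0%N (undup (map val sigma)) i) | i < d].
rewrite -[X in (_ <= X ^ _)%N]card_ord -card_tuple.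
apply: (@leq_card_in _ _ h) => s s'; rewrite !inE => /eqP sE /eqP s'E hE.
have nthE (r : D.+1.-tuple 'I_N.+1) i : (i < D.+1)%N ->
    nth 0%N (map val r) i = val (nth ord0 r i).
  by move=> iD; rewrite (nth_map ord0)// size_tuple.
have H : map val s = map val s'.
  rewrite -(pat_nth (map val s)) -(pat_nth (map val s')) sE s'E.
  apply/eq_in_map => x xs; have xD : (x < D.+1)%N by case/mapP : xs => y _ ->; exact: ltn_ord.
  rewrite !nthE//; congr val.
  have xu : x \in undup (map val sigma) by rewrite mem_undup.
  have xd : (index x (undup (map val sigma)) < d)%N by rewrite index_mem.
  have := congr1 (fun t => tnth t (Ordinal xd)) hE.
  by rewrite !tnth_mktuple /= nth_index.
by apply: val_inj; apply: inj_map H; exact: val_inj.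
Qed.

(** Every injective labelling of the distinct symbols realises the pattern. With the upper bound, a
    class of v symbols has N^v members to leading order. *)
Lemma pattern_class_ge sigma : pat (map val sigma) = map val sigma ->
  (N.+1 ^_ size (undup (map val sigma)) <= #|pattern_class sigma|)%N.
Proof.
move=> ps; pose u := undup (map val sigma); pose d := size u.
pose h (t : d.-tuple 'I_N.+1) : D.+1.-tuple 'I_N.+1 :=
  map_tuple (fun x : 'I_D.+1 => nth ord0 t (index (val x) u)) sigma.
rewrite -[X in (X ^_ _ <= _)%N](card_ord N.+1) -card_uniq_tuples.
have mu x : x \in sigma -> (index (val x) u < d)%N.
  by move=> xs; rewrite index_mem mem_undup map_f.
rewrite -(card_in_imset (f := h)); last first.
  move=> t t'; rewrite !inE => /andP[_ ut] /andP[_ ut'] E.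
  apply: eq_from_tnth => i; rewrite !(tnth_nth ord0).
  have : nth 0%N u i \in map val sigma by rewrite -mem_undup mem_nth.
  case/mapP => x xs Ex.
  have := congr1 (fun r : D.+1.-tuple _ => nth ord0 r (index x sigma)) E.
  have xi : (index x sigma < size sigma)%N by rewrite index_mem.
  rewrite /= !(nth_map ord0)// nth_index// -Ex index_uniq ?undup_uniq//.
apply: subset_leq_card; apply/fintype.subsetP => r /imsetP[t].
rewrite !inE => /andP[_ ut] ->; rewrite -[X in _ == X]ps /=.
pose g (y : nat) := val (nth ord0 t (index y u)).
have -> : map val (map (fun x : 'I_D.+1 => nth ord0 t (index (val x) u)) sigma) =
    map g (map val sigma) by rewrite -!map_comp.
rewrite pat_map// => x y xs ys /val_inj /eqP.
rewrite nth_uniq ?size_tuple ?index_mem ?mem_undup// => /eqP.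
by move=> /(congr1 (nth 0%N u)); rewrite !nth_index ?mem_undup.
Qed.

End patterns.

Arguments keys : simpl never.

(** * Limits of normalised walk sums and their growth *)

Section limiting_moments.
Context {R : realType} (q : nat).
Implicit Types (tau M : nat -> R) (k N : nat).

Definition closed_walk (s : seq nat) := head 0%N s == last 0%N s.

Definition walk_sum N k tau : R :=
  \sum_(s : (wsize q k).-tuple 'I_N | closed_walk (map val s))
    blockprod tau (keys q k (map val s)).

Definition tree_pattern k (sigma : (wsize q k).-tuple 'I_(wsize q k)) :=
  [&& closed_walk (map val sigma), pat (map val sigma) == map val sigma &
      size (undup (map val sigma)) ==
        (1 + q.+1 * size (undup (keys q k (map val sigma))))%N].

(* In N^-1 E tr A^k a closed walk with v vertices and b distinct hyperedges has
   weight N^(v - 1 - (q+1) b), and v <= 1 + (q+1) b. *)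
Definition tree_moment M k : R :=
  \sum_(sigma : (wsize q k).-tuple 'I_(wsize q k) | tree_pattern sigma)
    blockprod M (keys q k (map val sigma)).

(** An injective relabelling acts injectively on multisets; the left inverse [g'] of g on D serves
    to pull a permutation of images back. *)
Lemma key_map_in (E : seq (seq nat)) (D : seq nat) (g : nat -> nat) tau :
  (forall e, e \in E -> {subset e <= D}) -> {in D &, injective g} ->
  blockprod tau (map key (map (map g) E)) = blockprod tau (map key E) /\
  size (undup (map key (map (map g) E))) = size (undup (map key E)).
Proof.
move=> ED inj.
have -> : map key (map (map g) E) = map (fun e => key (map g e)) (map key E).
  rewrite -!map_comp; apply: eq_map => e /=; apply/eqP; rewrite key_eq.
  by rewrite perm_sym perm_map// perm_sort.
apply: blockprod_map => _ _ /mapP[e eE ->] /mapP[e' e'E ->] /eqP.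
rewrite key_eq => H; apply/eqP; rewrite key_eq.
pose g' y := nth 0%N D (index y (map g D)).
have gK x : x \in D -> g' (g x) = x.
  by move=> xD; rewrite /g' index_map_in// nth_index.
have gKs f : f \in E -> map g' (map g (key f)) = key f.
  move=> fE; rewrite -map_comp -[RHS]map_id; apply/eq_in_map => x.
  by rewrite mem_key => /(ED _ fE) /gK.
have := perm_map g' H; rewrite !gKs// => H'.
by rewrite -(perm_sort leq) perm_sym -(perm_sort leq) perm_sym.
Qed.

Lemma keys_relabel k (s : seq nat) (g : nat -> nat) tau : {in s &, injective g} ->
  blockprod tau (keys q k (map g s)) = blockprod tau (keys q k s) /\
  size (undup (keys q k (map g s))) = size (undup (keys q k s)).
Proof.
move=> inj; rewrite /keys hedges_map; apply: (key_map_in _ _ inj) => e.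
exact: mem_hedges.
Qed.

Lemma closed_relabel (s : seq nat) (g : nat -> nat) : {in s &, injective g} ->
  closed_walk (map g s) = closed_walk s.
Proof.
case: s => // a s inj; rewrite /closed_walk /= last_map.
by apply/eqP/eqP => [H|<-//]; apply: inj => //; rewrite ?mem_head ?mem_last.
Qed.

Lemma walk_sumE N k tau : walk_sum N.+1 k tau =
  \sum_(sigma : (wsize q k).-tuple 'I_(wsize q k))
    #|pattern_class N sigma|%:R *
    (if closed_walk (map val sigma) then blockprod tau (keys q k (map val sigma)) else 0).
Proof.
rewrite /walk_sum big_mkcond /=.
apply: (@sum_by_pattern R (k * q.+1) N (fun s => if closed_walk s then blockprod tau (keys q k s) else 0)).
by move=> s g inj; rewrite closed_relabel// (keys_relabel k tau inj).1.
Qed.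

Lemma cvg_ffact d : ((N.+1 ^_ d)%:R / N.+1%:R ^+ d : R) @[N --> \oo] --> (1 : R).
Proof.
elim: d => [|d IH].
  under eq_fun do rewrite ffactn0 expr0 divr1; exact: cvg_cst.
have L : ((N.+1 - d)%N%:R / N.+1%:R : R) @[N --> \oo] --> (1 : R).
  rewrite [X in _ --> X](_ : 1 = 1 - d%:R * 0 :> R); last by rewrite mulr0 subr0.
  have : (1 - d%:R * N.+1%:R^-1 : R) @[N --> \oo] --> 1 - d%:R * (0 : R).
    apply: cvgB; first exact: cvg_cst.
    by apply: cvgM; [exact: cvg_cst|exact: cvg_harmonic].
  apply: cvg_trans; apply: near_eq_cvg; near=> N.
  have dN : (d <= N.+1)%N by apply: leqW; near: N; exact: nbhs_infty_ge.
  by rewrite natrB// mulrBl mulfV// pnatr_eq0.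
rewrite [X in _ --> X](_ : 1 = 1 * 1 :> R); last by rewrite mulr1.
apply: cvg_trans (cvgM IH L); apply: near_eq_cvg; near=> N.
rewrite ffactnSr natrM exprSr invfM /=; ring.
Unshelve. all: by end_near. Qed.

Lemma cvg_blockprod (ks : seq (seq nat)) (Mi : nat -> nat -> R) M :
  (forall m, (0 < m)%N -> Mi i m @[i --> \oo] --> M m) ->
  blockprod (Mi i) ks @[i --> \oo] --> blockprod M ks.
Proof.
move=> MiM; pose pos (tau : nat -> R) m := if m is 0%N then 1 else tau m.
have posE tau : blockprod tau ks = blockprod (pos tau) ks.
  by apply: eq_blockprod => -[].
rewrite posE; under eq_fun do rewrite posE.
apply: cvg_prod_seq => x; case: (count_mem x ks) => [|m]; first exact: cvg_cst.
exact: MiM.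
Qed.

(** By [vertex_bound1] no pattern has a positive power of N; those that are not tree patterns keep a
    factor 1 / N at least, while a tree class with v vertices has N^v members to leading order. *)
Lemma cvg_walk_sum k (tau : nat -> nat -> R) M :
  (forall m, (0 < m)%N -> N.+1%:R ^+ q.+1 * tau N m @[N --> \oo] --> M m) ->
  walk_sum N.+1 k (tau N) / N.+1%:R @[N --> \oo] --> tree_moment M k.
Proof.
move=> tauM; rewrite /tree_moment big_mkcond /=.
under eq_fun do rewrite walk_sumE mulr_suml.
apply: cvg_sum_seq => sigma; rewrite /tree_pattern.
case: (boolP (closed_walk _)) => csig /=; last first.
  by under eq_fun do rewrite mulr0 mul0r; exact: cvg_cst.
set S := map val sigma; set ks := keys q k S; pose b := size (undup ks).
pose d := size (undup S).
have bE (N : nat) : blockprod (tau N) ks =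
    (N.+1%:R ^+ (q.+1 * b))^-1 * blockprod (fun m => N.+1%:R ^+ q.+1 * tau N m) ks.
  by rewrite blockprod_const -exprM mulrA mulVf ?mul1r// expf_neq0// pnatr_eq0.
have Lb : blockprod (fun m => N.+1%:R ^+ q.+1 * tau N m) ks @[N --> \oo] --> blockprod M ks.
  exact: cvg_blockprod.
have [/eqP ps|nps] := boolP (pat S == S); last first.
  under eq_fun do rewrite pattern_class0// !mul0r.
  by exact: cvg_cst.
have dle : (d <= 1 + q.+1 * b)%N by apply: vertex_bound1; rewrite size_map size_tuple.
have [de|dne] /= := eqVneq d (1 + q.+1 * b)%N.
  rewrite -[blockprod M ks]mul1r.
  have Lc : (#|pattern_class N sigma|%:R / N.+1%:R ^+ d : R) @[N --> \oo] --> (1 : R).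
    apply: (squeeze_cvgr _ (@cvg_ffact d) (cvg_cst (1 : R))).
    apply: nearW => N; apply/andP; split.
      by rewrite ler_pM2r ?invr_gt0 ?exprn_gt0// ler_nat pattern_class_ge.
    by rewrite ler_pdivrMr ?exprn_gt0// mul1r -natrX ler_nat pattern_class_le.
  apply: cvg_trans (cvgM Lc Lb); apply: near_eq_cvg; apply: nearW => N /=.
  by rewrite bE de exprD expr1 invfM /=; ring.
have dlt : (d.+1 <= 1 + q.+1 * b)%N by rewrite ltn_neqAle dne.
rewrite -[X in _ --> X](mul0r (blockprod M ks)).
have Lc : (#|pattern_class N sigma|%:R / N.+1%:R ^+ (1 + q.+1 * b) : R) @[N --> \oo] --> (0 : R).
  apply: (squeeze_cvgr _ (cvg_cst (0 : R)) (@cvg_harmonic R)).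
  apply: nearW => N; rewrite divr_ge0 ?exprn_ge0//= /harmonic /=.
  rewrite ler_pdivrMr ?exprn_gt0// add1n exprS mulrA mulVf ?pnatr_eq0// mul1r.
  by rewrite -natrX ler_nat (leq_trans (pattern_class_le _ _))// leq_pexp2l.
apply: cvg_trans (cvgM Lc Lb); apply: near_eq_cvg; apply: nearW => N /=.
by rewrite bE exprD expr1 invfM /=; ring.
Qed.

Lemma cvg_tree_moment k (Mi : nat -> nat -> R) M :
  (forall m, (0 < m)%N -> Mi i m @[i --> \oo] --> M m) ->
  tree_moment (Mi i) k @[i --> \oo] --> tree_moment M k.
Proof.
move=> MiM; rewrite /tree_moment big_mkcond; under eq_fun do rewrite big_mkcond.
apply: cvg_sum_seq => sigma; case: ifP => _; last exact: cvg_cst.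
exact: cvg_blockprod.
Qed.

(** Read off from the walk sums with k = 0, whose list of keys is empty, rather than from the
    patterns. *)
Lemma tree_moment0 M : tree_moment M 0 = 1.
Proof.
have L : walk_sum N.+1 0 (fun=> 0) / N.+1%:R @[N --> \oo] --> (1 : R).
  rewrite (_ : (fun _ => _) = fun=> 1); first exact: cvg_cst.
  apply/funext => N; rewrite /walk_sum /keys /= /blockprod.
  rewrite (eq_bigl xpredT); last by case=> -[|a [|b s]] //= _; rewrite /closed_walk /= eqxx.
  under eq_bigr do rewrite big_nil.
  by rewrite sumr_const card_tuple card_ord expn1 divff// pnatr_eq0.
have H := @cvg_walk_sum 0 (fun _ _ => 0) (fun=> 0).
have E : tree_moment M 0 = tree_moment (fun=> 0) 0.
  by apply: eq_bigr => sigma _; rewrite /keys /blockprod /= !big_nil.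
rewrite E; apply: (cvg_unique _ (H _) L) => // m _.
by under eq_fun do rewrite mulr0; exact: cvg_cst.
Qed.

Lemma eq_tree_moment M M' k : (forall m, (0 < m)%N -> M m = M' m) ->
  tree_moment M k = tree_moment M' k.
Proof. by move=> E; apply: eq_bigr => sigma _; exact: eq_blockprod. Qed.

Lemma tree_moment_scale a M k :
  tree_moment (fun m => a ^+ m * M m) k = a ^+ k * tree_moment M k.
Proof.
rewrite /tree_moment mulr_sumr; apply: eq_bigr => sigma _.
by rewrite blockprod_scale size_keys.
Qed.

Lemma ler_norm_tree_moment M M' k : (forall m, (0 < m)%N -> `|M m| <= M' m) ->
  `|tree_moment M k| <= tree_moment M' k.
Proof.
move=> MM'; rewrite (le_trans (ler_norm_sum _ _ _))//; apply: ler_sum => sigma _.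
exact: ler_norm_blockprod.
Qed.

Section growth.
Variable N : nat.
Let n : R := N.+1%:R ^+ q.+1.
Let n0 : 0 < n. Proof. by rewrite exprn_gt0. Qed.

Lemma card_same_key (u : 'I_N.+1) (kap : seq nat) :
  (#|[set x : q.+1.-tuple 'I_N.+1 | key (rcons (map val x) (val u)) == kap]%SET|
   <= q.+1`!)%N.
Proof.
set A := [set _ | _]%SET; have [->|[x0 x0A]] := set_0Vmem A; first by rewrite cards0.
rewrite -(card_Sn q.+1).
pose h (p : 'S_q.+1) : q.+1.-tuple 'I_N.+1 := [tuple tnth x0 (p i) | i < q.+1].
apply: leq_trans (leq_imset_card h _); apply: subset_leq_card.
apply/fintype.subsetP => x; rewrite inE => /eqP xE.
move: x0A; rewrite inE -xE eq_sym key_eq perm_rcons perm_sym perm_rcons perm_cons => H.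
have /tuple_permP[p Ep] : perm_eq x x0.
  by rewrite perm_sym; exact: (perm_map_inj val_inj).
by apply/imsetP; exists p => //; apply: val_inj; exact: Ep.
Qed.

(** The origin of the factor k!. Hyperedges are prepended one at a time: a fresh key costs n^-1 for
    at most n choices, and a repeated one is among the k present keys, each with at most (q + 1)!
    orderings. Together this is at most (q + 2)! (k + 1). No enumeration of trees is involved. *)
Lemma sum_walk_weight k :
  \sum_(s : (wsize q k).-tuple 'I_N.+1)
     n ^- size (undup (keys q k (map val s))) <=
  N.+1%:R * (q.+2`!%:R ^+ k * k`!%:R) :> R.
Proof.
elim: k => [|k IH].
  rewrite /keys /=; under eq_bigr do rewrite expr0 invr1.
  by rewrite sumr_const card_tuple card_ord expn1 expr0 fact0 !mulr1.
rewrite (big_tuple_cat (m := q.+1) (n := wsize q k)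
  (fun s => n ^- size (undup (keys q k.+1 (map val s)))))//; last first.
  by rewrite /wsize mulSn addnS.
rewrite exchange_big.
apply: (@le_trans _ _ (\sum_(s : (wsize q k).-tuple 'I_N.+1)
    n ^- size (undup (keys q k (map val s))) * (q.+2`!%:R * k.+1%:R))); last first.
  rewrite -mulr_suml (factS k) natrM exprSr.
  rewrite (_ : N.+1%:R * _ = N.+1%:R * (q.+2`!%:R ^+ k * k`!%:R) * (q.+2`!%:R * k.+1%:R)); last by ring.
  by rewrite ler_wpM2r// mulr_ge0.
apply: ler_sum => s _; set ks := keys q k (map val s).
pose u := thead (s : (k * q.+1).+1.-tuple 'I_N.+1).
have Es : map val s = val u :: behead (map val s).
  by rewrite /u; case: (s) => -[//|a s' i] /=; rewrite (thead_tuple _) || rewrite /thead (tnth_nth ord0).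
have kE (x : q.+1.-tuple 'I_N.+1) : keys q k.+1 (map val (x ++ s)) =
    key (rcons (map val x) (val u)) :: ks.
  rewrite map_cat /keys /=; congr (key _ :: map key (hedges _ _ _)).
    rewrite take_cat size_map size_tuple ltnNge leqnSn /= subSnn Es /= take0.
    by rewrite cats1.
  by rewrite drop_size_cat// size_map size_tuple.
apply: (@le_trans _ _ (\sum_(x : q.+1.-tuple 'I_N.+1) n ^- size (undup ks) *
    (n^-1 + (key (rcons (map val x) (val u)) \in ks)%:R))).
  apply: ler_sum => x _; rewrite kE /=; case: (boolP (_ \in ks)) => xk.
    by rewrite ler_peMr ?invr_ge0 ?exprn_ge0 ?(ltW n0)// lerDr invr_ge0 ltW.
  by rewrite /= addr0 exprSr invfM.
rewrite -mulr_sumr ler_wpM2l ?invr_ge0 ?exprn_ge0 ?(ltW n0)//.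
rewrite big_split /= sumr_const card_tuple card_ord -natr1 mulrDr mulr1 addrC.
apply: lerD.
  rewrite (@le_trans _ _ (\sum_(kap <- ks) \sum_(x : q.+1.-tuple 'I_N.+1)
      (key (rcons (map val x) (val u)) == kap)%:R))//.
    rewrite exchange_big /=; apply: ler_sum => x _.
    elim: (ks) => [|a ks' IHk]; first by rewrite big_nil.
    rewrite big_cons in_cons; case: eqP => _ /=; last by rewrite add0r.
    by rewrite lerDl sumr_ge0// => i _; rewrite ler0n.
  apply: (@le_trans _ _ (\sum_(kap <- ks) q.+2`!%:R)).
    apply: ler_sum => kap _; rewrite -natr_sum ler_nat.
    rewrite sum1dep_card || rewrite -big_mkcond /= sum1dep_card.
    rewrite (leq_trans (card_same_key _ _))// factS leq_pmull//.
  by rewrite big_const_seq iter_addr_0 count_predT size_keys mulr_natr.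
by rewrite -[_ *+ _]mulr_natr natrX -/n mulVf ?gt_eqF// ler1n fact_gt0.
Qed.

End growth.

(** Comparison with M constant equal to 1, whose tree moment is a limit of normalised walk weights;
    walks that are not closed only increase the bound. *)
Lemma tree_moment_growth M C k : 0 <= C -> (forall m, (0 < m)%N -> `|M m| <= C ^+ m) ->
  `|tree_moment M k| <= (q.+2`!%:R * C) ^+ k * k`!%:R.
Proof.
move=> C0 MC.
have H : tree_moment (fun=> 1) k <= q.+2`!%:R ^+ k * k`!%:R :> R.
  have L := @cvg_walk_sum k (fun N _ => (N.+1%:R ^+ q.+1)^-1) (fun=> 1).
  have {}L := L (fun m _ => _).
  have E : walk_sum N.+1 k (fun=> (N.+1%:R ^+ q.+1)^-1) / N.+1%:R @[N --> \oo] --> tree_moment (fun=> 1) k.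
    apply: L; under eq_fun do rewrite mulfV ?expf_neq0 ?pnatr_eq0//.
    exact: cvg_cst.
  apply: (cvgr_to_le E); apply: nearW => N; rewrite ler_pdivrMr// mulrC.
  apply: le_trans (sum_walk_weight N k); rewrite /walk_sum [leRHS](bigID (fun s : (wsize q k).-tuple 'I_N.+1 => closed_walk (map val s)))/=.
  rewrite ler_wpDr//; first by apply: sumr_ge0 => s _; rewrite invr_ge0 !exprn_ge0.
  apply: ler_sum => s _; rewrite /blockprod big_const_seq count_predT.
  by rewrite iter_mulr_1 exprVn.
apply: (@le_trans _ _ (tree_moment (fun m => C ^+ m * 1) k)).
  by apply: ler_norm_tree_moment => m m0; rewrite mulr1 MC.
rewrite tree_moment_scale exprMn mulrC -mulrA [C ^+ k * _]mulrC mulrA.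
by rewrite ler_wpM2r ?exprn_ge0.
Qed.

End limiting_moments.

(** * Particular walks that bound tree moments from below *)

Section lower_bounds.
Context {R : realType}.
Implicit Types (N k q b : nat).

Lemma big_tuple_cons (T : finType) k (F : seq T -> R) :
  \sum_(t : k.+1.-tuple T) F t = \sum_(x : T) \sum_(t : k.-tuple T) F (x :: t).
Proof.
rewrite (@big_tuple_cat R T k.+1 1 k)//.
rewrite (reindex (fun x : T => [tuple x])) /=; first by [].
exists (fun t : 1.-tuple T => thead t) => [x _|t _].
  by rewrite /thead (tnth_nth x).
by rewrite [RHS](tuple_eta t); apply: val_inj => /=; case: t => -[|? []].
Qed.

(** A closed walk around a centre a. A branch x is walked outwards from a to its last vertex, then
    back to a with the same other vertices in between: both passages have the same key. *)
Definition star q (T : Type) (a : T) (xs : seq (seq T)) : seq T :=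
  a :: flatten [seq x ++ rcons (take q x) a | x <- xs].

Lemma map_star q (T T' : Type) (g : T -> T') a xs :
  map g (star q a xs) = star q (g a) (map (map g) xs).
Proof.
rewrite /star /= map_flatten -!map_comp; congr (_ :: flatten _).
by apply: eq_map => x /=; rewrite map_cat map_rcons map_take.
Qed.

Lemma keys_star q (a : nat) (xs : seq (seq nat)) :
  all (fun x => size x == q.+1) xs ->
  keys q (size xs).*2 (star q a xs) =
  flatten [seq [:: key (a :: x); key (a :: x)] | x <- xs].
Proof.
elim: xs => [|x xs IH] //= /andP[/eqP sx /IH {}IH].
pose r := flatten [seq x ++ rcons (take q x) a | x <- xs].
have sz : size (take q x) = q by rewrite size_take sx ltnSn.
have Ex : x = rcons (take q x) (last 0%N x).
  have := take_nth 0%N (n := q) (s := x); rewrite sx => /(_ (ltnSn q)).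
  by rewrite -sx take_size => {1}->; rewrite -[last _ _]nth_last sx.
have -> : star q a (x :: xs) = a :: x ++ rcons (take q x) a ++ r.
  by rewrite /star /= -/r catA.
rewrite /keys /= -/(keys q _ _).
have -> : take q.+1 (x ++ rcons (take q x) a ++ r) = x.
  by rewrite -sx take_size_cat.
have Ed : drop q (x ++ rcons (take q x) a ++ r) = last 0%N x :: rcons (take q x) a ++ r.
  by rewrite {1}Ex cat_rcons -{1}sz drop_size_cat.
rewrite Ed /= -!IH; congr [:: _, _ & _].
  have -> : take q.+1 (rcons (take q x) a ++ r) = rcons (take q x) a.
    by rewrite take_size_cat// size_rcons sz.
  apply/eqP; rewrite key_eq; apply/seq.permP => z.
  by rewrite /= -cats1 count_cat /= [in RHS]Ex -cats1 count_cat /=; lia.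
congr (keys _ _ _); rewrite /star -/r cat_rcons -{1}sz drop_size_cat//.
Qed.

Lemma blockprod_dup (K : eqType) (c : R) (ks : seq K) :
  blockprod (fun m => c * (~~ odd m)%:R) (flatten [seq [:: x; x] | x <- ks]) =
  c ^+ size (undup ks).
Proof.
set dd := flatten _.
have cnt x : count_mem x dd = (count_mem x ks).*2.
  by rewrite /dd; elim: ks {dd} => //= y ks ->; rewrite addnA addnn doubleD.
have pe : perm_eq (undup dd) (undup ks).
  apply: perm_undup => x; rewrite -!has_pred1 !has_count cnt.
  by case: count.
rewrite /blockprod (perm_big _ pe) /= (eq_bigr (fun=> c)); last first.
  by move=> x _; rewrite cnt odd_double mulr1.
by rewrite big_const_seq count_predT iter_mulr_1.
Qed.

Lemma star_inj q (T : eqType) (a a' : T) (xs xs' : seq (seq T)) :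
  all (fun x => size x == q.+1) xs -> all (fun x => size x == q.+1) xs' ->
  size xs = size xs' -> star q a xs = star q a' xs' -> a = a' /\ xs = xs'.
Proof.
rewrite /star => A A' S [<-{a'} E]; split=> //.
elim: xs xs' A A' S E => [|x xs IH] [|x' xs'] //= /andP[/eqP sx A] /andP[/eqP sx' A'] [S].
rewrite -!catA => /eqP; rewrite eqseq_cat ?sx ?sx'// => /andP[/eqP <- /eqP E].
congr (_ :: _); apply: IH => //; apply/eqP.
by move: E => /eqP; rewrite eqseq_cat// => /andP[].
Qed.

Section sorted_stars.
Variables (q N : nat).
Let X := q.+1.-tuple 'I_N.+1.
Let srt (x : X) := sorted leq (map val x).
Let n : R := N.+1%:R ^+ q.+1.
Let n0 : 0 < n. Proof. by rewrite exprn_gt0. Qed.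

(** Sorted branches have distinct keys once the centre is added, so distinct branches count distinct
    hyperedges; at least b of them are required. *)
Definition star_sum k b : R :=
  \sum_(xs : k.-tuple X | all srt xs && (b <= size (undup xs))%N) n ^- size (undup xs).

(** Prepending a branch that is already present adds no key, and there are at least b such
    branches. *)
Lemma star_sum_rec k b : b%:R * star_sum k b <= star_sum k.+1 b.
Proof.
rewrite /star_sum [leRHS]big_mkcond /=.
rewrite (@big_tuple_cons _ k (fun xs : seq X => if all srt xs && (b <= size (undup xs))%N
  then n ^- size (undup xs) else 0)) /= exchange_big /= mulr_sumr big_mkcond /=.
have w0 j : 0 <= n ^- j by rewrite invr_ge0 exprn_ge0// ltW.
apply: ler_sum => xs _; case: ifP => [/andP[sxs bxs]|_]; last first.
  by apply: sumr_ge0 => x _; case: ifP.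
apply: (@le_trans _ _ (\sum_(x <- undup xs) n ^- size (undup xs))).
  by rewrite big_const_seq count_predT iter_addr_0 -[leRHS]mulr_natl ler_wpM2r// ler_nat.
rewrite big_uniq ?undup_uniq//= big_mkcond /=; apply: ler_sum => x _.
rewrite mem_undup; case: ifP => xx; last by case: ifP.
by rewrite (allP sxs _ xx) sxs bxs.
Qed.

Lemma star_sum_base b : (#|[set x : X | srt x]%SET| ^_ b)%:R / n ^+ b <= star_sum b b.
Proof.
rewrite -card_uniq_tuples mulr_natl -sumr_const /star_sum.
rewrite [leLHS]big_mkcond [leRHS]big_mkcond /=; apply: ler_sum => xs _.
have w0 j : 0 <= n ^- j by rewrite invr_ge0 exprn_ge0// ltW.
rewrite inE; case: ifP => [/andP[axs uxs]|_]; last by case: ifP.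
rewrite undup_id// size_tuple leqnn andbT ifT//.
apply/allP => x xin.
have : x \in [set x : X | srt x]%SET by exact: (allP axs x xin).
by rewrite inE.
Qed.

Lemma walk_sum_star k b : N.+1%:R * star_sum k b <=
  walk_sum q N.+1 k.*2 (fun m => n^-1 * (~~ odd m)%:R).
Proof.
pose st (z : 'I_N.+1 * k.-tuple X) := star q z.1 (map val z.2).
have sall (xs : k.-tuple X) : all (fun x => size x == q.+1) (map val xs).
  by rewrite all_map; apply/allP => x _ /=; rewrite size_tuple.
have ssz z : size (st z) == wsize q k.*2.
  rewrite /st /star /= size_flatten /shape -!map_comp /wsize eqSS.
  rewrite -[X in _ == (X.*2 * _)%N](size_tuple z.2).
  apply/eqP; elim: (tval z.2) => //= x xs ->.
  by rewrite size_cat size_rcons size_take size_tuple ltnSn -mul2n; lia.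
pose h z := Tuple (ssz z).
have hinj : injective h.
  move=> [a xs] [a' xs'] /(congr1 val) /= /star_inj[] //; rewrite ?size_map ?size_tuple//.
  by move=> /= -> /inj_map E; congr pair; apply: val_inj; apply: E; exact: val_inj.
pose F (s : (wsize q k.*2).-tuple 'I_N.+1) : R := if closed_walk (map val s) then
  blockprod (fun m => n^-1 * (~~ odd m)%:R) (keys q k.*2 (map val s)) else 0.
have F0 s : 0 <= F s.
  rewrite /F; case: ifP => // _; apply: blockprod_ge0 => m _.
  by rewrite mulr_ge0// invr_ge0 ltW.
rewrite /walk_sum [leRHS]big_mkcond /= -/F.
apply: le_trans (ler_sum_inj hinj F0).
rewrite -(pair_big xpredT xpredT (fun a xs => F (h (a, xs)))) /=.
rewrite mulr_natl -[X in _ *+ X](card_ord N.+1) -sumr_const.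
apply: ler_sum => a _; rewrite /star_sum big_mkcond /=; apply: ler_sum => xs _.
case: ifP => [/andP[sxs _]|_] //.
have hE : map val (h (a, xs)) = star q (val a) (map (map val) (map val xs)).
  exact: map_star.
rewrite /F hE.
have cl : closed_walk (star q (val a) [seq [seq val i | i <- x] | x <- [seq val i | i <- xs]]).
  rewrite /closed_walk /star /=; case/lastP : (map (map val) _) => [|ys y]; first by rewrite eqxx.
  by rewrite map_rcons flatten_rcons last_cat last_cat last_rcons.
rewrite ifT//.
have := @keys_star q (val a) (map (map val) (map val xs)).
rewrite !size_map size_tuple => ->; last first.
  by rewrite !all_map; apply/allP => x _ /=; rewrite size_map size_tuple.
rewrite -map_comp -map_comp.
rewrite (_ : [seq _ | i <- xs] = [seq [:: y; y] |
  y <- [seq key (val a :: map val x) | x : X <- xs]]); last by rewrite -map_comp.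
rewrite blockprod_dup exprVn.
have inj : {in xs &, injective (fun x : X => key (val a :: map val x))}.
  move=> x y /(allP sxs) sx /(allP sxs) sy /eqP; rewrite key_eq perm_cons => pxy.
  apply: val_inj; apply: (inj_map val_inj).
  by apply: (sorted_eq leq_trans anti_leq sx sy pxy).
by have [_ ->] := @blockprod_map R _ _ (fun=> 0) _ _ inj.
Qed.

End sorted_stars.

Lemma card_sorted_ge q N : (N.+1 ^ q.+1 <=
  #|[set x : q.+1.-tuple 'I_N.+1 | sorted leq (map val x)]%SET| * q.+1`!)%N.
Proof.
rewrite card_sorted_tuples bin_ffact.
elim: q.+1 => [|j IH]; first by rewrite ffactn0.
rewrite addSn ffactSS expnS leq_mul// -addSn.
by rewrite ltnS leq_addl.
Qed.

(** Stars with b distinct branches have total weight bounded below, and each further branch gains a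
    factor b. As b is arbitrary, even tree moments outgrow every geometric sequence. *)
Lemma tree_moment_star q b : (0 < b)%N -> exists2 c : R, 0 < c & forall k, (b <= k)%N ->
  c * b%:R ^+ k <= tree_moment q (fun m => (~~ odd m)%:R) k.*2.
Proof.
(* At least n / (q + 1)! tuples are sorted; for N large, half of this proportion remains after b of
   them are excluded. *)
move=> b0; pose c0 : R := (2 * q.+1`!%:R)^-1.
have f0 : 0 < q.+1`!%:R :> R by rewrite ltr0n fact_gt0.
have c00 : 0 < c0 by rewrite invr_gt0 mulr_gt0.
have bb : 0 < b%:R :> R by rewrite ltr0n.
exists (c0 ^+ b / b%:R ^+ b); first by rewrite divr_gt0 ?exprn_gt0.
move=> k bk.
have base : \forall N \near \oo, c0 ^+ b <= star_sum q N b b.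
  near=> N; apply: le_trans (star_sum_base q N b).
  set X := #|_|; set n := N.+1%:R ^+ q.+1.
  have n0 : 0 < n by rewrite exprn_gt0.
  have nX : n <= X%:R * q.+1`!%:R.
    by rewrite /n -natrX -natrM ler_nat card_sorted_ge.
  have bn : 2 * b%:R * q.+1`!%:R <= n.
    rewrite (@le_trans _ _ N.+1%:R)//; last by rewrite /n exprS ler_peMr// exprn_ege1// ler1n.
    rewrite -natrM -natrM ler_nat ltnW// ltnS; near: N; exact: nbhs_infty_ge.
  have Xb : c0 * n <= X%:R - b%:R.
    rewrite /c0 mulrC ler_pdivrMr ?mulr_gt0//; nra.
  rewrite ler_pdivlMr ?exprn_gt0// -exprMn.
  have Xb' : (b <= X)%N.
    by rewrite -(ler_nat R) -subr_ge0 (le_trans _ Xb)// mulr_ge0// ltW.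
  apply: (@le_trans _ _ ((X - b)%:R ^+ b)).
    by rewrite natrB// lerXn2r ?nnegrE ?mulr_ge0 ?(ltW c00) ?(ltW n0)// subr_ge0 ler_nat.
  rewrite -natrX ler_nat.
  suff H j : (j <= b)%N -> ((X - b) ^ j <= X ^_ j)%N by exact: H.
  elim: j => [|j IH] jb; first by rewrite ffactn0.
  rewrite expnSr ffactnSr leq_mul ?IH ?(ltnW jb)// leq_sub2l// ltnW//.
have step N : b%:R ^+ (k - b) * star_sum q N b b <= star_sum q N k b.
  rewrite -{2}(subnK bk); elim: (k - b)%N => [|j IH]; first by rewrite mul1r.
  rewrite exprS -mulrA addSn (le_trans _ (star_sum_rec _ _ _ _))//.
  by rewrite ler_wpM2l.
have L : walk_sum q N.+1 k.*2 (fun m => (N.+1%:R ^+ q.+1)^-1 * (~~ odd m)%:R) / N.+1%:R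
    @[N --> \oo] --> tree_moment q (fun m => (~~ odd m)%:R : R) k.*2.
  apply: (@cvg_walk_sum R q k.*2 (fun N m => (N.+1%:R ^+ q.+1)^-1 * (~~ odd m)%:R)) => m _.
  under eq_fun do rewrite mulrA mulfV ?expf_neq0 ?pnatr_eq0// mul1r.
  exact: cvg_cst.
apply: (cvgr_to_ge L); near=> N.
rewrite ler_pdivlMr// mulrC (le_trans _ (walk_sum_star q N k b))// ler_wpM2l//.
apply: le_trans (step N).
rewrite (_ : _ / _ * _ = b%:R ^+ (k - b) * c0 ^+ b); last first.
  by rewrite -[in LHS](subnK bk) exprD; field; rewrite expf_neq0// gt_eqF.
rewrite ler_wpM2l ?exprn_ge0//; near: N; exact: base.
Unshelve. all: by end_near. Qed.

Lemma hedges_step q k (x : nat) (y : seq nat) z r : size y = q ->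
  hedges q k.+1 (x :: y ++ z :: r) = (x :: rcons y z) :: hedges q k (z :: r).
Proof.
move=> sy /=; congr ((_ :: _) :: hedges _ _ _).
  rewrite -cat_rcons take_size_cat// size_rcons sy//.
by rewrite -sy drop_size_cat.
Qed.

(** One hyperedge with distinguished vertices a, b, c and others w is crossed three times, from a to
    b, from b to c and from c to a. It must hold three vertices, hence [q.+1]. In dimension N there
    are N^(q + 3) choices of weight N^-(q + 2), and the normalisation takes the remaining N. *)
Lemma tree_moment_triangle q : 1 <= tree_moment q.+1 (fun m => (m == 3%N)%:R : R) 3.
Proof.
have L : walk_sum q.+1 N.+1 3 (fun m => (N.+1%:R ^+ q.+2)^-1 * (m == 3%N)%:R) / N.+1%:R
    @[N --> \oo] --> tree_moment q.+1 (fun m => (m == 3%N)%:R : R) 3.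
  apply: (@cvg_walk_sum R q.+1 3 (fun N m => (N.+1%:R ^+ q.+2)^-1 * (m == 3%N)%:R)) => m _.
  under eq_fun do rewrite mulrA mulfV ?expf_neq0 ?pnatr_eq0// mul1r.
  exact: cvg_cst.
apply: (cvgr_to_ge L); apply: nearW => N.
pose tr (T : Type) (a b c : T) (w : seq T) : seq T :=
  a :: (c :: w ++ [:: b]) ++ (a :: w ++ [:: c]) ++ (b :: w ++ [:: a]).
have trmap (T T' : Type) (g : T -> T') (a b c : T) (w : seq T) :
    map g (tr T a b c w) = tr T' (g a) (g b) (g c) (map g w).
  by rewrite /tr /= !(map_cat, map_cons).
pose st (t : q.+3.-tuple 'I_N.+1) : seq 'I_N.+1 :=
  tr _ (nth ord0 t 0) (nth ord0 t 1) (nth ord0 t 2) (drop 3 t).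
have ssz t : size (st t) == wsize q.+1 3.
  rewrite /st /tr /= !(size_cat, size_drop, size_tuple) /= /wsize.
  by apply/eqP; lia.
pose h t := Tuple (ssz t).
have hinj : injective h.
  move=> t t' /(congr1 val) /=; rewrite /st /tr => E; apply: val_inj => /=.
  have tE (u : q.+3.-tuple 'I_N.+1) :
      tval u = [:: nth ord0 u 0, nth ord0 u 1, nth ord0 u 2 & drop 3 u].
    by case: u => -[|x [|y [|z s]]] //= _; rewrite drop0.
  rewrite (tE t) (tE t'); move: E => [-> -> E].
  have sd (u : q.+3.-tuple 'I_N.+1) : size (drop 3 u) = q.
    by rewrite size_drop size_tuple; lia.
  move: E; rewrite -!catA => /eqP; rewrite eqseq_cat ?sd// => /andP[/eqP -> /eqP].
  by move=> [->].
pose F (s : (wsize q.+1 3).-tuple 'I_N.+1) : R := if closed_walk (map val s) then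
  blockprod (fun m => (N.+1%:R ^+ q.+2)^-1 * (m == 3%N)%:R) (keys q.+1 3 (map val s)) else 0.
have n0 : 0 < N.+1%:R ^+ q.+2 :> R by rewrite exprn_gt0.
have F0 s : 0 <= F s.
  rewrite /F; case: ifP => // _; apply: blockprod_ge0 => m _.
  by rewrite mulr_ge0// invr_ge0 ltW.
rewrite ler_pdivlMr// mul1r /walk_sum [leRHS]big_mkcond /= -/F.
apply: le_trans (ler_sum_inj hinj F0).
rewrite (eq_bigr (fun=> (N.+1%:R ^+ q.+2)^-1)); last first.
  move=> t _; have hE := trmap _ _ val (nth ord0 t 0) (nth ord0 t 1) (nth ord0 t 2) (drop 3 t).
  rewrite /F -[map val (h t)]/(map val (tr _ _ _ _ _)) hE.
  set a := val (nth _ t 0); set b := val (nth _ t 1); set c := val (nth _ t 2).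
  set w := map val (drop 3 t).
  have sw : size w = q by rewrite size_map size_drop size_tuple; lia.
  rewrite ifT; last by rewrite /closed_walk /tr /= ?last_cat /= ?last_cat /= ?last_cat /= eqxx.
  have -> : keys q.+1 3 (tr _ a b c w) = [:: key (a :: c :: rcons w b); key (a :: c :: rcons w b); key (a :: c :: rcons w b)].
    have -> : tr _ a b c w = a :: (c :: w) ++ b :: (a :: w) ++ c :: (b :: w) ++ [:: a].
      by rewrite /tr /= -!catA.
    rewrite /keys !hedges_step /=; try by rewrite sw.
    congr [:: _; _; _]; apply/eqP; rewrite key_eq; apply/seq.permP => z;
    rewrite /= -!cats1 !count_cat /=; lia.
  rewrite /blockprod /= !inE !eqxx /= big_cons big_nil /= !eqxx /= mulr1.
  by rewrite mulr1.
rewrite sumr_const card_tuple card_ord -[leRHS]mulr_natr natrX exprS mulrCA.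
by rewrite mulVf ?mulr1// gt_eqF.
Qed.

End lower_bounds.

(** * Spectral measures of the contraction *)

Section spectral_weights.
Context {R : realType} (N : nat).
Implicit Types A : 'M[R]_N.+1.

Lemma esd_integral A (f : R -> R) : measurable_fun setT f ->
  \int[esd A]_y f y = N.+1%:R^-1 * \sum_(l <- eigenvalues A) f l.
Proof.
move=> mf; have mE : measurable_fun setT (EFin \o f) by exact/measurable_EFinP.
have szE : size (eigenvalues A) = N.+1 by rewrite size_map size_enum_ord.
have H (g : R -> \bar R) : measurable_fun setT g -> (forall y, 0 <= g y)%E ->
    (\int[esd A]_y g y = (N.+1%:R^-1)%:E * \sum_(k < N.+1) g (eigenvalues A)`_k)%E.
  move=> mg g0; rewrite /esd ge0_integral_mscale//; congr *%E.
  rewrite ge0_integral_measure_sum//; apply: eq_bigr => k _.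
  by rewrite integral_dirac// diracT mul1e.
rewrite /Rintegral integralE H; [|exact: measurable_funepos|by move=> y; exact: funepos_ge0].
rewrite H; [|exact: measurable_funeneg|by move=> y; exact: funeneg_ge0].
rewrite [in RHS](big_nth 0) szE big_mkord.
transitivity (fine ((N.+1%:R^-1 * \sum_(k < N.+1) Num.max (f (eigenvalues A)`_k) 0)%:E
   - (N.+1%:R^-1 * \sum_(k < N.+1) Num.max (- f (eigenvalues A)`_k) 0)%:E)%E).
  rewrite !EFinM -!sumEFin; congr (fine (_ * _ - _ * _)%E); apply: eq_bigr => k _.
    by rewrite funeposE /= EFin_max.
  by rewrite funenegE /= EFin_max.
rewrite -EFinB /= -mulrBr -sumrB; congr (_ * _); apply: eq_bigr => k _.
by rewrite /Num.max; do 2 case: ifP; lra.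
Qed.

Lemma conjugate_diag_pow (F : comNzRingType) (U V : 'M[F]_N.+1) (d : 'rV_N.+1) k :
  U *m V = 1%:M -> V *m U = 1%:M ->
  (U *m diag_mx d *m V) ^+ k = U *m diag_mx (\row_i (d ord0 i ^+ k)) *m V.
Proof.
move=> UV VU; elim: k => [|k IH].
  rewrite expr0 (_ : \row_i _ = const_mx 1); last by apply/rowP => i; rewrite !mxE.
  by rewrite diag_const_mx mulmx1 UV.
rewrite exprS IH -mulmxE !mulmxA -(mulmxA _ V) VU mulmx1; congr (_ *m _).
rewrite -!mulmxA; congr (_ *m _).
by rewrite mulmx_diag; congr diag_mx; apply/rowP => i; rewrite !mxE exprS.
Qed.

(** [w a] is the spectral measure of A at the a-th basis vector, made of squared moduli of
    coordinates of unit eigenvectors; unitarity in both orders makes w doubly stochastic. *)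
Lemma spectral_weights A : A^T = A ->
  exists w : 'I_N.+1 -> 'I_N.+1 -> R,
  [/\ forall a i, 0 <= w a i, forall a, \sum_i w a i = 1, forall i, \sum_a w a i = 1 &
      forall k a, (A ^+ k) a a = \sum_i w a i * (eigenvalues A)`_i ^+ k].
Proof.
move=> symA; pose C := map_mx (real_complex R) A.
have hermC : C \is hermsymmx.
  apply/is_hermitianmxP; rewrite expr0 scale1r.
  apply/matrixP => i j; rewrite !mxE -[in LHS]symA mxE.
  by apply/esym/CrealP/complex_realP; exists (A j i).
have /mxOverP realD := hermitian_spectral_diag_real hermC.
have /orthomx_spectralP defC := hermitian_normalmx hermC.
set V := spectralmx C in defC; set D := spectral_diag C in defC realD.
have uV : V \is unitarymx := spectral_unitarymx C.
have iV := invmx_unitary uV.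
have Vu : V \in unitmx by exact: unitarymx_unit.
have lE (i : 'I_N.+1) : (eigenvalues A)`_i = complex.Re (D ord0 i).
  rewrite /eigenvalues (nth_map ord0) ?size_enum_ord//.
  by rewrite nth_ord_enum.
have DE (i : 'I_N.+1) : D ord0 i = real_complex R (eigenvalues A)`_i.
  by rewrite lE /= RRe_real.
have CkE k : C ^+ k = invmx V *m diag_mx (\row_i (D ord0 i ^+ k)) *m V.
  rewrite (congr1 (fun M => M ^+ k) defC).
  by apply: conjugate_diag_pow; rewrite ?mulmxV ?mulVmx.
pose z i a := V i a; pose w a i := complex.Re (z i a) ^+ 2 + complex.Im (z i a) ^+ 2.
have wE a i : real_complex R (w a i) = (z i a)^* * z i a.
  by rewrite mulrC -normCK normc_def -rmorphXn sqr_sqrtr// addr_ge0 ?sqr_ge0.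
exists w; split.
- by move=> a i; rewrite addr_ge0// sqr_ge0.
- move=> a; apply: (fmorph_inj (real_complex R)); rewrite rmorph_sum rmorph1.
  transitivity (\sum_i (z i a)^* * z i a); first by apply: eq_bigr => i _; exact: wE.
  have /matrixP/(_ a a) := mulVmx Vu.
  rewrite iV !mxE eqxx => H; apply: etrans H; apply: eq_bigr => i _; by rewrite !mxE.
- move=> i; apply: (fmorph_inj (real_complex R)); rewrite rmorph_sum rmorph1.
  transitivity (\sum_a (z i a)^* * z i a); first by apply: eq_bigr => a _; exact: wE.
  have /matrixP/(_ i i) := mulmxV Vu.
  rewrite iV !mxE eqxx => H; apply: etrans H; apply: eq_bigr => a _; by rewrite !mxE mulrC.
- move=> k a; apply: (fmorph_inj (real_complex R)); rewrite rmorph_sum.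
  apply: (@etrans _ _ ((C ^+ k) a a)); first by rewrite /C -rmorphXn mxE.
  rewrite CkE iV mul_mx_diag mxE; apply: eq_bigr => i _.
  rewrite !mxE; apply: (@etrans _ _ ((z i a)^* * z i a * D ord0 i ^+ k)).
    by rewrite mulrAC.
  by rewrite -wE DE -rmorphXn -rmorphM.
Qed.

Lemma sum_eigenvalues A (w : 'I_N.+1 -> 'I_N.+1 -> R) (f : R -> R) :
  (forall i, \sum_a w a i = 1) ->
  \sum_(l <- eigenvalues A) f l = \sum_a \sum_i w a i * f (eigenvalues A)`_i.
Proof.
move=> w1; rewrite exchange_big /= (big_nth 0) size_map size_enum_ord big_mkord.
by apply: eq_bigr => i _; rewrite -mulr_suml w1 mul1r.
Qed.

Lemma sum_eigenvalues_pow A k : A^T = A -> \sum_(l <- eigenvalues A) l ^+ k = \tr (A ^+ k).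
Proof.
move=> /spectral_weights[w [_ _ w1 wk]].
by rewrite (sum_eigenvalues A (fun l => l ^+ k) w1); apply: eq_bigr => a _; rewrite wk.
Qed.

Lemma sum_eigenvalues_horner A Q : A^T = A ->
  \sum_(l <- eigenvalues A) Q.[l] = Lin (fun k => \tr (A ^+ k)) Q.
Proof.
move=> sA; rewrite /Lin; under eq_bigr do rewrite horner_coef.
rewrite exchange_big /=; apply: eq_bigr => i _.
by rewrite -mulr_sumr sum_eigenvalues_pow.
Qed.

(** Jensen's inequality for the concave minimum with 1, against the weights w. Eigenvalues are
    thereby replaced by the diagonal of the square, where large entries can be treated row by
    row. *)
Lemma eigenvalues_sum_le A (m : R) : 0 < m -> A^T = A ->
  \sum_(l <- eigenvalues A) Num.min 1 (l ^+ 2 / m) <=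
  \sum_a Num.min 1 ((A ^+ 2) a a / m).
Proof.
move=> m0 /spectral_weights[w [w0 wr wc wk]].
rewrite (sum_eigenvalues A (fun l => Num.min 1 (l ^+ 2 / m)) wc).
apply: ler_sum => a _; rewrite le_min; apply/andP; split.
  rewrite -[leRHS](wr a); apply: ler_sum => i _.
  by rewrite ler_piMr// ge_min lexx.
rewrite wk mulr_suml; apply: ler_sum => i _.
by rewrite -mulrA ler_wpM2l// ge_min lexx orbT.
Qed.

Lemma eigenvalue_sqr_le A (l : R) : A^T = A -> l \in eigenvalues A ->
  l ^+ 2 <= \tr (A ^+ 2).
Proof.
move=> sA lA; rewrite -sum_eigenvalues_pow// (big_rem l)//= lerDl.
by apply: sumr_ge0 => i _; rewrite sqr_ge0.
Qed.

End spectral_weights.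

(** * Traces of powers as sums over closed walks *)

Section contraction_trace.
Context {R : realType} (q N : nat) (c : R).
Implicit Types Y : seq nat -> R.

(** The array Y is arbitrary and c stands for the normalisation, so that the random tensor and the
    finite atomic models share one expansion into walks. *)
Definition contraction Y : 'M[R]_N.+1 := \matrix_(a, b)
  (c * \sum_(j : q.-tuple 'I_N.+1) Y (key (map val [:: a, b & j]))).

Lemma contraction_sym Y : (contraction Y)^T = contraction Y.
Proof.
apply/matrixP => a b; rewrite !mxE; congr (_ * _); apply: eq_bigr => j _.
congr (Y _); apply/eqP; rewrite key_eq /=; apply/seq.permP => z /=; lia.
Qed.

Definition walk_weight Y k (s : seq nat) := \prod_(e <- keys q k s) Y e.

(** Placing the summed indices j between the matrix indices a and u yields the slicing of [hedges]:
    consecutive factors share the intermediate matrix index. *)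
Lemma contraction_pow Y k (a b : 'I_N.+1) : (contraction Y ^+ k) a b =
  c ^+ k * \sum_(s : (wsize q k).-tuple 'I_N.+1 |
     (head 0%N (map val s) == a) && (last 0%N (map val s) == b))
       walk_weight Y k (map val s).
Proof.
elim: k a => [|k IH] a.
  rewrite !expr0 mul1r mxE /walk_weight /keys /=.
  under eq_bigr do rewrite big_nil.
  rewrite big_mkcond /=.
  rewrite (reindex (fun x : 'I_N.+1 => [tuple x])) /=; last first.
    exists (fun t : 1.-tuple 'I_N.+1 => thead t) => [x _|t _].
      by rewrite /thead (tnth_nth x).
    by rewrite [RHS](tuple_eta t); apply: val_inj => /=; case: t => -[|? []].
  rewrite (bigD1 a)//= eqxx /= big1 ?addr0; last first.
    by move=> i ia; rewrite (inj_eq val_inj) (negbTE ia).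
  by rewrite (inj_eq val_inj); case: eqP.
pose F (s : seq 'I_N.+1) : R := if (head 0%N (map val s) == a) && (last 0%N (map val s) == b)
  then walk_weight Y k.+1 (map val s) else 0.
rewrite big_mkcond /= -/(F _) (@big_tuple_cat R _ _ q.+1 (wsize q k) F); last first.
  by rewrite /wsize mulSn addnS.
rewrite (@big_tuple_cons R _ q (fun x => \sum_(y : (wsize q k).-tuple _) F (x ++ y))).
rewrite (bigD1 a)//= [X in _ + X]big1 ?addr0; last first.
  move=> i ia; apply: big1 => j _; apply: big1 => y _.
  by rewrite /F /= (inj_eq val_inj) (negbTE ia).
rewrite exprS -[_ * _]/(_ *m _) mxE exprS -mulrA mulr_sumr.
under eq_bigr do rewrite mxE -mulrA mulr_suml.
rewrite -[LHS]mulr_sumr; congr (_ * _); rewrite exchange_big /=.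
apply: eq_bigr => j _; under eq_bigr do rewrite IH mulrCA mulr_sumr.
rewrite -[LHS]mulr_sumr; congr (_ * _).
rewrite (exchange_big_dep xpredT)//=; apply: eq_bigr => y _.
have ly : last 0%N (map val (a :: j ++ y)) = last 0%N (map val y).
  by rewrite /= map_cat last_cat; case: (y) => -[].
rewrite /F ly /= eqxx /=.
pose u := thead (y : (k * q.+1).+1.-tuple 'I_N.+1).
have Ey : map val y = val u :: behead (map val y).
  by rewrite /u; case: (y) => -[//|z s' i] /=; rewrite (thead_tuple _) || rewrite /thead (tnth_nth ord0).
have [lb|lb] := boolP (last 0%N (map val y) == b); last first.
  by rewrite big1// => i /andP[].
rewrite (bigD1 u)/=; last by rewrite Ey eqxx.
rewrite big1 ?addr0; last first.
  by move=> i /andP[/andP[+ _] iu]; rewrite Ey /= (inj_eq val_inj) eq_sym (negbTE iu).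
rewrite /walk_weight.
have -> : keys q k.+1 (val a :: map val (j ++ y)) =
    key (map val [:: a, u & j]) :: keys q k (map val y).
  rewrite /keys /=; congr (_ :: map key (hedges _ _ _)); last first.
    by rewrite map_cat drop_size_cat// size_map size_tuple.
  apply/eqP; rewrite key_eq map_cat take_cat size_map size_tuple ltnNge leqnSn /= subSnn Ey /= take0.
  by rewrite perm_cons cats1 perm_rcons.
by rewrite big_cons.
Qed.

Lemma contraction_trace Y k : \tr (contraction Y ^+ k) =
  c ^+ k * \sum_(s : (wsize q k).-tuple 'I_N.+1 | closed_walk (map val s))
     walk_weight Y k (map val s).
Proof.
rewrite /mxtrace; under eq_bigr do rewrite contraction_pow.
rewrite -mulr_sumr; congr (_ * _).
rewrite (exchange_big_dep (fun s : (wsize q k).-tuple 'I_N.+1 => closed_walk (map val s)))/=; last first.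
  by move=> a s _ /andP[/eqP h /eqP l]; rewrite /closed_walk h l.
apply: eq_bigr => s cs.
pose u := thead (s : (k * q.+1).+1.-tuple 'I_N.+1).
have Es : map val s = val u :: behead (map val s).
  by rewrite /u; case: (s) => -[//|z s' i] /=; rewrite (thead_tuple _) || rewrite /thead (tnth_nth ord0).
rewrite (bigD1 u)/=; last by move: cs; rewrite /closed_walk => /eqP <-; rewrite Es eqxx.
rewrite big1 ?addr0// => i /andP[/andP[+ _] iu].
by rewrite Es /= (inj_eq val_inj) eq_sym (negbTE iu).
Qed.

End contraction_trace.

(** * Finite atomic models and bounds on the limiting moments *)

Section finite_product.
Context {R : realType} (I J : finType) (pr : J -> R).
Hypothesis pr_ge0 : forall j, 0 <= pr j.
Hypothesis pr1 : \sum_j pr j = 1.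

Definition mean (F : {ffun I -> J} -> R) := \sum_(w : {ffun I -> J}) (\prod_i pr (w i)) * F w.

Lemma mean_prod (ks : seq I) (g : I -> J -> R) : uniq ks ->
  mean (fun w => \prod_(i <- ks) g i (w i)) = \prod_(i <- ks) \sum_j pr j * g i j.
Proof.
move=> uks; pose g' i j := if i \in ks then g i j else 1.
have E (h : I -> R) : \prod_(i <- ks) h i = \prod_i (if i \in ks then h i else 1).
  by rewrite -big_mkcond /= big_uniq.
rewrite E.
transitivity (\prod_i \sum_j pr j * g' i j); last first.
  apply: eq_bigr => i _; rewrite /g'; case: ifP => // _.
  by under eq_bigr do rewrite mulr1.
rewrite bigA_distr_bigA /=; apply: eq_bigr => w _.
by rewrite E -big_split.
Qed.

Lemma mean_single i (g : J -> R) : mean (fun w => g (w i)) = \sum_j pr j * g j.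
Proof.
have := @mean_prod [:: i] (fun=> g) isT; rewrite big_seq1 => <-.
by apply: eq_bigr => w _; rewrite big_seq1.
Qed.

Lemma mean_pair i i' (g : J -> R) : i != i' ->
  mean (fun w => g (w i) * g (w i')) = (\sum_j pr j * g j) ^+ 2.
Proof.
move=> ii'; have := @mean_prod [:: i; i'] (fun=> g); rewrite /= inE ii' => /(_ isT).
rewrite big_cons big_seq1 -expr2 => <-.
by apply: eq_bigr => w _; rewrite big_cons big_seq1.
Qed.

Lemma mean_cst c : mean (fun=> c) = c.
Proof.
have := @mean_prod [::] (fun _ _ => 1) isT; rewrite !big_nil /mean => H.
rewrite -mulr_suml -[RHS]mul1r; congr (_ * _); rewrite -[RHS]H.
by apply: eq_bigr => w _; rewrite mulr1.
Qed.

Lemma mean_le F G : (forall w, F w <= G w) -> mean F <= mean G.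
Proof. by move=> FG; apply: ler_sum => w _; rewrite ler_wpM2l// prodr_ge0. Qed.

Lemma meanD F G : mean (fun w => F w + G w) = mean F + mean G.
Proof. by rewrite /mean -big_split; apply: eq_bigr => w _; rewrite mulrDr. Qed.

Lemma meanZ c F : mean (fun w => c * F w) = c * mean F.
Proof. by rewrite /mean mulr_sumr; apply: eq_bigr => w _; rewrite mulrCA. Qed.

Lemma mean_sum (L : Type) (r : seq L) (A : pred L) (F : L -> {ffun I -> J} -> R) :
  mean (fun w => \sum_(l <- r | A l) F l w) = \sum_(l <- r | A l) mean (F l).
Proof.
by rewrite /mean exchange_big; apply: eq_bigr => w _; rewrite mulr_sumr.
Qed.

End finite_product.

Section proper_keys.
Variables q N : nat.

Definition proper_key (e : seq nat) := (size e == q.+2) && all (fun x => x < N.+1)%N e.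

Lemma proper_keys k (s : (wsize q k).-tuple 'I_N.+1) : {in keys q k (map val s), forall e, proper_key e}.
Proof.
move=> e eks; apply/andP; split; last first.
  by apply/allP => x /(mem_keys eks) /mapP[y _ ->]; exact: ltn_ord.
move: eks => /mapP[f fh ->]; rewrite size_sort.
have : size (map val s) = wsize q k by rewrite size_map size_tuple.
move: (map val s) fh; elim: k {s} => //= k IH s; rewrite in_cons => /predU1P[->|fh] ss.
  by rewrite size_takel ?eqxx// ss /wsize mulSn; lia.
by apply: (IH _ fh); rewrite size_drop ss /wsize mulSn; lia.
Qed.

Lemma proper_pair (a b : 'I_N.+1) (j : q.-tuple 'I_N.+1) :
  proper_key (key (map val [:: a, b & j])).
Proof.
rewrite /proper_key size_sort /= size_map size_tuple eqxx.
apply/allP => x; rewrite mem_key => /(@mapP _ _ val [:: a, b & j])[y _ ->]; exact: ltn_ord.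
Qed.

End proper_keys.

Section atomic_array.
Context {R : realType} (q : nat) (J : finType) (lam wt : J -> R) (N : nat).
Hypothesis lam_ge0 : forall j, 0 <= lam j.
Let n : R := N.+1%:R ^+ q.+1.
Hypothesis lam_le : \sum_j lam j <= n.
Let I := (q.+2.-tuple 'I_N.+1)%type.

Let n0 : 0 < n. Proof. by rewrite exprn_gt0. Qed.

(* Each entry equals wt j with probability lam j / n and 0 otherwise: a finite
   model in which positivity of the limiting moments is visible. *)
Definition atom_prob (j : option J) : R :=
  if j is Some j' then lam j' / n else 1 - (\sum_j' lam j') / n.
Definition atom_val (j : option J) : R := if j is Some j' then wt j' else 0.

Lemma sum_option (F : option J -> R) : \sum_j F j = F None + \sum_j F (Some j).
Proof.
rewrite (bigD1 None)//=; congr (_ + _); rewrite (reindex_omap Some id)//=.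
  by apply: eq_bigl => j; rewrite eqxx.
by case.
Qed.

Lemma atom_prob_ge0 j : 0 <= atom_prob j.
Proof.
case: j => [j|] /=; first by rewrite divr_ge0// ltW.
by rewrite subr_ge0 ler_pdivrMr// mul1r.
Qed.

Lemma atom_prob1 : \sum_j atom_prob j = 1.
Proof. by rewrite sum_option /= -mulr_suml subrK. Qed.

Local Notation E := (mean (I := I) atom_prob).

(** A finite index for keys. On proper keys [inord] is faithful and the map is injective; elsewhere
    the value is a convention. *)
Definition to_tuple (e : seq nat) : I := [tuple inord (nth 0%N e i) | i < q.+2].
Definition atom_array (w : {ffun I -> option J}) (e : seq nat) := atom_val (w (to_tuple e)).

Lemma to_tupleK e : proper_key q N e -> map val (to_tuple e) = e.
Proof.
move=> /andP[/eqP se ae]; apply: (@eq_from_nth _ 0%N).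
  by rewrite size_map size_tuple se.
move=> k; rewrite size_map size_tuple => kq.
rewrite (nth_map ord0) ?size_tuple// -[k]/(nat_of_ord (Ordinal kq)) -tnth_nth tnth_mktuple /=.
by rewrite inordK//; apply: (allP ae); rewrite mem_nth// se.
Qed.

Definition atom_tau m : R := \sum_j atom_prob j * atom_val j ^+ m.

Lemma atom_tauE m : (0 < m)%N -> n * atom_tau m = \sum_j lam j * wt j ^+ m.
Proof.
move=> m0; rewrite /atom_tau sum_option /= expr0n (gtn_eqF m0) mulr0 add0r mulr_sumr.
by apply: eq_bigr => j _; rewrite mulrA mulrCA mulfV ?mulr1// gt_eqF.
Qed.

Lemma mean_walk_weight k (s : (wsize q k).-tuple 'I_N.+1) :
  E (fun w => walk_weight q (atom_array w) k (map val s)) =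
  blockprod atom_tau (keys q k (map val s)).
Proof.
set ks := keys q k (map val s).
have pk e : e \in undup ks -> proper_key q N e by rewrite mem_undup; exact: proper_keys.
have inj : {in undup ks &, injective to_tuple}.
  by move=> e f /pk pe /pk pf ef; rewrite -(to_tupleK pe) ef to_tupleK.
pose g (i : I) (j : option J) := atom_val j ^+ count_mem (map val i) ks.
transitivity (E (fun w => \prod_(i <- map to_tuple (undup ks)) g i (w i))).
  apply: eq_bigr => w _; congr (_ * _); rewrite /walk_weight prod_undup_count big_map.
  rewrite big_seq [RHS]big_seq; apply: eq_bigr => e /pk pe.
  by rewrite /g to_tupleK.
rewrite mean_prod; [|exact: atom_prob1|by rewrite map_inj_in_uniq// undup_uniq].
rewrite big_map /blockprod -/ks [LHS]big_seq [RHS]big_seq; apply: eq_bigr => e /pk pe.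
by rewrite /g to_tupleK.
Qed.

Lemma mean_trace c Q :
  E (fun w => \sum_(l <- eigenvalues (contraction q N c (atom_array w))) Q.[l]) =
  Lin (fun k => c ^+ k * walk_sum q N.+1 k atom_tau) Q.
Proof.
transitivity (E (fun w => \sum_(i < size Q) Q`_i * (c ^+ i *
    \sum_(s : (wsize q i).-tuple 'I_N.+1 | closed_walk (map val s))
      walk_weight q (atom_array w) i (map val s)))).
  apply: eq_bigr => w _; rewrite sum_eigenvalues_horner ?contraction_sym//.
  by congr (_ * _); apply: eq_bigr => i _; rewrite contraction_trace.
rewrite mean_sum; apply: eq_bigr => i _; rewrite !meanZ mean_sum; congr (_ * (_ * _)).
by apply: eq_bigr => s _; rewrite mean_walk_weight.
Qed.

(** By [mean_trace] the left side is a mean of sums of values of Q at real eigenvalues. *)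
Lemma atom_Lin_le0 c Q : (forall y, Q.[y] <= 0) ->
  Lin (fun k => c ^+ k * walk_sum q N.+1 k atom_tau) Q <= 0.
Proof.
move=> Q0; rewrite -mean_trace -[leRHS](@mean_cst _ I _ _ atom_prob1 0).
apply: mean_le; first exact: atom_prob_ge0.
by move=> w; apply: sumr_le0 => l _.
Qed.

Section bound.
Variables (s eps : R).
Hypothesis s02 : 0 < s < 2.
Hypothesis eps0 : 0 < eps.
Let S := \sum_j lam j * `|wt j| `^ s.
Let D := \sum_j lam j * `|wt j|.

(** Entries are split at the level eps: large ones are counted through S, their absolute moment of
    order s, small ones are summed in mean square. D enters only through products of means. *)
Let small (x : R) : R := if `|x| <= eps then x else 0.
Let big (x : R) : R := if `|x| <= eps then 0 else 1.

Lemma big_le x : big x <= `|x| `^ s * eps `^ (- s).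
Proof.
have /andP[s0 s2] := s02.
rewrite /big; case: (leP `|x| eps) => [_|xe]; first by rewrite mulr_ge0// powR_ge0.
rewrite powRN ler_pdivlMr ?powR_gt0// mul1r ge0_ler_powR ?nnegrE ?(ltW s0)// ltW//.
Qed.

Lemma small_le x : small x ^+ 2 <= `|x| `^ s * eps `^ (2 - s).
Proof.
have /andP[s0 s2] := s02.
rewrite /small; case: (leP `|x| eps) => [xe|_]; last by rewrite expr0n mulr_ge0// powR_ge0.
have [->|x0] := eqVneq x 0; first by rewrite expr0n mulr_ge0// powR_ge0.
have ax : 0 < `|x| by rewrite normr_gt0.
rewrite -real_normK ?num_real// -powR_mulrn ?normr_ge0//.
rewrite -[X in _ `^ X](subrK s) addrC powRD; last by rewrite (gt_eqF ax) implybT.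
by rewrite ler_wpM2l ?powR_ge0// ge0_ler_powR ?nnegrE ?(ltW eps0)// subr_ge0 ltW.
Qed.

Lemma mean_big e : E (fun w => big (atom_array w e)) <= n^-1 * (S * eps `^ (- s)).
Proof.
rewrite (mean_single atom_prob1 (to_tuple e) (fun j => big (atom_val j))) sum_option /=.
rewrite {1}/big normr0 (ltW eps0) mulr0 add0r mulr_suml mulr_sumr; apply: ler_sum => j _.
by rewrite -!mulrA mulrCA ler_wpM2l ?invr_ge0 ?(ltW n0)// ler_wpM2l// big_le.
Qed.

(** Entries at distinct keys are independent, and the product of their means is of order n^-2; for
    equal keys [small_le] applies. *)
Lemma mean_small e f : proper_key q N e -> proper_key q N f ->
  E (fun w => small (atom_array w e) * small (atom_array w f)) <=
  (e == f)%:R * (n^-1 * (S * eps `^ (2 - s))) + (n^-1 * D) ^+ 2.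
Proof.
move=> pe pf; have [<-|ef] := eqVneq e f; last first.
  rewrite (mean_pair atom_prob1 (fun j => small (atom_val j))); last first.
    by apply: contra_neq ef => H; rewrite -(to_tupleK pe) H to_tupleK.
  rewrite mul0r add0r -[leLHS]real_normK ?num_real// ler_sqr ?nnegrE ?normr_ge0//; last first.
    by rewrite mulr_ge0 ?invr_ge0 ?(ltW n0)// sumr_ge0// => j _; rewrite mulr_ge0.
  rewrite sum_option /= {1}/small normr0 (ltW eps0) mulr0 add0r mulr_sumr.
  apply: le_trans (ler_norm_sum _ _ _) _; apply: ler_sum => j _.
  rewrite normrM ger0_norm ?divr_ge0 ?(ltW n0)// [lam j / n]mulrC -mulrA.
  rewrite ler_wpM2l ?invr_ge0 ?(ltW n0)// ler_wpM2l// /small.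
  by case: ifP; rewrite ?normr0.
rewrite mul1r -[leLHS]addr0 lerD// ?sqr_ge0//.
rewrite (_ : E _ = E (fun w => (fun j => small (atom_val j) ^+ 2) (w (to_tuple e)))); last first.
  by apply: eq_bigr => w _; rewrite expr2.
rewrite (mean_single atom_prob1 (to_tuple e) (fun j => small (atom_val j) ^+ 2)) sum_option /=.
rewrite {1}/small normr0 (ltW eps0) expr0n mulr0 add0r mulr_suml mulr_sumr; apply: ler_sum => j _.
by rewrite -!mulrA mulrCA ler_wpM2l ?invr_ge0 ?(ltW n0)// ler_wpM2l// small_le.
Qed.

(** If row a has an entry above eps, the count of large entries pays for the bound 1. Otherwise
    dropping large entries leaves the row unchanged, and its sum of squares expands over pairs j,
    j'. *)
Lemma diag_sqr_le c m Y (a : 'I_N.+1) : 0 < m ->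
  Num.min 1 ((contraction q N c Y ^+ 2) a a / m) <=
  \sum_(b : 'I_N.+1) \sum_(j : q.-tuple 'I_N.+1) big (Y (key (map val [:: a, b & j]))) +
  c ^+ 2 / m * \sum_(b : 'I_N.+1) \sum_(j : q.-tuple 'I_N.+1) \sum_(j' : q.-tuple 'I_N.+1)
    (small (Y (key (map val [:: a, b & j]))) * small (Y (key (map val [:: a, b & j'])))).
Proof.
move=> m0.
have sq (Z : seq nat -> R) : (contraction q N c Z ^+ 2) a a = \sum_b contraction q N c Z a b ^+ 2.
  rewrite (expr2 (contraction q N c Z)) -mulmxE mxE; apply: eq_bigr => b _.
  have -> : contraction q N c Z b a = contraction q N c Z a b.
    by rewrite -[in LHS]contraction_sym mxE.
  by rewrite -expr2.
have sqE (Z : seq nat -> R) : c ^+ 2 / m * \sum_(b : 'I_N.+1) \sum_(j : q.-tuple 'I_N.+1) \sum_(j' : q.-tuple 'I_N.+1)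
    (Z (key (map val [:: a, b & j])) * Z (key (map val [:: a, b & j']))) =
    (contraction q N c Z ^+ 2) a a / m.
  rewrite sq mulrAC; congr (_ / m).
  rewrite mulr_sumr; apply: eq_bigr => b _.
  rewrite mxE exprMn; congr (_ * _); rewrite expr2.
  by rewrite mulr_suml; apply: eq_bigr => j _; rewrite mulr_sumr.
have big0 x : 0 <= big x by rewrite /big; case: ifP.
have [/existsP[b /existsP[j H]]|H] := boolP [exists b : 'I_N.+1, [exists j : q.-tuple 'I_N.+1,
   eps < `|Y (key (map val [:: a, b & j]))|]].
  apply: (@le_trans _ _ 1); first by rewrite ge_min lexx.
  rewrite ler_wpDr//.
    rewrite (sqE (small \o Y)) divr_ge0 ?(ltW m0)//.
    by rewrite sq; apply: sumr_ge0 => b' _; rewrite sqr_ge0.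
  rewrite (bigD1 b)//= (bigD1 j)//= -addrA {1}/big ifF; last by rewrite leNgt H.
  rewrite lerDl.
  rewrite addr_ge0//; apply: sumr_ge0 => i _ //.
  by apply: sumr_ge0 => i' _.
rewrite ler_wpDl//; first by do 2 (apply: sumr_ge0 => ? _).
rewrite (sqE (small \o Y)) ge_min; apply/orP; right.
rewrite le_eqVlt; apply/orP; left; apply/eqP; congr (_ / m).
rewrite !sq; apply: eq_bigr => b _; rewrite !mxE; congr ((_ * _) ^+ 2).
apply: eq_bigr => j _ /=; rewrite /small ifT// leNgt.
by move: H; rewrite negb_exists => /forallP/(_ b); rewrite negb_exists => /forallP/(_ j).
Qed.

Lemma card_same_pair (a b : 'I_N.+1) (j : q.-tuple 'I_N.+1) :
  \sum_(j' : q.-tuple 'I_N.+1) (key (map val [:: a, b & j]) == key (map val [:: a, b & j']))%:R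
  <= q.+2`!%:R :> R.
Proof.
rewrite -natr_sum ler_nat -big_mkcond /= sum1dep_card.
set A := [set _ | _]%SET; pose h (j' : q.-tuple 'I_N.+1) : q.+1.-tuple 'I_N.+1 := [tuple of b :: j'].
have hinj : injective h by move=> x y /(congr1 val) [] H; exact: val_inj.
rewrite -(card_imset A hinj).
apply: (@leq_trans q.+1`!); last by rewrite [leqRHS]factS leq_pmull.
apply: (leq_trans _ (card_same_key q a (key (map val [:: a, b & j])))).
apply/subset_leq_card/fintype.subsetP => x /imsetP[j' + ->]; rewrite !inE => /eqP ->.
by rewrite key_eq perm_rcons.
Qed.

(** Each row has n pairs (b, j). For each of them at most (q + 2)! indices j' share the key, and the
    product of means over all N^q indices j' adds up to N^q D^2 / n^2; summation leaves the term D^2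
    / N, with N for the dimension. *)
Lemma atom_Lin_bound c m Q : 0 < m -> (forall y, Q.[y] <= Num.min 1 (y ^+ 2 / m)) ->
  Lin (fun k => c ^+ k * walk_sum q N.+1 k atom_tau) Q / N.+1%:R <=
  S * (eps `^ (- s) + c ^+ 2 * q.+2`!%:R / m * eps `^ (2 - s)) + c ^+ 2 / m * D ^+ 2 / N.+1%:R.
Proof.
move=> m0 Qm; rewrite ler_pdivrMr// -mean_trace.
pose C w := contraction q N c (atom_array w).
pose K (a b : 'I_N.+1) (j : q.-tuple 'I_N.+1) := key (map val [:: a, b & j]).
apply: (@le_trans _ _ (E (fun w => \sum_a (
  \sum_(b : 'I_N.+1) \sum_(j : q.-tuple 'I_N.+1) big (atom_array w (K a b j)) +
  c ^+ 2 / m * \sum_(b : 'I_N.+1) \sum_(j : q.-tuple 'I_N.+1) \sum_(j' : q.-tuple 'I_N.+1)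
    (small (atom_array w (K a b j)) * small (atom_array w (K a b j'))))))).
  apply: mean_le; first exact: atom_prob_ge0.
  move=> w; apply: (@le_trans _ _ (\sum_(l <- eigenvalues (C w)) Num.min 1 (l ^+ 2 / m))).
    by apply: ler_sum => l _.
  apply: le_trans (eigenvalues_sum_le m0 (contraction_sym _ _ _ _)) _.
  by apply: ler_sum => a _; exact: diag_sqr_le.
rewrite mean_sum.
have cq : c ^+ 2 / m >= 0 by rewrite divr_ge0 ?sqr_ge0 ?ltW.
have S0 : 0 <= S by apply: sumr_ge0 => j _; rewrite mulr_ge0// powR_ge0.
apply: (@le_trans _ _ (\sum_(a : 'I_N.+1) (\sum_(b : 'I_N.+1) \sum_(j : q.-tuple 'I_N.+1)
    (n^-1 * (S * eps `^ (- s)) + c ^+ 2 / m * (q.+2`!%:R * (n^-1 * (S * eps `^ (2 - s))) +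
      N.+1%:R ^+ q * (n^-1 * D) ^+ 2))))).
  apply: ler_sum => a _; rewrite meanD meanZ !mean_sum mulr_sumr -big_split /=.
  apply: ler_sum => b _; rewrite !mean_sum mulr_sumr -big_split /=.
  apply: ler_sum => j _; rewrite lerD ?mean_big// ler_wpM2l// mean_sum.
  apply: (@le_trans _ _ (\sum_(j' : q.-tuple 'I_N.+1)
     ((K a b j == K a b j')%:R * (n^-1 * (S * eps `^ (2 - s))) + (n^-1 * D) ^+ 2))).
    by apply: ler_sum => j' _; rewrite mean_small// proper_pair.
  rewrite big_split /= sumr_const card_tuple card_ord -mulr_suml lerD//; last first.
    by rewrite -[_ *+ (_ ^ _)]mulr_natl natrX.
  rewrite ler_wpM2r// ?card_same_pair// mulr_ge0 ?invr_ge0 ?(ltW n0)//.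
  by rewrite mulr_ge0// powR_ge0.
rewrite !sumr_const card_tuple card_ord.
set X := (X in X *+ _ *+ _ *+ _).
rewrite -[X *+ _]mulr_natl -[_ *+ N.+1]mulr_natl -[(_ * _) *+ N.+1]mulr_natl natrX.
rewrite le_eqVlt; apply/orP; left; apply/eqP; rewrite /X /n exprS.
have x0 : N.+1%:R != 0 :> R by rewrite pnatr_eq0.
have y0 : N.+1%:R ^+ q != 0 :> R by rewrite expf_neq0.
move: y0; move: (N.+1%:R ^+ q : R) => y y0; move: x0; move: (N.+1%:R : R) => x x0.
have m1 : m != 0 by rewrite gt_eqF.
by field; rewrite x0 y0 m1.
Qed.

End bound.
End atomic_array.

Section spectral_bounds.
Context {R : realType} (q : nat) (s : R).
Hypothesis s02 : 0 < s < 2.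

(** Both clauses involve finitely many moments at a time, so they pass to limits of moment
    sequences; this carries them from atoms to the stable moments. The first yields existence of the
    limit law, the second its collapse at 0 for large B. *)
Definition spectral_bounds (M : nat -> R) (S : R) := forall (c : R) (Q : {poly R}),
  ((forall y, Q.[y] <= 0) -> Lin (fun k => c ^+ k * tree_moment q M k) Q <= 0) /\
  (forall m eps, 0 < m -> 0 < eps -> (forall y, Q.[y] <= Num.min 1 (y ^+ 2 / m)) ->
     Lin (fun k => c ^+ k * tree_moment q M k) Q <=
     S * (eps `^ (- s) + c ^+ 2 * q.+2`!%:R / m * eps `^ (2 - s))).

Lemma spectral_bounds_lim (Mi : nat -> nat -> R) M (Si : nat -> R) S :
  (forall m, (0 < m)%N -> Mi i m @[i --> \oo] --> M m) -> Si i @[i --> \oo] --> S ->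
  (forall i, spectral_bounds (Mi i) (Si i)) -> spectral_bounds M S.
Proof.
move=> MiM SiS B c Q.
have L : Lin (fun k => c ^+ k * tree_moment q (Mi i) k) Q @[i --> \oo] -->
    Lin (fun k => c ^+ k * tree_moment q M k) Q.
  apply: cvg_Lin => k; apply: cvgM; first exact: cvg_cst.
  exact: cvg_tree_moment.
split=> [Q0|m eps m0 e0 Qm].
  by apply: (cvgr_to_le L); apply: nearW => i; apply: (B i c Q).1.
set b := _ + _.
have LS : Si i * b @[i --> \oo] --> S * b by apply: cvgM => //; exact: cvg_cst.
by apply: (ler_cvg_to L LS); apply: nearW => i; apply: (B i c Q).2.
Qed.

Lemma spectral_bounds_atoms (J : finType) (lam wt : J -> R) : (forall j, 0 <= lam j) ->
  spectral_bounds (fun m => \sum_j lam j * wt j ^+ m) (\sum_j lam j * `|wt j| `^ s).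
Proof.
move=> lam0 c Q; pose M m := \sum_j lam j * wt j ^+ m; rewrite -/M.
have nl : \forall N \near \oo, \sum_j lam j <= N.+1%:R ^+ q.+1.
  near=> N; apply: (@le_trans _ _ N.+1%:R).
    rewrite -natr1; apply: ltW; rewrite ltr_wpDr//; near: N; exact: nbhs_infty_gtr.
  by rewrite exprS ler_peMr// exprn_ege1// ler1n.
have L : Lin (fun k => c ^+ k * walk_sum q N.+1 k (atom_tau q lam wt N)) Q / N.+1%:R
    @[N --> \oo] --> Lin (fun k => c ^+ k * tree_moment q M k) Q.
  have : Lin (fun k => c ^+ k * (walk_sum q N.+1 k (atom_tau q lam wt N) / N.+1%:R)) Q
    @[N --> \oo] --> Lin (fun k => c ^+ k * tree_moment q M k) Q.
    apply: cvg_Lin => k; apply: cvgM; first exact: cvg_cst.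
    apply: cvg_walk_sum => m m0; under eq_fun do rewrite atom_tauE//.
    exact: cvg_cst.
  apply: cvg_trans; apply: near_eq_cvg; apply: nearW => N /=.
  by rewrite /Lin mulr_suml; apply: eq_bigr => i _; rewrite !mulrA.
split=> [Q0|m eps m0 e0 Qm].
  apply: (cvgr_to_le L); near=> N; rewrite ler_pdivrMr// mul0r; apply: atom_Lin_le0 => //.
  by near: N.
set b := _ * (_ + _).
have LS : b + c ^+ 2 / m * (\sum_j lam j * `|wt j|) ^+ 2 / N.+1%:R @[N --> \oo] --> b + c ^+ 2 / m * (\sum_j lam j * `|wt j|) ^+ 2 * 0.
  apply: cvgD; first exact: cvg_cst.
  by apply: cvgM; [exact: cvg_cst|exact: cvg_harmonic].
rewrite mulr0 addr0 in LS; apply: (ler_cvg_to L LS); near=> N; apply: atom_Lin_bound => //.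
by near: N.
Unshelve. all: by end_near. Qed.

End spectral_bounds.

(** * Geometric discretisation of the truncated stable measure *)

Section geometric_ratio.
Context {R : realType}.
Implicit Types (a b h : R).

(** The sum over j of (e^(a h) - 1) e^(-b h j), which arises from cells whose ends decrease by the
    factor e^(-h); it discretises a / b. *)
Definition geom_ratio a b h := (expR (a * h) - 1) / (1 - expR (- (b * h))).

Lemma geom_ratio_bounds a b h : 0 < a -> 0 < b -> 0 < h -> a * h < 1 ->
  a / b <= geom_ratio a b h <= a / b * ((1 + b * h) / (1 - a * h)).
Proof.
move=> a0 b0 h0 ah1; have ah0 : 0 < a * h by rewrite mulr_gt0.
have bh0 : 0 < b * h by rewrite mulr_gt0.
have bh1 : 0 < 1 + b * h by rewrite addr_gt0.
have ah2 : 0 < 1 - a * h by rewrite subr_gt0.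
have e1 : 1 + a * h <= expR (a * h) by exact: expR_ge1Dx.
have e2 : expR (a * h) <= (1 - a * h)^-1.
  by rewrite -[leLHS]invrK lef_pV2 ?posrE ?invr_gt0 ?expR_gt0// -expRN expR_ge1Dx.
have e3 : 1 - b * h <= expR (- (b * h)) by exact: expR_ge1Dx.
have e4 : expR (- (b * h)) <= (1 + b * h)^-1.
  by rewrite expRN lef_pV2 ?posrE ?expR_gt0// expR_ge1Dx.
have d0 : 0 < 1 - expR (- (b * h)) by rewrite subr_gt0 expR_lt1 oppr_lt0.
rewrite /geom_ratio; apply/andP; split.
  rewrite ler_pdivlMr// mulrAC ler_pdivrMr//.
  apply: (@le_trans _ _ (a * (b * h))); first by rewrite ler_wpM2l ?(ltW a0)//; lra.
  by rewrite [leLHS]mulrCA [leRHS]mulrC ler_wpM2l ?(ltW b0)//; lra.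
rewrite ler_pdivrMr//.
have x1 : a * h / (1 - a * h) = (1 - a * h)^-1 - 1 by field; rewrite gt_eqF.
have x2 : b * h / (1 + b * h) = 1 - (1 + b * h)^-1 by field; rewrite gt_eqF.
apply: (@le_trans _ _ (a * h / (1 - a * h))); first by rewrite x1 lerB.
apply: (@le_trans _ _ (a / b * ((1 + b * h) / (1 - a * h)) * (b * h / (1 + b * h)))).
  rewrite le_eqVlt; apply/orP; left; apply/eqP; field.
  by rewrite !gt_eqF.
rewrite x2 ler_wpM2l//; last by rewrite lerD2l lerN2.
by rewrite !mulr_ge0 ?invr_ge0 ?(ltW a0) ?(ltW b0) ?(ltW bh1) ?(ltW ah2).
Qed.

Lemma cvg_geom_ratio a b : 0 < a -> 0 < b ->
  geom_ratio a b i.+1%:R^-1 @[i --> \oo] --> a / b.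
Proof.
move=> a0 b0.
have L c : 1 + c * i.+1%:R^-1 @[i --> \oo] --> (1 : R).
  rewrite -[X in _ --> X]addr0 -(mulr0 c); apply: cvgD; first exact: cvg_cst.
  by apply: cvgM; [exact: cvg_cst|exact: cvg_harmonic].
have L2 : a / b * ((1 + b * i.+1%:R^-1) / (1 + (- a) * i.+1%:R^-1)) @[i --> \oo] --> a / b.
  rewrite -[X in _ --> X]mulr1; apply: cvgM; first exact: cvg_cst.
  rewrite -[X in _ --> X](@divr1 R 1); apply: cvgM; first exact: L.
  by apply: cvgV; [exact: oner_neq0|exact: L].
apply: (squeeze_cvgr _ (cvg_cst (a / b)) L2); near=> i.
rewrite mulNr; apply: geom_ratio_bounds => //.
rewrite ltr_pdivrMr// mul1r -natr1 ltr_wpDr//; near: i; exact: nbhs_infty_gtr.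
Unshelve. all: by end_near. Qed.

End geometric_ratio.

Section stable_moments.
Context {R : realType} (alpha : R).
Hypothesis alpha02 : 0 < alpha < 2.

(** The m-th moment of the Levy measure alpha |x|^(-alpha - 1) dx on 0 < |x| <= B, weighted by theta
    on the right and 1 - theta on the left. At order 1 the integral need not converge, and centring
    puts 0 in its place. *)
Definition stable_moment (theta B : R) (m : nat) : R :=
  if m == 1%N then 0
  else alpha / (m%:R - alpha) * B `^ (m%:R - alpha) * (theta + (-1) ^+ m * (1 - theta)).

(** alpha < s makes the absolute moment of order s finite near 0, s < 2 serves the spectral bounds,
    and s > 1 makes the compensating atom vanish. *)
Let s := (alpha + 2) / 2.

Lemma stable_exponent : [/\ 0 < s < 2, 1 < s & alpha < s].
Proof. by move: alpha02; rewrite /s => /andP[a0 a2]; split; [apply/andP; split|..]; lra. Qed.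

Section atoms.
Variables (theta B h : R).
Hypotheses (theta01 : 0 <= theta <= 1) (B0 : 0 < B) (h0 : 0 < h).

(* Geometric cells of the measure alpha |x|^(-alpha-1) dx on 0 < |x| <= B, with
   weights theta and 1 - theta on the two half-lines. *)
Definition slice_rate (K : nat) (x : bool * 'I_K) : R :=
  (if x.1 then theta else 1 - theta) *
  (B `^ (- alpha) * (expR (alpha * h) - 1) * expR (alpha * h) ^+ x.2).
Definition slice_point (K : nat) (x : bool * 'I_K) : R :=
  (if x.1 then 1 else -1) * (B * expR (- h) ^+ x.2).

Lemma slice_rate_ge0 K (x : bool * 'I_K) : 0 <= slice_rate x.
Proof.
have /andP[a0 _] := alpha02; have /andP[t0 t1] := theta01.
rewrite /slice_rate mulr_ge0//; first by case: ifP; rewrite ?subr_ge0.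
rewrite !mulr_ge0 ?powR_ge0 ?exprn_ge0 ?expR_ge0//.
by rewrite subr_ge0 ltW// expR_gt1 mulr_gt0.
Qed.

(** The atom [None] has rate 2^i and sits at -2^-i times the first moment rho of the slices. The
    total first moment is 0, and the atom contributes order 2^(i (1 - m)) to the m-th moment and
    2^(i (1 - s)) to the absolute moment of order s. *)
Definition compensated (K i : nat) (x : option (bool * 'I_K)) : R * R :=
  if x is Some y then (slice_rate y, slice_point y)
  else (2 ^+ i, - (2^-1 ^+ i * \sum_(y : bool * 'I_K) slice_rate y * slice_point y)).

Definition slice_moment K m : R :=
  if m == 1%N then 0 else \sum_(x : bool * 'I_K) slice_rate x * slice_point x ^+ m.

Lemma slice_bounds q K : spectral_bounds q s (slice_moment K)
  (\sum_(x : bool * 'I_K) slice_rate x * `|slice_point x| `^ s).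
Proof.
have [s02 s1 _] := stable_exponent.
set rho := \sum_(y : bool * 'I_K) slice_rate y * slice_point y.
pose lam i (x : option (bool * 'I_K)) := (compensated i x).1.
pose wt i (x : option (bool * 'I_K)) := (compensated i x).2.
apply: (@spectral_bounds_lim R q s (fun i m => \sum_x lam i x * wt i x ^+ m) _
  (fun i => \sum_x lam i x * `|wt i x| `^ s)).
- move=> m m0; under eq_fun do rewrite sum_option /=.
  have [->|m1] := eqVneq m 1%N; rewrite /slice_moment ?(negbTE m1) ?eqxx.
    under eq_fun => i.
      rewrite (_ : _ + _ = 0); first over.
      rewrite /lam /wt /= expr1 mulrN mulrA -exprMn mulfV// expr1n mul1r.
      by rewrite -[X in - _ + X]/rho addNr.
    exact: cvg_cst.
  pose A := \sum_(x : bool * 'I_K) slice_rate x * slice_point x ^+ m.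
  suff L : lam i None * wt i None ^+ m @[i --> \oo] --> (0 : R).
    have : lam i None * wt i None ^+ m + A @[i --> \oo] --> 0 + A.
      by apply: cvgD => //; exact: cvg_cst.
    by rewrite add0r.
  have E i : lam i None * wt i None ^+ m = (2^-1 ^+ m.-1) ^+ i * (- rho) ^+ m.
    rewrite /lam /wt /= -mulrN exprMn mulrA; congr (_ * _).
    rewrite -[in LHS](prednK m0) -!exprM [(m.-1 * i)%N]mulnC mulnS exprD mulrA.
    by rewrite -exprMn mulfV// expr1n mul1r.
  suff L : (2^-1 ^+ m.-1) ^+ i * (- rho) ^+ m @[i --> \oo] --> 0 * (- rho) ^+ m.
    rewrite mul0r in L; apply: cvg_trans L; apply: near_eq_cvg.
    by apply: nearW => i /=; rewrite E.
  apply: cvgM; last exact: cvg_cst.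
  apply: cvg_expr; rewrite ger0_norm ?exprn_ge0 ?invr_ge0// exprn_ilt1 ?invr_ge0//.
    by clear -m0 m1; case: m m0 m1 => [|[|m]].
  by rewrite invf_lt1// ltr1n.
- under eq_fun do rewrite sum_option /=.
  pose A := \sum_(x : bool * 'I_K) slice_rate x * `|slice_point x| `^ s.
  suff L : lam i None * `|wt i None| `^ s @[i --> \oo] --> (0 : R).
    have : lam i None * `|wt i None| `^ s + A @[i --> \oo] --> 0 + A.
      by apply: cvgD => //; exact: cvg_cst.
    by rewrite add0r.
  have E i : lam i None * `|wt i None| `^ s = (2 `^ (1 - s)) ^+ i * `|rho| `^ s.
    rewrite /lam /wt /= normrN normrM powRM// mulrA; congr (_ * _).
    rewrite ger0_norm ?exprn_ge0 ?invr_ge0// exprVn -!powR_mulrn ?powR_ge0 ?invr_ge0//.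
    rewrite -powRN -!powRrM -powRD; last by rewrite (gt_eqF (ltr0n R 2)) implybT.
    by congr (_ `^ _); ring.
  suff L : (2 `^ (1 - s)) ^+ i * `|rho| `^ s @[i --> \oo] --> 0 * `|rho| `^ s.
    rewrite mul0r in L; apply: cvg_trans L; apply: near_eq_cvg.
    by apply: nearW => i /=; rewrite E.
  apply: cvgM; last exact: cvg_cst.
  apply: cvg_expr; rewrite ger0_norm ?powR_ge0//.
  by rewrite /powR gt_eqF ?ltr0n// expR_lt1 pmulr_llt0 ?ln_gt0 ?ltr1n//; lra.
- move=> i; apply: spectral_bounds_atoms => // -[x|]; rewrite /lam /=; last by rewrite exprn_ge0.
  exact: slice_rate_ge0.
Qed.

Lemma slice_sum K (g : R -> R) : \sum_(x : bool * 'I_K) slice_rate x * g (slice_point x) =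
  B `^ (- alpha) * (expR (alpha * h) - 1) *
  \sum_(j < K) expR (alpha * h) ^+ j *
    (theta * g (B * expR (- h) ^+ j) + (1 - theta) * g (- (B * expR (- h) ^+ j))).
Proof.
rewrite -(pair_bigA _ (fun b j => slice_rate (b, j) * g (slice_point (b, j)))) /=.
rewrite big_bool /= -big_split mulr_sumr; apply: eq_bigr => j _.
by rewrite /slice_rate /slice_point /= mul1r mulN1r; ring.
Qed.

(** Summing |x|^a over the cells gives a geometric series of ratio e^(-(a - alpha) h), which
    converges because a > alpha. *)
Lemma geometric_slices (a : R) : alpha < a ->
  B `^ (- alpha) * (expR (alpha * h) - 1) *
    \sum_(j < K) (expR (alpha * h) ^+ j * (B * expR (- h) ^+ j) `^ a) @[K --> \oo] -->
  B `^ (a - alpha) * geom_ratio alpha (a - alpha) h.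
Proof.
move=> aa; set x := expR (- ((a - alpha) * h)).
have x1 : x < 1 by rewrite expR_lt1 oppr_lt0 mulr_gt0// subr_gt0.
have x0 : 0 < x by exact: expR_gt0.
have E K : \sum_(j < K) (expR (alpha * h) ^+ j * (B * expR (- h) ^+ j) `^ a) =
    B `^ a * ((1 - x ^+ K) / (1 - x)).
  have -> : (1 - x ^+ K) / (1 - x) = \sum_(j < K) x ^+ j.
    by rewrite -[1 - x ^+ K]opprB subrX1 -mulNr opprB mulrAC mulfV ?mul1r// subr_eq0 gt_eqF.
  rewrite mulr_sumr; apply: eq_bigr => j _.
  rewrite powRM ?exprn_ge0 ?expR_ge0 ?(ltW B0)// mulrCA; congr (_ * _).
  rewrite -!expRM_natl [X in _ * X]/powR gt_eqF ?expR_gt0// expRK -expRD.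
  by congr expR; rewrite /x; ring.
under eq_fun do rewrite E.
rewrite (_ : B `^ (a - alpha) * _ = B `^ (- alpha) * (expR (alpha * h) - 1) * (B `^ a * ((1 - 0) / (1 - x)))); last first.
  rewrite powRD; last by rewrite (gt_eqF B0) implybT.
  by rewrite /geom_ratio subr0 -/x; ring.
apply: cvgM; first exact: cvg_cst.
apply: cvgM; first exact: cvg_cst.
apply: cvgM; last exact: cvg_cst.
apply: cvgB; first exact: cvg_cst.
by apply: cvg_expr; rewrite ger0_norm ?ltW.
Qed.

Definition slice_limit m : R := if m == 1%N then 0 else
  B `^ (m%:R - alpha) * geom_ratio alpha (m%:R - alpha) h * (theta + (-1) ^+ m * (1 - theta)).

(** Limit in the number K of cells: for fixed h they come to fill the punctured interval up to its
    singularity at 0. *)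
Lemma slice_limit_bounds q : spectral_bounds q s slice_limit
  (B `^ (s - alpha) * geom_ratio alpha (s - alpha) h).
Proof.
have [s02 s1 as_] := stable_exponent.
apply: (@spectral_bounds_lim R q s slice_moment _
  (fun K => \sum_(x : bool * 'I_K) slice_rate x * `|slice_point x| `^ s)) (slice_bounds q).
- move=> m m0; rewrite /slice_limit /slice_moment; case: eqP => m1; first exact: cvg_cst.
  have am : alpha < m%:R.
    have /andP[_ a2] := alpha02; apply: lt_le_trans a2 _; rewrite (ler_nat _ 2).
    by case: m m0 m1 => [|[|]].
  under eq_fun do rewrite (slice_sum _ (fun y => y ^+ m)).
  have := cvgM (geometric_slices am) (cvg_cst (theta + (-1) ^+ m * (1 - theta))).
  move=> /(_ _ _); apply: cvg_trans; apply: near_eq_cvg; apply: nearW => K /=.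
  rewrite -[LHS]mulrA mulr_suml; congr (_ * _); apply: eq_bigr => j _.
  rewrite powR_mulrn ?mulr_ge0 ?exprn_ge0 ?expR_ge0 ?(ltW B0)//.
  rewrite [(- (B * _)) ^+ m]exprNn; move: ((B * _) ^+ m) ((-1) ^+ m) => y z; ring.
- under eq_fun do rewrite (slice_sum _ (fun y => `|y| `^ s)).
  apply: cvg_trans (geometric_slices as_); apply: near_eq_cvg; apply: nearW => K /=.
  congr (_ * _); apply: eq_bigr => j _; congr (_ * _).
  rewrite normrN ger0_norm ?mulr_ge0 ?exprn_ge0 ?expR_ge0 ?(ltW B0)//; ring.
Qed.

End atoms.

(** Limit of vanishing mesh along h = 1 / (i + 1), where [cvg_geom_ratio] gives the exact
    moments. *)
Lemma stable_bounds q theta B : 0 <= theta <= 1 -> 0 < B ->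
  spectral_bounds q s (stable_moment theta B) (alpha / (s - alpha) * B `^ (s - alpha)).
Proof.
move=> t01 B0; have [s02 s1 as_] := stable_exponent; have /andP[a0 a2] := alpha02.
apply: (@spectral_bounds_lim R q s (fun i => slice_limit theta B i.+1%:R^-1) _
  (fun i => B `^ (s - alpha) * geom_ratio alpha (s - alpha) i.+1%:R^-1)).
- move=> m m0; rewrite /slice_limit /stable_moment; case: eqP => m1; first exact: cvg_cst.
  have am : alpha < m%:R.
    by apply: lt_le_trans a2 _; rewrite (ler_nat _ 2); case: m m0 m1 => [|[|]].
  rewrite [alpha / _ * _]mulrC; apply: cvgM; last exact: cvg_cst.
  apply: cvgM; first exact: cvg_cst.
  by apply: cvg_geom_ratio; rewrite ?subr_gt0.
- rewrite mulrC; apply: cvgM; first exact: cvg_cst.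
  by apply: cvg_geom_ratio; rewrite ?subr_gt0.
- by move=> i; apply: slice_limit_bounds => //; rewrite invr_gt0.
Qed.

End stable_moments.

Section discretization.
Context {R : realType}.

Lemma count_thresholds (u : R) (M : nat) : 0 <= u <= M%:R ->
  0 <= u - \sum_(j < M) (nat_of_bool (j.+1%:R <= u)%R)%:R <= 1.
Proof.
elim: M => [|M IH] uM.
  by rewrite big_ord0 subr0; move: uM => /andP[-> u0]; rewrite (le_trans u0).
rewrite big_ord_recr /=; have /andP[u0 uM1] := uM.
have [leM|ltM] := leP u M%:R.
  have -> : (M.+1%:R <= u) = false.
    by apply/negbTE; rewrite -ltNge (le_lt_trans leM)// ltr_nat.
  by rewrite addr0; apply: IH; rewrite u0.
rewrite (eq_bigr (fun=> 1)); last first.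
  by move=> j _; rewrite (le_trans _ (ltW ltM))// ler_nat.
rewrite sumr_const card_ord; move: uM1 ltM; rewrite -natr1.
by case: (leP (M%:R + 1) u) => /= *; apply/andP; split; lra.
Qed.

(** Layer-cake approximation from below: indicators of level sets of g at spacing 1 / (n + 1),
    starting from -K. *)
Definition discretize (K : R) (n M : nat) (g : R -> R) (y : R) : R :=
  n.+1%:R^-1 * \sum_(j < M) (nat_of_bool (j.+1%:R <= (g y + K) * n.+1%:R)%R)%:R - K.

Lemma discretize_dist (K : R) (n M : nat) g y : `|g y| <= K -> K * 2 * n.+1%:R <= M%:R ->
  `|g y - discretize K n M g y| <= n.+1%:R^-1.
Proof.
move=> gK KM; have n0 : 0 < n.+1%:R :> R by [].
pose u := (g y + K) * n.+1%:R.
have u0M : 0 <= u <= M%:R.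
  move: gK; rewrite ler_norml => /andP[g1 g2]; apply/andP; split.
    by rewrite mulr_ge0//; lra.
  by apply: le_trans KM; rewrite ler_wpM2r//; lra.
have := count_thresholds u0M; rewrite /discretize -/u; set S := \sum_(j < M) _.
have -> : g y - (n.+1%:R^-1 * S - K) = n.+1%:R^-1 * (u - S).
  by rewrite mulrBr /u mulrCA mulVf ?gt_eqF//; ring.
move=> /andP[h0 h1]; rewrite normrM ger0_norm ?invr_ge0// ger0_norm//.
by rewrite -[leRHS]mulr1 ler_wpM2l ?invr_ge0.
Qed.

End discretization.

(** * Concentration of traces and convergence of spectral laws *)

Section independence.
Context {R : realType} d (T : measurableType d) (P : probability T R).

Lemma bdm_comp (X : T -> R) (g : R -> R) : measurable_fun setT X -> bdm g -> bdm (g \o X).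
Proof.
by move=> mX [mg [K gK]]; split; [exact: measurableT_comp|exists K => w; exact: gK].
Qed.

Lemma bdm_indic_comp (X : T -> R) (A : set R) : measurable_fun setT X -> measurable A ->
  bdm (fun w => \1_A (X w) : R).
Proof. by move=> mX mA; apply: (bdm_comp mX); exact: bdm_indic. Qed.

(** A bounded g is uniformly close to a finite combination of indicators of its level sets, so
    factorisation extends by linearity. *)
Lemma indicator_to_bounded (X : T -> R) (G : T -> R) g :
  measurable_fun setT X -> bdm G -> bdm g ->
  (forall A, measurable A -> \int[P]_w (G w * \1_A (X w)) =
     \int[P]_w G w * \int[P]_w (\1_A (X w))) ->
  \int[P]_w (G w * g (X w)) = \int[P]_w G w * \int[P]_w g (X w).
Proof.
move=> mX bG bg H; have [mg [K gK]] := bg; have [mG [L GL]] := bG.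
have K0 : 0 <= K by rewrite (le_trans _ (gK 0)).
have L0 : 0 <= L by rewrite (le_trans _ (GL point)).
have bgX : bdm (fun w => g (X w)) by exact: (bdm_comp mX bg).
apply/eqP; rewrite -subr_eq0 -normr_le0; apply/ler_addgt0Pl => e e0; rewrite addr0.
have [n n0 ne] := exists_div_le (mulr_ge0 (ler0n R 2) L0) e0.
pose M := Num.Def.archi_bound (K * 2 * n.-1.+1%:R).
have KM : K * 2 * n.-1.+1%:R <= M%:R by rewrite ltW// archi_boundP// !mulr_ge0.
pose A (j : 'I_M) := [set y | j.+1%:R <= (g y + K) * n.-1.+1%:R].
have mA j : measurable (A j).
  rewrite [A j](_ : _ = (fun y => (g y + K) * n.-1.+1%:R) @^-1` `[j.+1%:R, +oo[%classic); last first.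
    by apply/seteqP; split=> y /=; rewrite in_itv/= andbT.
  rewrite -[X in measurable X]setTI; apply: measurable_funM => //.
  exact: measurable_funD.
pose D w : R := n.-1.+1%:R^-1 * (\sum_(j < M) \1_(A j) (X w)) + (- K).
have DE w : D w = discretize K n.-1 M g (X w).
  rewrite /D /discretize; congr (_ * _ - _); apply: eq_bigr => j _.
  rewrite indicE; have -> // : (X w \in A j) = (j.+1%:R <= (g (X w) + K) * n.-1.+1%:R).
  by apply/idP/idP; rewrite inE.
have gD w : `|g (X w) - D w| <= n%:R^-1.
  by rewrite DE (le_trans (discretize_dist _ KM))// prednK.
have bI j : bdm (fun w => \1_(A j) (X w) : R) by exact: bdm_indic_comp.
have bS : bdm (fun w => \sum_(j < M) \1_(A j) (X w) : R) by apply: bdm_sum => j _; exact: bI.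
have bD : bdm D by apply: bdmD; [exact: bdmZ|exact: bdm_cst].
have ED : \int[P]_w D w = n.-1.+1%:R^-1 * (\sum_(j < M) \int[P]_w (\1_(A j) (X w))) - K.
  by rewrite integral_bdmD ?integral_bdmZ ?integral_cst1 ?integral_bdm_sum//; [exact: bdmZ|exact: bdm_cst].
have EGD : \int[P]_w (G w * D w) = \int[P]_w G w * \int[P]_w D w.
  have -> : (fun w => G w * D w) = (fun w => n.-1.+1%:R^-1 * (\sum_(j < M) G w * \1_(A j) (X w)) + (- K) * G w).
    by apply/funext => w; rewrite -mulr_sumr /D; ring.
  rewrite integral_bdmD; [|apply: bdmZ; apply: bdm_sum => j _; exact: bdmM|exact: bdmZ].
  rewrite !integral_bdmZ//; last by apply: bdm_sum => j _; exact: bdmM.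
  rewrite integral_bdm_sum; last by move=> j _; exact: bdmM.
  under eq_bigr do rewrite H//.
  by rewrite -mulr_sumr ED; ring.
have d1 : `|\int[P]_w (G w * g (X w)) - \int[P]_w (G w * D w)| <= L / n%:R.
  apply: integral_bdm_dist; [exact: bdmM|exact: bdmM|] => w.
  by rewrite -mulrBr normrM ler_pM.
have d2 : `|\int[P]_w g (X w) - \int[P]_w D w| <= n%:R^-1 by apply: integral_bdm_dist.
have d3 : `|\int[P]_w G w| <= L.
  have : `|\int[P]_w G w - \int[P]_w (0 : R)| <= L.
    by apply: integral_bdm_dist => //; [exact: bdm_cst|move=> w; rewrite subr0].
  by rewrite integral_cst1 subr0.
rewrite (_ : _ - _ = (\int[P]_w (G w * g (X w)) - \int[P]_w (G w * D w)) -
  \int[P]_w G w * (\int[P]_w g (X w) - \int[P]_w D w)); last by rewrite EGD; ring.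
apply: le_trans ne; rewrite (le_trans (ler_normB _ _))//.
rewrite (_ : 2 * L / n%:R = L / n%:R + L / n%:R); last by ring.
by rewrite lerD// normrM ler_pM.
Qed.

Variables (I : choiceType) (D : set I) (x : I -> {RV P >-> R}).
Hypothesis indep : mutually_independent D x.

(** Mixed form, in which some factors are still indicators. The induction on us moves an index u
    into vs by testing against an indicator, and [indicator_to_bounded] then restores [g u]. *)
Lemma independent_prod (us vs : seq I) (g : I -> R -> R) (A : I -> set R) :
  uniq (us ++ vs) -> (forall i, i \in us ++ vs -> D i) ->
  (forall i, bdm (g i)) -> (forall i, measurable (A i)) ->
  \int[P]_w ((\prod_(i <- us) g i (x i w)) * \prod_(i <- vs) \1_(A i) (x i w)) =
  (\prod_(i <- us) \int[P]_w g i (x i w)) * \prod_(i <- vs) \int[P]_w (\1_(A i) (x i w)).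
Proof.
move=> + + bg; elim: us vs A => [|u us IH] vs A uq inD mA.
  rewrite big_nil mul1r; under eq_Rintegral do rewrite big_nil mul1r.
  pose J : {fset I} := [fset i in vs]%fset.
  have JE : enum_fset J =i vs by move=> i; rewrite !inE.
  have pJ : perm_eq (enum_fset J) vs by apply: uniq_perm => //; exact: fset_uniq.
  have := @indep J A; rewrite (perm_big _ pJ) /= => /(_ _ mA) H.
  have {}H : P (\bigcap_(i in [set` J]) x i @^-1` A i) = (\prod_(i <- vs) fine (P (x i @^-1` A i)))%:E.
    by apply: H => i /=; rewrite !inE => iv; apply: inD.
  have mxA i : measurable (x i @^-1` A i) by rewrite -[X in measurable X]setTI; exact: measurable_funP.
  have -> : \prod_(i <- vs) \int[P]_w (\1_(A i) (x i w)) = \prod_(i <- vs) fine (P (x i @^-1` A i)).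
    apply: eq_bigr => i _; rewrite -integral_indic1//.
  have mC : measurable (\bigcap_(i in [set` J]) x i @^-1` A i).
    by apply: fin_bigcap_measurable => //; exact: finite_fset.
  rewrite -[RHS](congr1 fine H) -integral_indic1//; apply: eq_Rintegral => w _.
  rewrite indicE; case: (boolP (w \in _)) => [|] wC.
    rewrite big_seq big1// => i iv; rewrite indicE mem_set//.
    by move: wC; rewrite inE => /(_ i); apply => /=; rewrite inE.
  have [i iv wi] : exists2 i, i \in vs & ~ A i (x i w).
    apply: contrapT => K; move/negP: wC; apply; rewrite inE => i /= iv.
    by apply: contrapT => nA; apply: K; exists i => //; move: iv; rewrite inE.
  by rewrite (big_rem i)//= indicE memNset// mul0r.
pose G w := (\prod_(i <- us) g i (x i w)) * \prod_(i <- vs) \1_(A i) (x i w) : R.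
have mx i : measurable_fun setT (x i) by exact: measurable_funP.
have bG : bdm G.
  apply: bdmM; first by apply: bdm_prod => i _; exact: (bdm_comp (mx i)).
  by apply: bdm_prod => i _; exact: bdm_indic_comp.
move: (uq); rewrite cat_cons cons_uniq => /andP[unot uq'].
have inD' i : i \in us ++ vs -> D i by move=> iu; apply: inD; rewrite in_cons iu orbT.
have E : \int[P]_w (G w * g u (x u w)) = \int[P]_w G w * \int[P]_w g u (x u w).
  apply: indicator_to_bounded => // B mB.
  (* The set attached to u becomes B; nothing changes on vs, where u does not occur. *)
  pose A' i := if i == u then B else A i.
  have mA' i : measurable (A' i) by rewrite /A'; case: ifP.
  have uv : u \notin vs by move: unot; rewrite mem_cat negb_or => /andP[].
  have E1 w : \prod_(i <- vs) \1_(A' i) (x i w) = \prod_(i <- vs) \1_(A i) (x i w) :> R.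
    apply: eq_big_seq => i iv; rewrite /A' ifF//; apply/negP => /eqP iu.
    by move: uv; rewrite -iu iv.
  have E2 : \prod_(i <- vs) \int[P]_w (\1_(A' i) (x i w)) = \prod_(i <- vs) \int[P]_w (\1_(A i) (x i w)).
    apply: eq_big_seq => i iv; rewrite /A' ifF//; apply/negP => /eqP iu.
    by move: uv; rewrite -iu iv.
  have pm : perm_eq (us ++ u :: vs) (u :: us ++ vs) by rewrite -cat_rcons -cats1 -catA perm_catCA.
  have : \int[P]_w (\prod_(i <- us) g i (x i w) * \prod_(i <- (u :: vs)) \1_(A' i) (x i w)) =
    \prod_(i <- us) \int[P]_w g i (x i w) * (\int[P]_w (\1_B (x u w)) * \prod_(i <- vs) \int[P]_w (\1_(A i) (x i w))).
    rewrite IH//; first by rewrite big_cons E2 /A' eqxx.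
      by rewrite (perm_uniq pm).
    by move=> i; rewrite (perm_mem pm); exact: inD.
  rewrite mulrCA -(IH vs A uq' inD' mA) mulrC => <-.
  apply: eq_Rintegral => w _; rewrite big_cons E1 /A' eqxx /G; ring.
rewrite big_cons -mulrA -(IH vs A uq' inD' mA) mulrC -E; apply: eq_Rintegral => w _.
rewrite big_cons /G; ring.
Qed.

Lemma independent_mean (us : seq I) (g : I -> R -> R) :
  uniq us -> (forall i, i \in us -> D i) -> (forall i, bdm (g i)) ->
  \int[P]_w (\prod_(i <- us) g i (x i w)) = \prod_(i <- us) \int[P]_w g i (x i w).
Proof.
move=> uq inD bg.
have := @independent_prod us [::] g (fun=> setT); rewrite cats0 => /(_ uq inD bg (fun=> measurableT)).
rewrite big_nil mulr1 => <-; apply: eq_Rintegral => w _; by rewrite big_nil mulr1.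
Qed.

End independence.

Lemma cvg_eq {R : realType} (f g : nat -> R) (l : R) : (forall N, f N = g N) ->
  g N @[N --> \oo] --> l -> f N @[N --> \oo] --> l.
Proof. by move=> /funext ->. Qed.

(** * Mean and variance of normalised traces *)

Section trace_concentration.
Context {R : realType} d (T : measurableType d) (P : probability T R).
Variables (q : nat) (nu : probability R R) (x : seq nat -> {RV P >-> R}).
Hypothesis iid : iid_array q.+2 nu x.
Variable h : nat -> R -> R.
Hypothesis bh : forall N, bdm (h N).
Variables (M : nat -> R) (c : R).

Definition law_moment N m : R := \int[nu]_y (h N y ^+ m).

Hypothesis cvg_law_moment : forall m, (0 < m)%N ->
  N.+1%:R ^+ q.+1 * law_moment N m @[N --> \oo] --> M m.

Local Notation tau := law_moment.

Definition entry N (w : T) (e : seq nat) : R := h N (x e w).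

Lemma sorted_keys N k (s : (wsize q k).-tuple 'I_N.+1) e :
  e \in keys q k (map val s) -> sorted_indices q.+2 e.
Proof.
move=> ek; have /andP[/eqP se _] := proper_keys ek; split=> //.
by case/mapP : ek => f _ ->; apply: sort_sorted; exact: leq_total.
Qed.

Lemma mean_entry_pow N m e : sorted_indices q.+2 e ->
  \int[P]_w (h N (x e w) ^+ m) = tau N m.
Proof.
move=> se; have [_ law] := iid; have bhm := bdmX m (bh N).
have bhx : bdm (fun w => h N (x e w) ^+ m) by exact: (bdm_comp (measurable_funP (x e)) bhm).
have mE : measurable_fun setT (EFin \o (fun y => h N y ^+ m)) by apply/measurable_EFinP; case: bhm.
rewrite /law_moment /Rintegral; congr fine.
rewrite (@eq_measure_integral _ _ _ _ (distribution P (x e)) nu); last first.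
  by move=> A mA _; exact/esym/(law _ se).
by rewrite integral_distribution//; exact: (bdm_integrable P bhx).
Qed.

Lemma bdm_entry N e : bdm (fun w => entry N w e).
Proof. exact: (bdm_comp (measurable_funP (x e)) (bh N)). Qed.

Lemma mean_entry_prod N (ks : seq (seq nat)) : (forall e, e \in ks -> sorted_indices q.+2 e) ->
  \int[P]_w (\prod_(e <- ks) entry N w e) = blockprod (tau N) ks.
Proof.
move=> sks; have [ind _] := iid.
have := independent_mean ind (undup_uniq ks) _ (g := fun e y => h N y ^+ count_mem e ks).
move=> /(_ _ _) H; under eq_Rintegral do rewrite prod_undup_count.
rewrite H.
- rewrite /blockprod [LHS]big_seq [RHS]big_seq; apply: eq_bigr => e; rewrite mem_undup => ek.
  exact/mean_entry_pow/sks.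
- by move=> e; rewrite mem_undup; exact: sks.
- by move=> e; apply: bdmX.
Qed.

Definition trace_moment N k w : R := N.+1%:R^-1 * \tr (contraction q N c (entry N w) ^+ k).

Lemma trace_momentE N k w : trace_moment N k w = c ^+ k / N.+1%:R *
  \sum_(s : (wsize q k).-tuple 'I_N.+1 | closed_walk (map val s)) walk_weight q (entry N w) k (map val s).
Proof. by rewrite /trace_moment contraction_trace; ring. Qed.

Lemma bdm_walk_weight N k (s : seq nat) : bdm (fun w => walk_weight q (entry N w) k s).
Proof. by apply: bdm_prod => e _; exact: bdm_entry. Qed.

Lemma bdm_trace_moment N k : bdm (trace_moment N k).
Proof.
rewrite (funext (trace_momentE N k)).
by apply: bdmZ; apply: bdm_sum => s _; exact: bdm_walk_weight.
Qed.

Lemma mean_trace_moment N k :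
  \int[P]_w trace_moment N k w = c ^+ k * (walk_sum q N.+1 k (tau N) / N.+1%:R).
Proof.
under eq_Rintegral do rewrite trace_momentE.
rewrite integral_bdmZ; last by apply: bdm_sum => s _; exact: bdm_walk_weight.
rewrite integral_bdm_sum; last by move=> s _; exact: bdm_walk_weight.
rewrite (_ : \sum_(s | _) _ = walk_sum q N.+1 k (tau N)); first by ring.
apply: eq_bigr => s _; rewrite mean_entry_prod// => e; exact: sorted_keys.
Qed.

Lemma cvg_mean_trace_moment k :
  \int[P]_w trace_moment N k w @[N --> \oo] --> c ^+ k * tree_moment q M k.
Proof.
under eq_fun do rewrite mean_trace_moment.
by apply: cvgM; [exact: cvg_cst|exact: cvg_walk_sum].
Qed.

Section pairs.
Variable k : nat.
Let W := wsize q k.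

(** Contribution of two walks to the variance of a trace. Both sit in one tuple t so that pattern
    counting applies to the pair; walks without a common vertex are independent and contribute
    nothing. *)
Definition excess N (t : seq nat) : R :=
  let s := take W t in let s' := drop W t in
  if [&& closed_walk s, closed_walk s' & has (mem s) s'] then
    blockprod (tau N) (keys q k s ++ keys q k s') -
    blockprod (tau N) (keys q k s) * blockprod (tau N) (keys q k s')
  else 0.

Lemma mean_sqr_trace_moment N :
  \int[P]_w (trace_moment N k w ^+ 2) - (\int[P]_w trace_moment N k w) ^+ 2 =
  (c ^+ k / N.+1%:R) ^+ 2 * \sum_(t : (W + W).-tuple 'I_N.+1) excess N (map val t).
Proof.
set a := c ^+ k / N.+1%:R.
have bw (s s' : seq nat) : bdm (fun w => walk_weight q (entry N w) k s * walk_weight q (entry N w) k s').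
  by apply: bdmM; exact: bdm_walk_weight.
have -> : \int[P]_w (trace_moment N k w ^+ 2) = a ^+ 2 *
  \sum_(s : W.-tuple 'I_N.+1 | closed_walk (map val s)) \sum_(s' : W.-tuple 'I_N.+1 | closed_walk (map val s'))
     blockprod (tau N) (keys q k (map val s) ++ keys q k (map val s')).
  transitivity (\int[P]_w (a ^+ 2 * \sum_(s : W.-tuple 'I_N.+1 | closed_walk (map val s)) \sum_(s' : W.-tuple 'I_N.+1 | closed_walk (map val s'))
     (walk_weight q (entry N w) k (map val s) * walk_weight q (entry N w) k (map val s')))).
    apply: eq_Rintegral => w _; rewrite trace_momentE exprMn; congr (_ * _).
    by rewrite expr2 mulr_suml; apply: eq_bigr => s _; rewrite mulr_sumr.
  rewrite integral_bdmZ; last by apply: bdm_sum => s _; apply: bdm_sum => s' _.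
  rewrite integral_bdm_sum; last by move=> s _; apply: bdm_sum => s' _.
  congr (_ * _); apply: eq_bigr => s _; rewrite integral_bdm_sum//; apply: eq_bigr => s' _.
  rewrite -mean_entry_prod; last by move=> e; rewrite mem_cat => /orP[|]; exact: sorted_keys.
  by apply: eq_Rintegral => w _; rewrite big_cat.
have -> : (\int[P]_w trace_moment N k w) ^+ 2 = a ^+ 2 *
  \sum_(s : W.-tuple 'I_N.+1 | closed_walk (map val s)) \sum_(s' : W.-tuple 'I_N.+1 | closed_walk (map val s'))
     (blockprod (tau N) (keys q k (map val s)) * blockprod (tau N) (keys q k (map val s'))).
  rewrite mean_trace_moment (_ : c ^+ k * _ = a * walk_sum q N.+1 k (tau N)); last by rewrite /a; ring.
  rewrite exprMn; congr (_ * _); rewrite expr2 mulr_suml; apply: eq_bigr => s _.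
  by rewrite mulr_sumr.
rewrite -mulrBr -sumrB; congr (_ * _).
rewrite (@big_tuple_cat R _ _ W W (fun t => excess N (map val t)))//.
rewrite big_mkcond; apply: eq_bigr => s _; rewrite -sumrB.
case: ifPn => cs; last first.
  rewrite big1// => s' _; rewrite /excess map_cat take_size_cat ?size_map ?size_tuple//.
  by rewrite (negbTE cs).
rewrite big_mkcond; apply: eq_bigr => s' _.
rewrite /excess map_cat take_size_cat ?size_map ?size_tuple// drop_size_cat ?size_map ?size_tuple//.
rewrite cs; case: ifP => //= _; case: ifPn => // dis.
have [|-> _] := blockprod_cat (tau N) (ks := keys q k (map val s)) (ks' := keys q k (map val s')); last by rewrite subrr.
apply/hasPn => e es'; apply/negP => es; move/negP: dis; apply.
have [se _] := sorted_keys es.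
(* Keys are nonempty, so a common key exhibits a common vertex. *)
have e0 : head 0%N e \in e by case: e se {es es'} => //= y e' _; rewrite mem_head.
apply/hasP; exists (head 0%N e); first exact: (mem_keys es').
exact: (mem_keys es).
Qed.

Lemma excess_relabel N (s : seq nat) (g : nat -> nat) : {in s &, injective g} ->
  excess N (map g s) = excess N s.
Proof.
move=> inj; rewrite /excess -map_take -map_drop.
set s1 := take W s; set s2 := drop W s.
have i1 : {in s1 &, injective g} by move=> y z /mem_take ys /mem_take zs; exact: inj.
have i2 : {in s2 &, injective g} by move=> y z /mem_drop ys /mem_drop zs; exact: inj.
rewrite !closed_relabel// (keys_relabel q k (tau N) i1).1 (keys_relabel q k (tau N) i2).1.
have -> : has (mem (map g s1)) (map g s2) = has (mem s1) s2.
  apply/hasP/hasP => [[_ /mapP[y y2 ->]] /mapP[z z1 /inj E]|[y y2 y1]]; last first.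
    by exists (g y); rewrite /= map_f.
  exists y => //=; rewrite E ?(mem_drop y2) ?(mem_take z1)//.
have -> // : blockprod (tau N) (keys q k (map g s1) ++ keys q k (map g s2)) =
  blockprod (tau N) (keys q k s1 ++ keys q k s2).
rewrite /keys !hedges_map -!map_cat.
have [|-> //] := @key_map_in R (hedges q k s1 ++ hedges q k s2) s g (tau N) _ inj.
move=> e; rewrite mem_cat => /orP[] /mem_hedges H y /H; [exact: mem_take|exact: mem_drop].
Qed.

(** A pair of walks is normalised by N^2 but has only one vertex beyond (q + 1) b: a factor 1 / N
    remains. *)
Lemma cvg_class0 D (sigma : D.+1.-tuple 'I_D.+1) b (f : nat -> R) (l : R) :
  (size (undup (map val sigma)) <= 1 + q.+1 * b)%N ->
  N.+1%:R ^+ (q.+1 * b) * f N @[N --> \oo] --> l ->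
  #|pattern_class N sigma|%:R / N.+1%:R ^+ 2 * f N @[N --> \oo] --> (0 : R).
Proof.
move=> sb fl; set v := size _ in sb.
have L1 : #|pattern_class N sigma|%:R / N.+1%:R ^+ (1 + q.+1 * b) * N.+1%:R^-1 @[N --> \oo] --> (0 : R).
  apply: (squeeze_cvgr _ (cvg_cst (0 : R)) (@cvg_harmonic R)).
  apply: nearW => N; rewrite mulr_ge0 ?divr_ge0 ?exprn_ge0 ?invr_ge0//= /harmonic /=.
  rewrite ler_piMl ?invr_ge0// ler_pdivrMr ?exprn_gt0// mul1r -natrX ler_nat.
  by rewrite (leq_trans (pattern_class_le _ _))// leq_pexp2l.
rewrite -(mul0r l); apply: cvg_trans (cvgM L1 fl); apply: near_eq_cvg; apply: nearW => N /=.
have y0 : N.+1%:R ^+ (q.+1 * b) != 0 :> R by rewrite expf_neq0// pnatr_eq0.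
have x0 : N.+1%:R != 0 :> R by rewrite pnatr_eq0.
rewrite exprD expr1; move: y0; move: (N.+1%:R ^+ (q.+1 * b) : R) => y y0.
by move: x0; move: (N.+1%:R : R) => z z0; field; rewrite z0.
Qed.

(** Both terms of [excess] satisfy [cvg_class0]: the joint one by [vertex_bound2], and the product
    because the separate numbers of keys add up to at least the joint number. *)
Lemma cvg_excess : N.+1%:R ^- 2 * \sum_(t : (W + W).-tuple 'I_N.+1) excess N (map val t)
   @[N --> \oo] --> (0 : R).
Proof.
have WE : (W + W = (k * q.+1 + W).+1)%N by [].
rewrite WE; set D := (k * q.+1 + W)%N.
have E N : N.+1%:R ^- 2 * \sum_(t : D.+1.-tuple 'I_N.+1) excess N (map val t) =
  \sum_(sigma : D.+1.-tuple 'I_D.+1) #|pattern_class N sigma|%:R / N.+1%:R ^+ 2 * excess N (map val sigma).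
  rewrite (@sum_by_pattern R D N (excess N)); last by move=> s g; exact: excess_relabel.
  rewrite mulr_sumr; apply: eq_bigr => sigma _; ring.
apply: (cvg_eq E).
rewrite [X in _ --> X](_ : 0 = \sum_(sigma : D.+1.-tuple 'I_D.+1) (0 : R)); last by rewrite big1.
apply: cvg_sum_seq => sigma; rewrite /excess.
set s := take W _; set s' := drop W _.
have sz : size (map val sigma) = (W + W)%N by rewrite size_map size_tuple.
have ss : size s = W by rewrite size_takel// sz leq_addr.
have ss' : size s' = W by rewrite size_drop sz addKn.
have [/and3P[_ _ sh]|_] := boolP [&& closed_walk s, closed_walk s' & has (mem s) s']; last first.
  by apply: (cvg_eq (fun=> mulr0 _)); exact: cvg_cst.
set ks := keys q k s; set ks' := keys q k s'.
have vb : (size (undup (map val sigma)) <= 1 + q.+1 * size (undup (ks ++ ks')))%N.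
  by have := vertex_bound2 ss ss' sh; rewrite cat_take_drop.
have bE (N : nat) (l : seq (seq nat)) : N.+1%:R ^+ (q.+1 * size (undup l)) * blockprod (tau N) l =
    blockprod (fun m => N.+1%:R ^+ q.+1 * tau N m) l.
  by rewrite blockprod_const -exprM.
have Lb (l : seq (seq nat)) : N.+1%:R ^+ (q.+1 * size (undup l)) * blockprod (tau N) l @[N --> \oo] --> blockprod M l.
  by apply: (cvg_eq (bE ^~ l)); exact: cvg_blockprod.
apply: (cvg_eq (fun=> mulrBr _ _ _)).
rewrite -[X in _ --> X](subr0 0); apply: cvgB; first exact: (cvg_class0 vb (Lb _)).
apply: (@cvg_class0 _ _ (size (undup ks) + size (undup ks')) _ (blockprod M ks * blockprod M ks')).
  apply: leq_trans vb _; rewrite leq_add2l leq_mul2l /= size_undup_cat leq_add2l.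
  by rewrite -filter_undup size_filter count_size.
apply: cvg_trans (cvgM (Lb ks) (Lb ks')); apply: near_eq_cvg; apply: nearW => N /=.
by rewrite mulnDr exprD mulrACA.
Qed.

(** Variance plus squared bias, each tending to 0. *)
Theorem cvg_trace_moment_sqr :
  \int[P]_w ((trace_moment N k w - c ^+ k * tree_moment q M k) ^+ 2) @[N --> \oo] --> (0 : R).
Proof.
set m := c ^+ k * tree_moment q M k.
have bt N := bdm_trace_moment N k.
have E N : \int[P]_w ((trace_moment N k w - m) ^+ 2) =
   (c ^+ k) ^+ 2 * (N.+1%:R ^- 2 * \sum_(t : (W + W).-tuple 'I_N.+1) excess N (map val t)) +
   (\int[P]_w trace_moment N k w - m) ^+ 2.
  transitivity (\int[P]_w (trace_moment N k w ^+ 2 + ((- m *+ 2) * trace_moment N k w + m ^+ 2))).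
    by apply: eq_Rintegral => w _; ring.
  rewrite integral_bdmD; [|exact: bdmX|apply: bdmD; [exact: bdmZ|exact: bdm_cst]].
  rewrite integral_bdmD; [|exact: bdmZ|exact: bdm_cst].
  rewrite integral_bdmZ// integral_cst1.
  have := mean_sqr_trace_moment N; set I2 := \int[P]_w _; set I1 := \int[P]_w _.
  set S := \sum_t _ => H.
  have -> : I2 = I1 ^+ 2 + (c ^+ k / N.+1%:R) ^+ 2 * S by rewrite -H; ring.
  by rewrite exprMn exprVn; ring.
apply: (cvg_eq E).
rewrite [X in _ --> X](_ : 0 = (c ^+ k) ^+ 2 * 0 + (m - m) * (m - m)); last by rewrite subrr !mulr0 addr0.
apply: cvgD; first by apply: cvgM; [exact: cvg_cst|exact: cvg_excess].
under eq_fun do rewrite expr2.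
by apply: cvgM; apply: cvgB; (exact: cvg_mean_trace_moment || exact: cvg_cst).
Qed.

End pairs.
End trace_concentration.

Section mean_square.
Context {R : realType} d (T : measurableType d) (P : probability T R).
Implicit Types X Y : nat -> T -> R.

Definition mean_square_null X :=
  (forall N, bdm (X N)) /\ \int[P]_w (X N w ^+ 2) @[N --> \oo] --> (0 : R).

Lemma mean_square_nullD X Y : mean_square_null X -> mean_square_null Y ->
  mean_square_null (fun N w => X N w + Y N w).
Proof.
move=> [bX X0] [bY Y0]; split; first by move=> N; exact: bdmD.
have L : 2 * \int[P]_w (X N w ^+ 2) + 2 * \int[P]_w (Y N w ^+ 2) @[N --> \oo] --> 2 * 0 + 2 * (0 : R).
  by apply: cvgD; (apply: cvgM; first exact: cvg_cst).
rewrite mulr0 addr0 in L; apply: (squeeze_cvgr _ (cvg_cst (0 : R)) L).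
apply: nearW => N; rewrite integral_bdm_ge0 => [/=|w]; last exact: sqr_ge0.
have bX2 := bdmX 2 (bX N); have bY2 := bdmX 2 (bY N).
rewrite -!integral_bdmZ// -integral_bdmD; [|exact: bdmZ|exact: bdmZ].
apply: le_integral_bdm; [exact/bdmX/bdmD|by apply: bdmD; exact: bdmZ|move=> w].
rewrite -subr_ge0 (_ : _ - _ = (X N w - Y N w) ^+ 2) ?sqr_ge0//; ring.
Qed.

Lemma mean_square_nullZ c X : mean_square_null X -> mean_square_null (fun N w => c * X N w).
Proof.
move=> [bX X0]; split; first by move=> N; exact: bdmZ.
apply: (cvg_eq (g := fun N => c ^+ 2 * \int[P]_w (X N w ^+ 2))).
  move=> N; rewrite -integral_bdmZ; last exact: bdmX.
  by apply: eq_Rintegral => w _; rewrite exprMn.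
by rewrite -[X in _ --> X](mulr0 (c ^+ 2)); apply: cvgM => //; exact: cvg_cst.
Qed.

Lemma mean_square_null_sum n (X : 'I_n -> nat -> T -> R) :
  (forall i, mean_square_null (X i)) -> mean_square_null (fun N w => \sum_(i < n) X i N w).
Proof.
elim: n X => [|n IH] X nX.
  rewrite (_ : (fun _ _ => _) = fun _ _ => 0); last first.
    by apply/funext => N; apply/funext => w; rewrite big_ord0.
  split; first by move=> N; exact: bdm_cst.
  apply: (cvg_eq (g := fun=> 0)); last exact: cvg_cst.
  by move=> N; under eq_Rintegral do rewrite expr0n; rewrite integral_cst1.
rewrite (_ : (fun _ _ => _) = fun N w => \sum_(i < n) X (widen_ord (leqnSn n) i) N w + X ord_max N w); last first.
  by apply/funext => N; apply/funext => w; rewrite big_ord_recr.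
by apply: mean_square_nullD => //; apply: IH.
Qed.

Lemma markov_sqr (X : T -> R) (e : R) : 0 < e -> bdm X ->
  fine (P [set w | e <= X w]) <= e^-1 * \int[P]_w `|X w|.
Proof.
move=> e0 bX; have [mX _] := bX.
have mA : measurable [set w | e <= X w].
  rewrite (_ : [set w | _] = X @^-1` `[e, +oo[%classic); last first.
    by apply/seteqP; split=> w /=; rewrite in_itv/= andbT.
  by rewrite -[Y in measurable Y]setTI; exact: mX.
rewrite -integral_indic1// -integral_bdmZ; last exact: bdm_norm.
apply: le_integral_bdm; [exact: bdm_indic|by apply: bdmZ; exact: bdm_norm|move=> w].
rewrite indicE; case: (boolP (w \in _)) => [|_]; last by rewrite mulr_ge0 ?invr_ge0 ?(ltW e0).
by rewrite inE /= => eX; rewrite ler_pdivlMl// mulr1 (le_trans eX)// ler_norm.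
Qed.

End mean_square.

(** * From traces to empirical spectral distributions *)

Section convergence.
Context {R : realType} d (T : measurableType d) (P : probability T R).
Variables (q : nat) (nu : probability R R) (x : seq nat -> {RV P >-> R}).
Hypothesis iid : iid_array q.+2 nu x.
Variable h : nat -> R -> R.
Hypothesis bh : forall N, bdm (h N).
Variables (M : nat -> R) (c : R).
Hypothesis cvg_law_moment : forall m, (0 < m)%N ->
  N.+1%:R ^+ q.+1 * law_moment nu h N m @[N --> \oo] --> M m.

Let A N w := contraction q N c (entry x h N w).
Let tm N k w := trace_moment q x h c N k w.

Lemma esd_integral_horner N w Q : \int[esd (A N w)]_y Q.[y] = Lin (fun k => tm N k w) Q.
Proof.
rewrite esd_integral//; last by apply: continuous_measurable_fun; exact: continuous_horner.
rewrite sum_eigenvalues_horner ?contraction_sym// /Lin mulr_sumr.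
by apply: eq_bigr => i _; rewrite mulrCA.
Qed.

Lemma bdm_Lin_trace N Q : bdm (fun w => Lin (fun k => tm N k w) Q).
Proof. by apply: bdm_sum => i _; apply: bdmZ; exact: bdm_trace_moment. Qed.

Lemma esd_dist N w (f g : R -> R) (e : R) : measurable_fun setT f -> measurable_fun setT g ->
  (forall l, l \in eigenvalues (A N w) -> `|f l - g l| <= e) ->
  `|\int[esd (A N w)]_y f y - \int[esd (A N w)]_y g y| <= e.
Proof.
move=> mf mg fg; rewrite !esd_integral// -mulrBr -sumrB normrM ger0_norm ?invr_ge0//.
rewrite ler_pdivrMl//; apply: le_trans (ler_norm_sum _ _ _) _.
rewrite big_seq; apply: (@le_trans _ _ (\sum_(l <- eigenvalues (A N w)) e)).
  by rewrite [leRHS]big_seq; apply: ler_sum => l /fg.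
by rewrite big_const_seq count_predT size_map size_enum_ord iter_addr_0 mulr_natl.
Qed.

(** Measurability of the eigenvalues is bypassed: on the bounded range of the spectrum f is a
    uniform limit of polynomials, whose spectral integrals are combinations of traces. *)
Lemma measurable_esd_integral N f : bcont f ->
  measurable_fun setT (fun w => \int[esd (A N w)]_y f y).
Proof.
move=> bf; have [cf _] := bf; have [mf _] := bcont_bdm bf.
have [_ [K tK]] := bdm_trace_moment q x bh c N 2.
(* A deterministic bound on the spectrum. The squared eigenvalues sum to the trace of the square,
   which is bounded as the entries are; adding 1 turns a bound on l^2 into one on |l|. *)
pose a := 1 + N.+1%:R * `|K|.
have a0 : 0 < a by rewrite ltr_pwDl// mulr_ge0.
have la w l : l \in eigenvalues (A N w) -> `|l| <= a.
  move=> lA; have := eigenvalue_sqr_le (contraction_sym _ _ _ _) lA.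
  have := le_trans (tK w) (ler_norm K); rewrite /trace_moment normrM ger0_norm ?invr_ge0//.
  rewrite ler_pdivrMl// => /(le_trans (ler_norm _)) H1 /le_trans/(_ H1) H2.
  rewrite /a; case: (leP `|l| 1) => [l1|l1]; first by rewrite (le_trans l1)// lerDl mulr_ge0.
  rewrite ler_wpDl//; apply: le_trans H2; rewrite -real_normK ?num_real//.
  by rewrite expr2 ler_peMr// ltW.
have /choice[Q fQ] (n : nat) : exists Q : {poly R}, forall y, `|y| <= a -> `|f y - Q.[y]| <= n.+1%:R^-1.
  by apply: weierstrass => //; rewrite invr_gt0.
apply: (@measurable_fun_cvg _ _ _ setT (fun n w => Lin (fun k => tm N k w) (Q n))).
  by move=> n; have [] := bdm_Lin_trace N (Q n).
move=> w _; apply/cvgrPdist_le => e e0.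
have := @cvg_harmonic R; move/cvgrPdist_le => /(_ e e0); apply: filterS => n.
rewrite sub0r normrN ger0_norm ?invr_ge0// => ne.
rewrite -esd_integral_horner; apply: le_trans ne; apply: esd_dist => //.
  by apply: continuous_measurable_fun; exact: continuous_horner.
by move=> l /la; exact: fQ.
Qed.

Variables (mu : probability R R) (C : R).
Hypothesis fmu : finite_moments mu.
Hypothesis mmu : forall k, moment k mu = c ^+ k * tree_moment q M k.
Hypothesis C0 : 0 < C.
Hypothesis growth : forall k, `|moment k mu| <= C ^+ k * k`!%:R.

Lemma mean_square_null_Lin Q :
  mean_square_null P (fun N w => Lin (fun k => tm N k w) Q - Lin (moment ^~ mu) Q).
Proof.
rewrite (_ : (fun _ _ => _) = fun N w => \sum_(i < size Q) (Q`_i * (tm N i w - moment i mu))); last first.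
  apply/funext => N; apply/funext => w; rewrite /Lin -sumrB.
  by apply: eq_bigr => i _; rewrite mulrBr.
apply: mean_square_null_sum => i; apply: mean_square_nullZ; split.
  by move=> N; apply: bdmB; [exact: bdm_trace_moment|exact: bdm_cst].
by have := cvg_trace_moment_sqr iid bh c cvg_law_moment i; rewrite -mmu; apply.
Qed.

(** When the two integrals of f differ by more than e, one of the trace errors for Q and W must be
    large, because the limit functional of W is small. Markov's inequality for the sum of their
    squares concludes. *)
Theorem esd_weak_cvg : weak_cvg_in_probability P (fun N w => esd (A N w)) mu.
Proof.
move=> f cf bf e e0.
have [K fK] : exists K, forall y, `|f y| <= K.
  by have [K [_ HK]] := bf; exists (K + 1) => y; apply: HK => //; rewrite ltrDl.
have bcf : bcont f by split=> //; exists K.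
have e80 : 0 < e / 8 by rewrite divr_gt0.
have [Q [W [fQ We]]] := polynomial_squeeze C0 growth cf fK e80.
pose XQ N w := Lin (fun k => tm N k w) Q - Lin (moment ^~ mu) Q.
pose XW N w := Lin (fun k => tm N k w) W - Lin (moment ^~ mu) W.
have [bQ Q0] := mean_square_null_Lin Q; have [bW W0] := mean_square_null_Lin W.
pose Z N w := XQ N w ^+ 2 + XW N w ^+ 2.
have bZ N : bdm (Z N) by apply: bdmD; apply: bdmX; [exact: bQ|exact: bW].
have Z0 N w : 0 <= Z N w by rewrite addr_ge0 ?sqr_ge0.
(* On the event |XQ| + |XW| >= e / 2, so the sum of squares is at least (e / 2)^2 / 2. *)
pose r := e ^+ 2 / 8; have r0 : 0 < r by rewrite divr_gt0 ?exprn_gt0.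
pose S N := [set w | e < `|\int[esd (A N w)]_y f y - \int[mu]_y f y|].
have mf := (bcont_bdm bcf).1.
have mS N : measurable (S N).
  have mI : measurable_fun setT (fun w => `|\int[esd (A N w)]_y f y - \int[mu]_y f y|).
    apply: measurableT_comp => //; apply: measurable_funB => //.
    exact: measurable_esd_integral.
  rewrite (_ : S N = (fun w => `|\int[esd (A N w)]_y f y - \int[mu]_y f y|) @^-1` `]e, +oo[%classic); last first.
    by apply/seteqP; split=> w /=; rewrite in_itv/= andbT.
  by rewrite -[X in measurable X]setTI; exact: mI.
have mpoly V : measurable_fun setT (horner V : R -> R).
  by apply: continuous_measurable_fun; exact: continuous_horner.
have SZ N : S N `<=` [set w | r <= Z N w].
  move=> w /=; rewrite /S /= => ew.
  have d1 : `|\int[esd (A N w)]_y f y - Lin (fun k => tm N k w) Q| <= Lin (fun k => tm N k w) W.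
    rewrite -!esd_integral_horner !esd_integral// -mulrBr -sumrB normrM ger0_norm ?invr_ge0//.
    rewrite ler_wpM2l ?invr_ge0//; apply: le_trans (ler_norm_sum _ _ _) _.
    by apply: ler_sum => l _; exact: fQ.
  have d2 := integral_squeeze fmu bcf fQ.
  have hh : e < `|XQ N w| + `|XW N w| + e / 4.
    apply: lt_le_trans ew _.
    rewrite (_ : _ - _ = (\int[esd (A N w)]_y f y - Lin (fun k => tm N k w) Q) + XQ N w - (\int[mu]_y f y - Lin (moment ^~ mu) Q)); last by rewrite /XQ; ring.
    apply: le_trans (ler_normB _ _) _.
    apply: le_trans (lerD (ler_normD _ _) (lexx _)) _.
    have := ler_norm (XW N w); rewrite {1}/XW => h1.
    have h2 := le_trans d2 We; have h3 := We; move: d1 h1 h2 h3; lra.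
  rewrite /r /Z -(real_normK (num_real (XQ N w))) -(real_normK (num_real (XW N w))).
  move: hh (normr_ge0 (XQ N w)) (normr_ge0 (XW N w)); set a := `|_|; set b := `|_| => hh a0 b0.
  have hab : e / 2 <= a + b by lra.
  have : (e / 2) ^+ 2 <= (a + b) ^+ 2 by rewrite ler_sqr ?nnegrE ?addr_ge0//; lra.
  have := sqr_ge0 (a - b); nra.
have LZ : r^-1 * (\int[P]_w (XQ N w ^+ 2) + \int[P]_w (XW N w ^+ 2)) @[N --> \oo] --> r^-1 * (0 + 0 : R).
  by apply: cvgM; [exact: cvg_cst|exact: cvgD].
rewrite addr0 mulr0 in LZ.
apply: cvg_EFin; first by apply: nearW => N; exact: (fin_num_measure P _ (mS N)).
apply: (squeeze_cvgr _ (cvg_cst (0 : R)) LZ); apply: nearW => N /=.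
rewrite fine_ge0//=; apply: (@le_trans _ _ (fine (P [set w | r <= Z N w]))).
  have mZ : measurable [set w | r <= Z N w].
    rewrite (_ : [set w | _] = Z N @^-1` `[r, +oo[%classic); last first.
      by apply/seteqP; split=> w /=; rewrite in_itv/= andbT.
    by rewrite -[X in measurable X]setTI; apply: (bZ N).1.
  have mSN := mS N; rewrite -/(S N).
  apply: fine_le; [exact: fin_num_measure|exact: fin_num_measure|].
  by apply: le_measure; rewrite ?inE//; exact: SZ.
apply: le_trans (markov_sqr P r0 (bZ N)) _; rewrite ler_wpM2l ?invr_ge0 ?(ltW r0)//.
under eq_Rintegral do rewrite ger0_norm//.
by rewrite integral_bdmD//; [exact: (bdmX 2 (bQ N))|exact: (bdmX 2 (bW N))].
Qed.

End convergence.

(** * Regular variation and truncated moments *)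

Section sandwich.
Context {R : realType}.

(** The bounding sequences may depend on e and have different limits, which suits bounds obtained
    from a discretisation. *)
Lemma cvg_sandwich (f : nat -> R) (l : R) :
  (forall e : R, 0 < e -> exists (u v : nat -> R) (a b : R),
     [/\ u N @[N --> \oo] --> a, v N @[N --> \oo] --> b,
         \forall N \near \oo, u N <= f N <= v N, l - e <= a & b <= l + e]) ->
  f N @[N --> \oo] --> l.
Proof.
move=> H; apply/cvgrPdist_le => e e0; have e20 : 0 < e / 2 by rewrite divr_gt0.
have [u [v [a [b [/cvgrPdist_le ua /cvgrPdist_le vb uv la bl]]]]] := H _ e20.
near=> N; have /andP[u1 v1] : u N <= f N <= v N by near: N.
have : `|a - u N| <= e / 2 by near: N; exact: ua.
have : `|b - v N| <= e / 2 by near: N; exact: vb.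
by rewrite !ler_norml => /andP[b1 b2] /andP[a1 a2]; apply/andP; split; lra.
Unshelve. all: by end_near. Qed.

End sandwich.

Section regular_variation.
Context {R : realType} (nu : probability R R) (alpha theta : R).
Hypothesis alpha0 : 0 < alpha.
Hypothesis heavy : heavy_tailed alpha theta nu.

Definition tail (u : R) : R := fine (nu [set y : R | u <= `|y|]).
Definition open_tail (u : R) : R := fine (nu [set y : R | u < `|y|]).

Lemma measurable_absge (u : R) : measurable [set y : R | u <= `|y|].
Proof.
rewrite (_ : [set y : R | _] = Num.norm @^-1` `[u, +oo[%classic); last first.
  by apply/seteqP; split=> y /=; rewrite in_itv/= andbT.
by rewrite -[X in measurable X]setTI; exact: normr_measurable.
Qed.

Lemma measurable_absgt (u : R) : measurable [set y : R | u < `|y|].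
Proof.
rewrite (_ : [set y : R | _] = Num.norm @^-1` `]u, +oo[%classic); last first.
  by apply/seteqP; split=> y /=; rewrite in_itv/= andbT.
by rewrite -[X in measurable X]setTI; exact: normr_measurable.
Qed.

Lemma measurable_gt (u : R) : measurable [set y : R | u < y].
Proof.
rewrite (_ : [set y : R | _] = `]u, +oo[%classic); first exact: measurable_itv.
by apply/seteqP; split=> y /=; rewrite in_itv/= andbT.
Qed.

Lemma measurable_lt (u : R) : measurable [set y : R | y < u].
Proof.
rewrite (_ : [set y : R | _] = `]-oo, u[%classic); first exact: measurable_itv.
by apply/seteqP; split=> y /=; rewrite in_itv/=.
Qed.

Lemma fine_nu_le (A B : set R) : measurable A -> measurable B -> A `<=` B ->
  fine (nu A) <= fine (nu B).
Proof.
move=> mA mB AB; apply: fine_le; rewrite ?fin_num_measure//.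
by apply: le_measure; rewrite ?inE.
Qed.

Lemma tail_ge0 u : 0 <= tail u.
Proof. exact: fine_ge0. Qed.

Lemma tail_homo u v : u <= v -> tail v <= tail u.
Proof.
move=> uv; apply: fine_nu_le; try exact: measurable_absge.
by move=> y /=; exact: le_trans.
Qed.

Lemma open_tail_le u : open_tail u <= tail u.
Proof.
apply: fine_nu_le; [exact: measurable_absgt|exact: measurable_absge|].
by move=> y /=; exact: ltW.
Qed.

Lemma open_tail_ge u v : u < v -> tail v <= open_tail u.
Proof.
move=> uv; apply: fine_nu_le; [exact: measurable_absge|exact: measurable_absgt|].
by move=> y /=; exact: lt_le_trans.
Qed.

Lemma tail_gt0 u : 0 < u -> 0 < tail u.
Proof.
move=> u0; have [[L [L0 _ _] tE] _] := heavy.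
by rewrite /tail tE//= mulr_gt0 ?L0 ?powR_gt0.
Qed.

Lemma tail_ratio c : 0 < c -> tail (c * u) / tail u @[u --> +oo] --> c `^ (- alpha).
Proof.
move=> c0; have [[L [L0 _ Lc] tE] _] := heavy.
rewrite -[X in _ --> X]mul1r.
have H : L (c * u) / L u * c `^ (- alpha) @[u --> +oo] --> 1 * c `^ (- alpha).
  by apply: cvgM; [exact: Lc|exact: cvg_cst].
apply: cvg_trans H; apply: near_eq_cvg; near=> u.
have u0 : 0 < u by near: u; exact: nbhs_pinfty_gt.
rewrite /tail !tE ?mulr_gt0//= powRM ?ltW// invfM.
have := L0 u u0; have : 0 < u `^ (- alpha) by rewrite powR_gt0.
move: (u `^ _) (L u) => x y x0 y0; field.
by rewrite !gt_eqF.
Unshelve. all: by end_near. Qed.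

Lemma tail_small e : 0 < e -> exists2 u, 0 < u & tail u <= e.
Proof.
move=> e0; pose F n := [set y : R | n.+1%:R <= `|y|].
have := @nonincreasing_cvg_mu _ _ _ nu F.
have mF n : measurable (F n) by exact: measurable_absge.
have F0 : \bigcap_n F n = set0.
  apply/seteqP; split=> y //= H; have := H (Num.Def.archi_bound `|y|) I.
  rewrite /F /= leNgt => /negP; apply; apply: lt_trans (archi_boundP (normr_ge0 y)) _.
  by rewrite ltr_nat.
rewrite F0 measure0 => /(_ _ mF measurable0 _) H.
have {H} : nu \o F @ \oo --> 0%E.
  apply: H; first by rewrite ltey_eq fin_num_measure.
  by move=> n m nm; apply/subsetPset => y; rewrite /F /=; apply: le_trans; rewrite ler_nat.
move=> /fine_cvg /cvgrPdist_le /(_ e e0) /filter_ex[n].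
rewrite sub0r normrN /= => H; exists n.+1%:R => //.
exact: le_trans (ler_norm _) H.
Qed.

Lemma positive_ratio : fine (nu [set y : R | t < y]) / open_tail t @[t --> +oo] --> theta.
Proof. by have [_] := heavy. Qed.

Lemma open_tail_split u : 0 <= u ->
  open_tail u = fine (nu [set y : R | u < y]) + fine (nu [set y : R | u < - y]).
Proof.
move=> u0; have mN : measurable [set y : R | u < - y].
  rewrite (_ : [set y : R | u < - y] = [set y | y < - u]); first exact: measurable_lt.
  by apply/seteqP; split=> y /=; rewrite ltrNr.
rewrite -fineD ?fin_num_measure//; [|exact: measurable_gt].
rewrite -measureU//; [|exact: measurable_gt|]; last first.
  by apply/seteqP; split=> y //= [uy]; rewrite ltrNr => yu; lra.
congr (fine (nu _)); apply/seteqP; split=> y /=.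
  by case: (ger0P y) => _ ?; [left|right].
by case=> uy; rewrite (lt_le_trans uy)// ?ler_norm// -normrN ler_norm.
Qed.

(** The tail may jump at the quantile, where n times the tail need not be 1; control is available
    strictly on either side only. *)
Lemma quantile_tail_le n u : (1 < n)%N -> tail_quantile nu n < u -> tail u <= n%:R^-1.
Proof.
move=> n1; rewrite /tail_quantile; set S := [set _ | _].
have n0 : 0 < n%:R^-1 :> R by rewrite invr_gt0 ltr0n (ltn_trans _ n1).
have toS v : tail v <= n%:R^-1 -> S v.
  by move=> H; rewrite /S /= -(fineK (fin_num_measure nu _ (measurable_absge v))) lee_fin.
have [v0 _ /toS Sv0] := tail_small n0.
move=> /(inf_lt (ex_intro _ _ Sv0))[v Sv vu]; apply: le_trans (tail_homo (ltW vu)) _.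
by move: Sv; rewrite /S /= -(fineK (fin_num_measure nu _ (measurable_absge v))) lee_fin.
Qed.

Lemma quantile_tail_gt n u : (1 < n)%N -> u < tail_quantile nu n -> n%:R^-1 < tail u.
Proof.
move=> n1 un; rewrite ltNge; apply/negP => H; move: un; rewrite ltNge => /negP; apply.
apply: ge_inf; last by rewrite /= -(fineK (fin_num_measure nu _ (measurable_absge u))) lee_fin.
exists 0 => v /=; rewrite -(fineK (fin_num_measure nu _ (measurable_absge v))) lee_fin -/(tail v) => vn.
rewrite leNgt; apply/negP => v0.
have : tail v = 1.
  rewrite /tail (_ : [set y : R | _] = setT) ?probability_setT//.
  by apply/seteqP; split=> y //= _; rewrite (le_trans (ltW v0)).
move: vn => /[swap] ->; rewrite leNgt invf_lt1 ?ltr1n ?n1// ltr0n.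
by apply: ltn_trans n1.
Qed.

Section quantile_scale.
Variable n : nat -> nat.
Hypothesis n_infty : forall X : R, \forall N \near \oo, X <= (n N)%:R.
Let t N := tail_quantile nu (n N).

Let n1 : \forall N \near \oo, (1 < n N)%N.
Proof.
by apply: filterS (n_infty 2) => N; rewrite (ler_nat _ 2).
Qed.

Lemma quantile_infty : t N @[N --> \oo] --> +oo.
Proof.
apply/cvgryPge => X; pose Y := Num.max X 1.
have Y0 : 0 < Y by rewrite lt_max ltr01 orbT.
near=> N; apply: (@le_trans _ _ Y); first by rewrite le_max lexx.
rewrite leNgt; apply/negP => /quantile_tail_le H.
have {}H : tail Y <= (n N)%:R^-1 by apply: H; near: N; exact: n1.
have X1 : 1 + (tail Y)^-1 <= (n N)%:R by near: N; exact: n_infty.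
have p0 : 0 < (tail Y)^-1 by rewrite invr_gt0 tail_gt0.
have : (n N)%:R <= (tail Y)^-1.
  by rewrite -[leLHS]invrK lef_pV2 ?posrE ?tail_gt0// invr_gt0; lra.
by lra.
Unshelve. all: by end_near. Qed.

Lemma near_quantile_gt (X : R) : \forall N \near \oo, X < t N.
Proof. by have := quantile_infty; move/cvgryPgt => /(_ X). Qed.

Lemma cvg_scaled_quantile c : 0 < c -> c * t N @[N --> \oo] --> +oo.
Proof.
move=> c0; apply/cvgryPge => X; apply: filterS (near_quantile_gt (X / c)) => N.
by rewrite ltr_pdivrMr// mulrC => /ltW.
Qed.

Lemma tail_ratio_quantile c c' : 0 < c -> 0 < c' ->
  tail (c * t N) / tail (c' * t N) @[N --> \oo] --> (c / c') `^ (- alpha).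
Proof.
move=> c0 c'0; have cc : 0 < c / c' by rewrite divr_gt0.
have := cvg_comp _ _ (cvg_scaled_quantile c'0) (tail_ratio cc).
apply: cvg_trans; apply: near_eq_cvg; apply: nearW => N /=.
by rewrite mulrA divfK ?gt_eqF.
Qed.

Let scale_exists (e : R) : 0 < e -> exists2 b : R, 1 < b & b `^ alpha = 1 + e.
Proof.
move=> e0; exists ((1 + e) `^ alpha^-1); last first.
  by rewrite -powRrM mulVf ?gt_eqF// powRr1//; lra.
rewrite /powR gt_eqF; last by lra.
by rewrite expR_gt1 mulr_gt0 ?invr_gt0 ?ln_gt0//; lra.
Qed.

Let powN_scale (b c : R) : 0 < b -> 0 < c -> (c * b) `^ (- alpha) = c `^ (- alpha) / b `^ alpha /\
  (c / b) `^ (- alpha) = c `^ (- alpha) * b `^ alpha.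
Proof.
move=> b0 c0; split; rewrite powRM ?invr_ge0 ?ltW//; first by rewrite [b `^ _]powRN.
congr (_ * _); rewrite powRN /powR !gt_eqF ?invr_gt0// lnV ?posrE//.
by rewrite mulrN expRN invrK.
Qed.

(** For b > 1, 1 / n lies between the tails at b t and at t / b. Regular variation gives the limits
    of the two resulting ratios, and b is taken close to 1. *)
Lemma cvg_tail c : 0 < c -> (n N)%:R * tail (c * t N) @[N --> \oo] --> c `^ (- alpha).
Proof.
move=> c0; set l := c `^ (- alpha); have l0 : 0 < l by rewrite powR_gt0.
apply: cvg_sandwich => e e0.
have el0 : 0 < e / l by rewrite divr_gt0.
(* With b^alpha = 1 + e / l the upper limit is l + e, and the lower limit l / (1 + e / l) is at
   least l - e. *)
have [b b1 bE] := scale_exists el0; have b0 : 0 < b by lra.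
have [E1 E2] := powN_scale b0 c0.
exists (fun N => tail (c * t N) / tail (b^-1 * t N)), (fun N => tail (c * t N) / tail (b * t N)).
exists ((c / b^-1) `^ (- alpha)), ((c / b) `^ (- alpha)).
split; [by apply: tail_ratio_quantile; rewrite ?invr_gt0|exact: tail_ratio_quantile| | |].
- near=> N; have t0 : 0 < t N by near: N; exact: near_quantile_gt.
  have nN : (1 < n N)%N by near: N; exact: n1.
  have nN0 : 0 < (n N)%:R :> R by rewrite ltr0n (ltn_trans _ nN).
  have G1 : (n N)%:R^-1 < tail (b^-1 * t N).
    by apply: quantile_tail_gt => //; rewrite ltr_pdivrMl// ltr_pMl.
  have G2 : tail (b * t N) <= (n N)%:R^-1 by apply: quantile_tail_le => //; rewrite ltr_pMl.
  have G0 : 0 < tail (b * t N) by rewrite tail_gt0// mulr_gt0.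
  apply/andP; split.
    rewrite [leRHS]mulrC ler_wpM2l ?tail_ge0// -[leRHS]invrK lef_pV2 ?posrE ?invr_gt0// ?ltW//.
    by apply: lt_trans G1; rewrite invr_gt0.
  rewrite mulrC ler_wpM2l ?tail_ge0//.
  by rewrite -[leLHS]invrK lef_pV2 ?posrE ?invr_gt0.
- rewrite invrK E1 bE -/l ler_pdivlMr; last by rewrite addr_gt0.
  have : 0 <= e * (e / l) by rewrite mulr_ge0 ?ltW.
  have : l * (e / l) = e by rewrite mulrCA mulfV ?mulr1 ?gt_eqF.
  by move: (e / l) => z; nra.
- by rewrite E2 bE -/l mulrDr mulr1 mulrCA mulfV ?mulr1// gt_eqF.
Unshelve. all: by end_near. Qed.

(** An open tail lies between closed tails at levels c b t and c t, with b as close to 1 as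
    desired. *)
Lemma cvg_open_tail c : 0 < c -> (n N)%:R * open_tail (c * t N) @[N --> \oo] --> c `^ (- alpha).
Proof.
move=> c0; set l := c `^ (- alpha); have l0 : 0 < l by rewrite powR_gt0.
apply: cvg_sandwich => e e0.
have el0 : 0 < e / l by rewrite divr_gt0.
have [b b1 bE] := scale_exists el0; have b0 : 0 < b by lra.
have [E1 _] := powN_scale b0 c0.
exists (fun N => (n N)%:R * tail (c * b * t N)), (fun N => (n N)%:R * tail (c * t N)).
exists ((c * b) `^ (- alpha)), l.
split; [by apply: cvg_tail; rewrite mulr_gt0|exact: cvg_tail| | |by rewrite lerDl ltW].
- near=> N; have t0 : 0 < t N by near: N; exact: near_quantile_gt.
  rewrite !ler_wpM2l ?open_tail_le//; apply: open_tail_ge.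
  by rewrite -mulrA ltr_pM2l// ltr_pMl.
- rewrite E1 bE -/l ler_pdivlMr; last by rewrite addr_gt0.
  have : 0 <= e * (e / l) by rewrite mulr_ge0 ?ltW.
  have : l * (e / l) = e by rewrite mulrCA mulfV ?mulr1 ?gt_eqF.
  by move: (e / l) => z; nra.
Unshelve. all: by end_near. Qed.

Lemma cvg_positive_tail c : 0 < c ->
  (n N)%:R * fine (nu [set y : R | c * t N < y]) @[N --> \oo] --> theta * c `^ (- alpha).
Proof.
move=> c0.
have H : fine (nu [set y | c * t N < y]) / open_tail (c * t N) * ((n N)%:R * open_tail (c * t N))
    @[N --> \oo] --> theta * c `^ (- alpha).
  apply: cvgM (cvg_open_tail c0).
  exact: (cvg_comp _ _ (cvg_scaled_quantile c0) positive_ratio).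
apply: cvg_trans H; apply: near_eq_cvg; near=> N => /=.
have t0 : 0 < t N by near: N; exact: near_quantile_gt.
have G0 : 0 < open_tail (c * t N).
  apply: lt_le_trans (open_tail_ge (v := 2 * (c * t N)) _); first by rewrite tail_gt0// !mulr_gt0.
  by rewrite ltr_pMl ?mulr_gt0// ltr1n.
rewrite mulrCA; congr (_ * _); rewrite divfK// gt_eqF//.
Unshelve. all: by end_near. Qed.

Lemma cvg_negative_tail c : 0 < c ->
  (n N)%:R * fine (nu [set y : R | c * t N < - y]) @[N --> \oo] --> (1 - theta) * c `^ (- alpha).
Proof.
move=> c0; rewrite mulrBl mul1r.
have H : (n N)%:R * open_tail (c * t N) - (n N)%:R * fine (nu [set y | c * t N < y])
    @[N --> \oo] --> c `^ (- alpha) - theta * c `^ (- alpha).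
  exact: cvgB (cvg_open_tail c0) (cvg_positive_tail c0).
apply: cvg_trans H; apply: near_eq_cvg; near=> N => /=.
have t0 : 0 < t N by near: N; exact: near_quantile_gt.
by rewrite open_tail_split ?mulr_ge0 ?ltW//; ring.
Unshelve. all: by end_near. Qed.

End quantile_scale.
End regular_variation.

(** * Karamata's bound for the truncated second moment *)

Section truncated_second_moment.
Context {R : realType} (nu : probability R R) (alpha theta : R).
Hypothesis alpha02 : 0 < alpha < 2.
Hypothesis heavy : heavy_tailed alpha theta nu.

Let a0 : 0 < alpha. Proof. by case/andP: alpha02. Qed.

Definition clip (v y : R) : R := if `|y| <= v then y else 0.

Lemma bdm_clip v : bdm (clip v : R -> R).
Proof.
split; last first.
  exists `|v| => y; rewrite /clip; case: ifP => [yv|_]; last by rewrite normr0.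
  exact: le_trans (ler_norm v).
have -> : clip v = fun y => \1_[set y | `|y| <= v] y * y.
  apply/funext => y; rewrite /clip indicE; case: ifPn => H.
    by rewrite mem_set// mul1r.
  by rewrite memNset ?mul0r//; exact/negP.
apply: measurable_funM; last exact: measurable_id.
apply: measurable_indic.
rewrite (_ : [set y : R | _] = ~` [set y | v < `|y|]); first by apply: measurableC; exact: measurable_absgt.
by apply/seteqP; split=> y /=; rewrite leNgt => /negP.
Qed.

Definition second_moment v : R := \int[nu]_y (clip v y ^+ 2).

Lemma second_moment_double v : 0 <= v ->
  second_moment (2 * v) <= second_moment v + 4 * v ^+ 2 * tail nu v.
Proof.
move=> v0; rewrite /tail -integral_indic1; last exact: measurable_absge.
have b1 := bdmX 2 (bdm_clip (2 * v)); have b2 := bdmX 2 (bdm_clip v).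
have b3 := bdm_indic (measurable_absge v).
rewrite -integral_bdmZ// -integral_bdmD//; last exact: bdmZ.
apply: le_integral_bdm => //; first by apply: bdmD => //; exact: bdmZ.
move=> y; rewrite /clip indicE; case: (leP `|y| v) => yv.
  rewrite ifT; last by rewrite (le_trans yv)// ler_peMl// ler1n.
  by rewrite lerDl mulr_ge0// mulr_ge0// sqr_ge0.
rewrite mem_set; last exact: ltW.
case: ifP => yv2; rewrite expr0n add0r mulr1; last by rewrite mulr_ge0// sqr_ge0.
rewrite -real_normK ?num_real// (_ : 4 * v ^+ 2 = (2 * v) ^+ 2); last by ring.
by rewrite ler_sqr// nnegrE mulr_ge0.
Qed.

Lemma second_moment_homo u v : u <= v -> second_moment u <= second_moment v.
Proof.
move=> uv; apply: le_integral_bdm; [exact/bdmX/bdm_clip|exact/bdmX/bdm_clip|move=> y].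
rewrite /clip; case: ifP => yu; first by rewrite (le_trans yu uv).
by rewrite expr0n sqr_ge0.
Qed.

(** A weak form of Karamata's theorem. For large v, doubling v multiplies v^2 [tail nu v] by at
    least 4 rho > 1, while the truncated second moment gains at most 4 v^2 [tail nu v]; a dyadic
    induction closes for K large. *)
Lemma second_moment_bound : exists K X, [/\ 0 < K, 0 < X &
  forall v, X <= v -> second_moment v <= K * v ^+ 2 * tail nu v].
Proof.
have [_ a2] := andP alpha02.
have r4 : 4^-1 < 2 `^ (- alpha) :> R.
  rewrite (_ : 4^-1 = 2 `^ (-2%:R)); last first.
    by rewrite powRN powR_mulrn// -natrX.
  by rewrite /powR gt_eqF ?ltr0n// ltr_expR ltr_pM2r ?ln_gt0 ?ltr1n// ltrN2.
(* A rate strictly between 1/4 and 2^-alpha, which are in this order because alpha < 2. *)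
pose rho := (4^-1 + 2 `^ (- alpha)) / 2 : R.
have rho1 : 4^-1 < rho by rewrite /rho; lra.
have rho2 : rho < 2 `^ (- alpha) by rewrite /rho; lra.
have rho0 : 0 < rho by lra.
have := tail_ratio heavy (ltr0n R 2); move=> /cvgr_gt/(_ rho rho2)[X0 [_ HX]].
pose X := Num.max X0 0 + 1.
have X0X : X0 < X by rewrite /X ltr_pwDr// le_max lexx.
have Xp : 0 < X by rewrite /X ltr_pwDr// le_max lexx orbT.
have ratio u : X <= u -> rho * tail nu u <= tail nu (2 * u).
  move=> Xu; have u0 := lt_le_trans Xp Xu.
  have := HX u (lt_le_trans X0X Xu); rewrite ltr_pdivlMr ?(tail_gt0 heavy)//.
  exact: ltW.
have tX : 0 < tail nu (2 * X) by rewrite (tail_gt0 heavy)// mulr_gt0.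
(* The first bound starts the induction on [X, 2 X]; the second says K / 4 + 1 <= K rho. *)
pose K := Num.max (second_moment (2 * X) / (X ^+ 2 * tail nu (2 * X))) (rho - 4^-1)^-1.
have K1 : second_moment (2 * X) <= K * (X ^+ 2 * tail nu (2 * X)).
  by rewrite -ler_pdivrMr ?mulr_gt0 ?exprn_gt0// le_max lexx.
have K2 : 1 <= K * (rho - 4^-1).
  by rewrite -ler_pdivrMr ?subr_gt0// mul1r le_max lexx orbT.
have K0 : 0 < K by rewrite lt_max invr_gt0 subr_gt0 rho1 orbT.
have base v : X <= v -> v <= 2 * X -> second_moment v <= K * v ^+ 2 * tail nu v.
  move=> Xv vX; apply: le_trans (second_moment_homo vX) _; apply: le_trans K1 _.
  rewrite -mulrA ler_wpM2l ?(ltW K0)// ler_pM ?sqr_ge0 ?tail_ge0 ?tail_homo//.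
  by rewrite ler_sqr ?nnegrE ?(ltW Xp)// (le_trans (ltW Xp)).
exists K, X; split => // v Xv.
suff H k : forall v, X <= v -> v <= 2 ^+ k * (2 * X) -> second_moment v <= K * v ^+ 2 * tail nu v.
  apply: (H (Num.Def.archi_bound (v / (2 * X)))) => //.
  have vX0 : 0 <= v / (2 * X) by rewrite divr_ge0 ?mulr_ge0 ?(ltW Xp)// (le_trans (ltW Xp)).
  rewrite -ler_pdivrMr ?mulr_gt0//; apply: le_trans (ltW (archi_boundP vX0)) _.
  by rewrite -natrX ler_nat ltnW// ltn_expl.
elim: k => [|k IH] {Xv}{}v Xv vk; first by apply: base => //; rewrite expr0 mul1r in vk.
have [vX|Xv2] := leP v (2 * X); first exact: base.
have Xv' : X <= v / 2 by lra.
have v0 : 0 <= v / 2 by lra.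
have v2 : 2 * (v / 2) = v by lra.
have IHv := IH (v / 2) Xv' _.
have {}IHv : second_moment (v / 2) <= K * (v / 2) ^+ 2 * tail nu (v / 2).
  by apply: IHv; move: vk; rewrite exprS; lra.
have := second_moment_double v0; rewrite v2 => D; apply: le_trans D _.
have rv := ratio _ Xv'; rewrite v2 in rv.
apply: (@le_trans _ _ ((K / 4 + 1) * v ^+ 2 * tail nu (v / 2))).
  move: IHv; set g := tail _ _; set U := second_moment _; rewrite expr_div_n => IHv.
  have : K * (v ^+ 2 / 2 ^+ 2) * g = K / 4 * v ^+ 2 * g by field.
  have : 4 * (v ^+ 2 / 2 ^+ 2) * g = v ^+ 2 * g by field.
  by lra.
apply: (@le_trans _ _ (K * rho * v ^+ 2 * tail nu (v / 2))).
  rewrite ler_wpM2r ?tail_ge0// ler_wpM2r ?sqr_ge0//; lra.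
rewrite (_ : K * rho * _ * _ = K * v ^+ 2 * (rho * tail nu (v / 2))); last by ring.
by rewrite ler_wpM2l// mulr_ge0 ?sqr_ge0 ?(ltW K0).
Qed.

End truncated_second_moment.

(** * Truncated moments on one half-line *)

Section one_sided_moments.
Context {R : realType} (nu : probability R R) (alpha : R) (g : R -> R).
Hypothesis (alpha02 : 0 < alpha < 2).
Hypothesis (mg : measurable_fun setT g) (gE : forall y, `|g y| = `|y|).

(** g is to be the identity or the opposite, so that one treatment serves both half-lines; t is the
    scale, and b the truncation level in units of t. *)
Definition part (t b : R) (m : nat) (y : R) : R :=
  if 0 < g y <= b * t then (g y / t) ^+ m else 0.

Definition side_tail (u : R) : R := fine (nu [set y | u < g y]).

Lemma measurable_side u : measurable [set y | u < g y].
Proof.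
rewrite (_ : [set y : R | _] = g @^-1` `]u, +oo[%classic); last first.
  by apply/seteqP; split=> y /=; rewrite in_itv/= andbT.
by rewrite -[X in measurable X]setTI; exact: mg.
Qed.

Lemma part_ge0 t b m y : 0 < t -> 0 <= part t b m y.
Proof.
by move=> t0; rewrite /part; case: ifP => // /andP[g0 _]; rewrite exprn_ge0// divr_ge0// ltW.
Qed.

Lemma bdm_part t b m : 0 < t -> 0 <= b -> bdm (part t b m : R -> R).
Proof.
move=> t0 b0; split; last first.
  exists (b ^+ m) => y; rewrite ger0_norm ?part_ge0// /part.
  case: ifP => [/andP[g0 gb]|_]; last by rewrite exprn_ge0.
  by rewrite lerXn2r ?nnegrE ?divr_ge0 ?(ltW g0) ?(ltW t0)// ler_pdivrMr.
have -> : part t b m = fun y => (\1_[set y | 0 < g y] y - \1_[set y | Num.max 0 (b * t) < g y] y) * (g y / t) ^+ m.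
  apply/funext => y; rewrite /part !indicE.
  have bt : 0 <= b * t by rewrite mulr_ge0// ltW.
  rewrite (max_r bt); case: (ltP 0 (g y)) => g0 /=; last first.
    rewrite !memNset ?subrr ?mul0r//=; apply/negP; rewrite -leNgt//.
    exact: le_trans bt.
  rewrite (mem_set (A := [set y | 0 < g y]))//; case: (leP (g y) (b * t)) => gb.
    by rewrite memNset ?subr0 ?mul1r//=; apply/negP; rewrite -leNgt.
  by rewrite mem_set// subrr mul0r.
apply: measurable_funM; last first.
  by apply: measurable_funX; apply: measurable_funM => //; exact: measurable_cst.
by apply: measurable_funB; apply: measurable_indic; exact: measurable_side.
Qed.

Lemma part_step t b b' m : 0 < t -> 0 < b' <= b ->
  b' ^+ m * (side_tail (b' * t) - side_tail (b * t)) <=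
    \int[nu]_y part t b m y - \int[nu]_y part t b' m y <=
  b ^+ m * (side_tail (b' * t) - side_tail (b * t)).
Proof.
move=> t0 /andP[b'0 bb]; have b0 := lt_le_trans b'0 bb.
have p1 := bdm_part m t0 (ltW b0); have p2 := bdm_part m t0 (ltW b'0).
have i1 : bdm (\1_[set y | b * t < g y] : R -> R) by apply: bdm_indic; exact: measurable_side.
have i2 : bdm (\1_[set y | b' * t < g y] : R -> R) by apply: bdm_indic; exact: measurable_side.
have i12 := bdmB i2 i1.
rewrite /side_tail -!integral_indic1; [|exact: measurable_side|exact: measurable_side].
rewrite -!integral_bdmB// -!integral_bdmZ//.
have E y : exists z : R, [/\ part t b m y - part t b' m y = z * (g y / t) ^+ m,
    \1_[set y | b' * t < g y] y - \1_[set y | b * t < g y] y = z, 0 <= z &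
    z != 0 -> b' * t < g y <= b * t].
  have bt : b' * t <= b * t by rewrite ler_pM2r.
  have bt0 : 0 < b' * t by rewrite mulr_gt0.
  rewrite /part !indicE; case: (leP (g y) (b' * t)) => gb'.
    have gb := le_trans gb' bt; rewrite gb !memNset /=; try by apply/negP; rewrite -leNgt.
    by exists 0; rewrite !subrr mul0r eqxx.
  have g0 := lt_trans bt0 gb'; rewrite g0 /= (mem_set (A := [set y | b' * t < g y]))//.
  case: (leP (g y) (b * t)) => gb.
    rewrite memNset; last by apply/negP; rewrite -leNgt.
    by exists 1; rewrite !subr0 mul1r ler01.
  by exists 0; rewrite mem_set// !subrr mul0r eqxx.
apply/andP; split; apply: le_integral_bdm; try exact: bdmB; try exact: bdmZ; move=> y.
  have [z [-> -> z0 H1]] := E y.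
  have [->|/H1/andP[lb ub]] := eqVneq z 0; first by rewrite mulr0 mul0r.
  rewrite mulrC ler_wpM2l// lerXn2r ?nnegrE ?(ltW b'0)//.
    by rewrite divr_ge0 ?(ltW t0)// (le_trans _ (ltW lb))// mulr_ge0 ?(ltW t0) ?(ltW b'0).
  by rewrite ler_pdivlMr// ltW.
have [z [-> -> z0 H1]] := E y.
have [->|/H1/andP[lb ub]] := eqVneq z 0; first by rewrite mulr0 mul0r.
rewrite [leRHS]mulrC ler_wpM2l// lerXn2r ?nnegrE ?(ltW b0)//.
  by rewrite divr_ge0 ?(ltW t0)// (le_trans _ (ltW lb))// mulr_ge0 ?(ltW t0) ?(ltW b'0).
by rewrite ler_pdivrMr.
Qed.

(** Near 0 a power m >= 2 is reduced to the square, to which Karamata's bound applies. *)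
Lemma part_tail t b m : 0 < t -> 0 < b -> (2 <= m)%N ->
  0 <= \int[nu]_y part t b m y <= b ^+ (m - 2) * (second_moment nu (b * t) / t ^+ 2).
Proof.
move=> t0 b0 m2; rewrite integral_bdm_ge0 => [/=|y]; last exact: part_ge0.
rewrite (_ : _ * _ = b ^+ (m - 2) / t ^+ 2 * second_moment nu (b * t)); last by ring.
have bc := bdmX 2 (bdm_clip (b * t)).
rewrite -integral_bdmZ//; apply: le_integral_bdm; [exact: (bdm_part m t0 (ltW b0))|exact: bdmZ|move=> y].
have n0 : 0 <= b ^+ (m - 2) / t ^+ 2 by rewrite divr_ge0 ?exprn_ge0 ?(ltW b0) ?(ltW t0).
rewrite /part /clip; case: ifP => [/andP[g0 gb]|_]; last by rewrite mulr_ge0 ?sqr_ge0.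
rewrite -gE ger0_norm ?(ltW g0)// gb -(real_normK (num_real y)) -gE ger0_norm ?(ltW g0)//.
rewrite -{1}(subnK m2) exprD (expr_div_n _ _ 2) mulrA [leRHS]mulrAC.
rewrite ler_wpM2r ?invr_ge0 ?exprn_ge0 ?(ltW t0)// ler_wpM2r ?sqr_ge0//.
by rewrite lerXn2r ?nnegrE ?divr_ge0 ?(ltW b0) ?(ltW g0) ?(ltW t0)// ler_pdivrMr.
Qed.

Section limit.
Variables (n t : nat -> R) (kappa B K : R) (m : nat).
Hypotheses (B0 : 0 < B) (K0 : 0 <= K) (kappa0 : 0 <= kappa) (m2 : (2 <= m)%N).
Hypotheses (n0 : forall N, 0 <= n N) (t0 : \forall N \near \oo, 0 < t N).
Hypothesis cvg_side : forall c, 0 < c ->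
  n N * side_tail (c * t N) @[N --> \oo] --> kappa * c `^ (- alpha).
Hypothesis second_moment_le : forall b, 0 < b ->
  exists2 s : nat -> R, s N @[N --> \oo] --> K * b ^+ 2 * b `^ (- alpha) &
  \forall N \near \oo, n N * (second_moment nu (b * t N) / t N ^+ 2) <= s N.

Let am : alpha < m%:R.
Proof. by case/andP: alpha02 => _ a2; apply: lt_le_trans a2 _; rewrite (ler_nat _ 2). Qed.

Section slices.
Variable h : R.
Hypothesis h0 : 0 < h.
Let b j := B * expR (- h) ^+ j.

Let b_gt0 j : 0 < b j. Proof. by rewrite mulr_gt0// exprn_gt0// expR_gt0. Qed.
Let b_le j : b j.+1 <= b j.
Proof.
by rewrite /b exprS mulrCA ler_piMl ?(ltW (b_gt0 j))// ltW// expR_lt1 oppr_lt0.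
Qed.
Let b_powR j : b j `^ (- alpha) = B `^ (- alpha) * expR (alpha * h) ^+ j.
Proof.
rewrite powRM ?exprn_ge0 ?expR_ge0 ?(ltW B0)//; congr (_ * _).
by rewrite -!expRM_natl /powR gt_eqF ?expR_gt0// expRK; congr expR; ring.
Qed.

Let mass N j := n N * side_tail (b j.+1 * t N) - n N * side_tail (b j * t N).

Definition slice_total J : R := B `^ (- alpha) * (expR (alpha * h) - 1) *
    \sum_(j < J) (expR (alpha * h) ^+ j * (B * expR (- h) ^+ j) `^ m%:R).

Let cvg_mass (w : nat -> R) J : \sum_(j < J) w j * mass N j @[N --> \oo] -->
  kappa * (B `^ (- alpha) * (expR (alpha * h) - 1) * \sum_(j < J) (expR (alpha * h) ^+ j * w j)).
Proof.
have -> : kappa * (B `^ (- alpha) * (expR (alpha * h) - 1) * \sum_(j < J) (expR (alpha * h) ^+ j * w j)) =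
    \sum_(j < J) w j * (kappa * b j.+1 `^ (- alpha) - kappa * b j `^ (- alpha)).
  rewrite mulrA mulr_sumr; apply: eq_bigr => j _; rewrite !b_powR exprS; ring.
apply: cvg_sum_seq => j; apply: cvgM; first exact: cvg_cst.
by apply: cvgB; exact: cvg_side.
Qed.

(** Limit of the bound for the part below the last level; it is of order (b J)^(m - alpha), hence
    small for large J. *)
Let rest J : R := K * b J ^+ m * b J `^ (- alpha).

Let cvg_rest : rest J @[J --> \oo] --> (0 : R).
Proof.
pose x := expR (- ((m%:R - alpha) * h)).
have E J : rest J = K * B ^+ m * B `^ (- alpha) * x ^+ J.
  have Ex : x = expR (- h) ^+ m * expR (alpha * h).
    by rewrite -expRM_natl -expRD; congr expR; ring.
  by rewrite /rest b_powR Ex !exprMn -!exprM (mulnC J m); ring.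
apply: (cvg_eq E); rewrite -[X in _ --> X](mulr0 (K * B ^+ m * B `^ (- alpha))).
apply: cvgM; first exact: cvg_cst.
apply: cvg_expr; rewrite ger0_norm ?expR_ge0// expR_lt1 oppr_lt0 mulr_gt0// subr_gt0//.
Qed.

(** Stieltjes sums over J geometric slices. Passing from the upper to the lower end of a slice costs
    e^(-h m), the same for all slices; the part near 0 is kept in the upper bound only. *)
Lemma slice_sandwich J : exists (u v : nat -> R),
  [/\ u N @[N --> \oo] --> expR (- h) ^+ m * (kappa * slice_total J),
      v N @[N --> \oo] --> kappa * slice_total J + rest J &
      \forall N \near \oo, u N <= n N * \int[nu]_y part (t N) B m y <= v N].
Proof.
have [s sl sb] := second_moment_le (b_gt0 J).
exists (fun N => \sum_(j < J) b j.+1 ^+ m * mass N j).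
exists (fun N => \sum_(j < J) b j ^+ m * mass N j + b J ^+ (m - 2) * s N).
have Et : slice_total J = B `^ (- alpha) * (expR (alpha * h) - 1) * \sum_(j < J) (expR (alpha * h) ^+ j * b j ^+ m).
  by congr (_ * _); apply: eq_bigr => j _; rewrite powR_mulrn// ltW// b_gt0.
split.
- have -> : expR (- h) ^+ m * (kappa * slice_total J) =
    kappa * (B `^ (- alpha) * (expR (alpha * h) - 1) * \sum_(j < J) (expR (alpha * h) ^+ j * b j.+1 ^+ m)).
    rewrite Et mulrCA; congr (_ * _); rewrite mulrCA; congr (_ * _); rewrite mulr_sumr.
    by apply: eq_bigr => j _; rewrite /b (exprS (expR (- h))) !exprMn; ring.
  exact: (@cvg_mass (fun j => b j.+1 ^+ m) J).
- rewrite Et; apply: cvgD; first exact: (@cvg_mass (fun j => b j ^+ m) J).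
  rewrite /rest (_ : K * _ * _ = b J ^+ (m - 2) * (K * b J ^+ 2 * b J `^ (- alpha))).
    by apply: cvgM => //; exact: cvg_cst.
  by rewrite -{1}(subnK m2) exprD; ring.
- near=> N; have tN : 0 < t N by near: N; exact: t0.
  have tel : \int[nu]_y part (t N) B m y = \sum_(j < J)
      (\int[nu]_y part (t N) (b j) m y - \int[nu]_y part (t N) (b j.+1) m y) + \int[nu]_y part (t N) (b J) m y.
    elim: (J) => [|j IH]; first by rewrite big_ord0 add0r /b expr0 mulr1.
    by rewrite big_ord_recr /= IH; ring.
  rewrite tel mulrDr mulr_sumr.
  have st j := part_step m tN (_ : 0 < b j.+1 <= b j).
  have {}st j : b j.+1 ^+ m * mass N j <=
     n N * (\int[nu]_y part (t N) (b j) m y - \int[nu]_y part (t N) (b j.+1) m y) <= b j ^+ m * mass N j.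
    have /andP[s1 s2] : b j.+1 ^+ m * (side_tail (b j.+1 * t N) - side_tail (b j * t N)) <=
      \int[nu]_y part (t N) (b j) m y - \int[nu]_y part (t N) (b j.+1) m y <=
      b j ^+ m * (side_tail (b j.+1 * t N) - side_tail (b j * t N)) by apply: st => i; rewrite b_gt0 b_le.
    by rewrite /mass -mulrBr !(mulrCA _ (n N)) !ler_wpM2l.
  have /andP[r0 r1] := part_tail tN (b_gt0 J) m2.
  apply/andP; split.
    rewrite ler_wpDr ?mulr_ge0//; apply: ler_sum => j _; by have /andP[] := st j.
  apply: lerD; first by apply: ler_sum => j _; have /andP[] := st j.
  apply: le_trans (ler_wpM2l (n0 N) r1) _; rewrite mulrCA ler_wpM2l ?exprn_ge0 ?(ltW (b_gt0 J))//.
  by near: N; exact: sb.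
Unshelve. all: by end_near. Qed.

Lemma geometric_sandwich (e : R) : 0 < e -> exists (u v : nat -> R) (a c : R),
  [/\ u N @[N --> \oo] --> a, v N @[N --> \oo] --> c,
      \forall N \near \oo, u N <= n N * \int[nu]_y part (t N) B m y <= v N,
      expR (- h) ^+ m * (kappa * (B `^ (m%:R - alpha) * geom_ratio alpha (m%:R - alpha) h)) - e <= a &
      c <= kappa * (B `^ (m%:R - alpha) * geom_ratio alpha (m%:R - alpha) h) + e].
Proof.
move=> e0; set l := kappa * _.
have L : kappa * slice_total J @[J --> \oo] --> l.
  by apply: cvgM; [exact: cvg_cst|exact: geometric_slices].
have L1 : expR (- h) ^+ m * (kappa * slice_total J) @[J --> \oo] --> expR (- h) ^+ m * l.
  by apply: cvgM; [exact: cvg_cst|].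
have L2 : kappa * slice_total J + rest J @[J --> \oo] --> l + 0 by exact: (cvgD L cvg_rest).
move/cvgrPdist_le : L1 => /(_ _ e0) L1; move/cvgrPdist_le : L2 => /(_ _ e0) L2.
have [J [J1 J2]] := filter_ex (filterI L1 L2).
have [u [v [ul vl uv]]] := slice_sandwich J.
exists u, v, (expR (- h) ^+ m * (kappa * slice_total J)), (kappa * slice_total J + rest J).
move: J1 J2; rewrite /= !ler_norml addr0 => /andP[_ j1] /andP[j2 _].
by split=> //; lra.
Qed.

End slices.

(** Limits are taken in N, then J, then h, where the last two only have to bring the bounds within
    e. *)
Theorem cvg_part : n N * \int[nu]_y part (t N) B m y @[N --> \oo] -->
  kappa * (alpha / (m%:R - alpha) * B `^ (m%:R - alpha)).
Proof.
have /andP[a0 a2] := alpha02.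
set l := kappa * _; apply: cvg_sandwich => e e0; have e20 : 0 < e / 2 by rewrite divr_gt0.
pose h (i : nat) : R := i.+1%:R^-1.
pose L i := kappa * (B `^ (m%:R - alpha) * geom_ratio alpha (m%:R - alpha) (h i)).
have L1 : L i @[i --> \oo] --> l.
  rewrite /l [alpha / _ * _]mulrC; apply: cvgM; first exact: cvg_cst.
  apply: cvgM; first exact: cvg_cst.
  by apply: cvg_geom_ratio => //; rewrite subr_gt0.
have L2 : expR (- h i) ^+ m * L i @[i --> \oo] --> 1 * l.
  apply: cvgM => //.
  have Lm : 1 - m%:R * h i @[i --> \oo] --> (1 : R).
    rewrite -[X in _ --> X]subr0 -(mulr0 m%:R); apply: cvgB; first exact: cvg_cst.
    by apply: cvgM; [exact: cvg_cst|exact: cvg_harmonic].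
  apply: (squeeze_cvgr _ Lm (cvg_cst (1 : R))); apply: nearW => i.
  rewrite -expRM_natl; apply/andP; split.
    by rewrite mulrN; exact: expR_ge1Dx.
  by rewrite -[leRHS]expR0 ler_expR mulrN oppr_le0 mulr_ge0// invr_ge0.
move/cvgrPdist_le : L1 => /(_ _ e20) L1; move/cvgrPdist_le : L2 => /(_ _ e20) L2.
have [i [J1 J2]] := filter_ex (filterI L1 L2).
have hi : 0 < h i by rewrite invr_gt0.
have [u [v [a [c [ul vl uv la lc]]]]] := geometric_sandwich hi e20.
exists u, v, a, c; move: J1 J2; rewrite /= !ler_norml mul1r => /andP[j1 _] /andP[_ j2].
rewrite -/(L i) in la lc.
by split=> //; lra.
Qed.

End limit.

End one_sided_moments.

(** * Moments of the centred truncated entry *)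

Section truncated_law.
Context {R : realType} (nu : probability R R) (alpha theta B : R).
Hypothesis alpha02 : 0 < alpha < 2.
Hypothesis heavy : heavy_tailed alpha theta nu.
Hypothesis theta01 : 0 <= theta <= 1.
Hypothesis B0 : 0 < B.
Variable n : nat -> nat.
Hypothesis n_infty : forall X : R, \forall N \near \oo, X <= (n N)%:R.

Let t N := tail_quantile nu (n N).
Let a0 : 0 < alpha. Proof. by case/andP: alpha02. Qed.

Definition truncation N (y : R) : R := (t N)^-1 * clip (B * t N) y.
Definition truncation_mean N : R := \int[nu]_y truncation N y.
Definition truncation_centered N y : R := truncation N y - truncation_mean N.

Lemma bdm_truncation N : bdm (truncation N).
Proof. by apply: bdmZ; exact: bdm_clip. Qed.

Lemma bdm_truncation_centered N : bdm (truncation_centered N).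
Proof. by apply: bdmB; [exact: bdm_truncation|exact: bdm_cst]. Qed.

Let t_gt0 : \forall N \near \oo, 0 < t N.
Proof. exact: (near_quantile_gt heavy n_infty). Qed.

Lemma second_moment_quantile : exists2 K : R, 0 < K & forall b, 0 < b ->
  exists2 s : nat -> R, s N @[N --> \oo] --> K * b ^+ 2 * b `^ (- alpha) &
  \forall N \near \oo, (n N)%:R * (second_moment nu (b * t N) / t N ^+ 2) <= s N.
Proof.
have [K [X [K0 X0 KX]]] := second_moment_bound alpha02 heavy.
exists K => // b b0; exists (fun N => K * b ^+ 2 * ((n N)%:R * tail nu (b * t N))).
  by apply: cvgM; [exact: cvg_cst|exact: (cvg_tail a0 heavy n_infty)].
near=> N; have tN : 0 < t N by near: N; exact: t_gt0.
have bX : X <= b * t N.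
  rewrite mulrC -ler_pdivrMr// ltW//; near: N; exact: (near_quantile_gt heavy n_infty).
rewrite (_ : K * b ^+ 2 * _ = (n N)%:R * (K * (b * t N) ^+ 2 * tail nu (b * t N) / t N ^+ 2)).
  by rewrite ler_wpM2l// ler_wpM2r ?invr_ge0 ?sqr_ge0// KX.
by field; rewrite gt_eqF.
Unshelve. all: by end_near. Qed.

Lemma truncation_pow N m y : 0 < t N -> (0 < m)%N ->
  truncation N y ^+ m = part id (t N) B m y + (-1) ^+ m * part -%R (t N) B m y.
Proof.
move=> tN m0; rewrite /truncation /clip /part /=.
have [y0|y0|->] := ltgtP y 0; last first.
- rewrite oppr0 ltxx /= mulr0 addr0; case: ifP => _; by rewrite mulr0 expr0n gtn_eqF.
- rewrite /= (_ : (0 < - y) = false); last by apply/negbTE; rewrite -leNgt oppr_le0 ltW.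
  rewrite gtr0_norm// mulr0 addr0; case: ifP => _; first by rewrite mulrC.
  by rewrite mulr0 expr0n gtn_eqF.
- rewrite /= oppr_gt0 y0 /= ltr0_norm// add0r; case: ifP => _; last first.
    by rewrite !mulr0 expr0n gtn_eqF.
  by rewrite -exprMn; congr (_ ^+ _); ring.
Qed.

Lemma cvg_truncation_moment m : (2 <= m)%N ->
  (n N)%:R * \int[nu]_y (truncation N y ^+ m) @[N --> \oo] --> stable_moment alpha theta B m.
Proof.
move=> m2; have m0 : (0 < m)%N by apply: leq_trans m2.
have /andP[th0 th1] := theta01; have [K K0 HK] := second_moment_quantile.
have n0 N : 0 <= (n N)%:R :> R by [].
have mN : measurable_fun setT (-%R : R -> R) by apply: continuous_measurable_fun; exact: opp_continuous.
have P1 := @cvg_part R nu alpha id alpha02 (@measurable_id _ _ setT) (fun=> erefl) (fun N => (n N)%:R) t theta B K m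
  B0 m2 n0 t_gt0 (fun c c0 => cvg_positive_tail a0 heavy n_infty c0) HK.
have P2 := @cvg_part R nu alpha -%R alpha02 mN (@normrN _ _) (fun N => (n N)%:R) t (1 - theta) B K m
  B0 m2 n0 t_gt0 (fun c c0 => cvg_negative_tail a0 heavy n_infty c0) HK.
have -> : stable_moment alpha theta B m = theta * (alpha / (m%:R - alpha) * B `^ (m%:R - alpha)) +
    (-1) ^+ m * ((1 - theta) * (alpha / (m%:R - alpha) * B `^ (m%:R - alpha))).
  by rewrite /stable_moment gtn_eqF//; ring.
have P12 : (n N)%:R * \int[nu]_y part id (t N) B m y + (-1) ^+ m * ((n N)%:R * \int[nu]_y part -%R (t N) B m y)
    @[N --> \oo] --> theta * (alpha / (m%:R - alpha) * B `^ (m%:R - alpha)) +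
    (-1) ^+ m * ((1 - theta) * (alpha / (m%:R - alpha) * B `^ (m%:R - alpha))).
  by apply: cvgD; [exact: P1|apply: cvgM; [exact: cvg_cst|exact: P2]].
apply: cvg_trans P12; apply: near_eq_cvg; near=> N.
have tN : 0 < t N by near: N; exact: t_gt0.
have b1 : bdm (part id (t N) B m : R -> R) by apply: bdm_part => //; exact: ltW.
have b2 : bdm (part -%R (t N) B m : R -> R) by apply: bdm_part => //; exact: ltW.
under [in RHS]eq_Rintegral do rewrite truncation_pow//.
by rewrite integral_bdmD ?integral_bdmZ//; [ring|exact: bdmZ].
Unshelve. all: by end_near. Qed.

Lemma sqr_integral_le (f : R -> R) : bdm f -> (\int[nu]_y f y) ^+ 2 <= \int[nu]_y (f y ^+ 2).
Proof.
move=> bf; set m := \int[nu]_y f y.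
have : 0 <= \int[nu]_y (f y ^+ 2 + ((- m *+ 2) * f y + m ^+ 2)).
  apply: integral_bdm_ge0 => y; rewrite (_ : _ + _ = (f y - m) ^+ 2) ?sqr_ge0//; ring.
rewrite integral_bdmD; [|exact: bdmX|by apply: bdmD; [exact: bdmZ|exact: bdm_cst]].
rewrite integral_bdmD; [|exact: bdmZ|exact: bdm_cst].
rewrite integral_bdmZ// integral_cst1 -/m; set J := \int[nu]_y _.
rewrite (_ : _ + _ = J - m ^+ 2) ?subr_ge0//; ring.
Qed.

(** Split at the level e t: above it the scaled value is at most B, below it the Cauchy-Schwarz
    inequality is used. *)
Lemma truncation_mean_le N e : 0 < t N -> 0 < e ->
  truncation_mean N ^+ 2 <= 2 * (B * open_tail nu (e * t N)) ^+ 2 +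
    2 * (second_moment nu (e * t N) / t N ^+ 2).
Proof.
move=> tN e0; set W : R -> R := fun y => (t N)^-1 * clip (e * t N) y.
have bW : bdm W by apply: bdmZ; exact: bdm_clip.
have bI : bdm (\1_[set y : R | e * t N < `|y|] : R -> R) by apply: bdm_indic; exact: measurable_absgt.
have -> : second_moment nu (e * t N) / t N ^+ 2 = \int[nu]_y (`|W y| ^+ 2).
  rewrite /second_moment mulrC -integral_bdmZ; last exact/bdmX/bdm_clip.
  by apply: eq_Rintegral => y _; rewrite real_normK ?num_real// exprMn exprVn.
have -> : open_tail nu (e * t N) = \int[nu]_y (\1_[set y : R | e * t N < `|y|] y).
  by rewrite integral_indic1//; exact: measurable_absgt.
have h : `|truncation_mean N| <= B * \int[nu]_y (\1_[set y : R | e * t N < `|y|] y) + \int[nu]_y `|W y|.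
  rewrite -integral_bdmZ// -integral_bdmD; [|exact: bdmZ|exact: bdm_norm].
  rewrite (le_trans (le_normr_Rintegral _ (bdm_integrable nu (bdm_truncation N))))//.
  apply: le_integral_bdm; [exact/bdm_norm/bdm_truncation|by apply: bdmD; [exact: bdmZ|exact: bdm_norm]|move=> y].
  rewrite indicE /truncation /W /clip; case: (leP `|y| (e * t N)) => ye.
    rewrite memNset; last by apply/negP; rewrite -leNgt.
    by rewrite mulr0 add0r; case: ifP => // _; rewrite mulr0 normr0.
  rewrite mem_set//= mulr1 mulr0 normr0 addr0; case: ifP => [yB|_]; last by rewrite mulr0 normr0 ltW.
  by rewrite normrM gtr0_norm ?invr_gt0// ler_pdivrMl// mulrC.
have Wsq := sqr_integral_le (bdm_norm bW).
move: h Wsq; set x := B * _; set z := \int[nu]_y `|W y|; set J := \int[nu]_y _ => h Wsq.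
rewrite -(real_normK (num_real (truncation_mean N))).
apply: (@le_trans _ _ ((x + z) ^+ 2)).
  by rewrite lerXn2r ?nnegrE// (le_trans _ h).
by have := sqr_ge0 (x - z); nra.
Qed.

Let cvg_invn : (n N)%:R^-1 @[N --> \oo] --> (0 : R).
Proof.
apply/cvgrPdist_le => e e0; near=> N; have nN : e^-1 + 1 <= (n N)%:R by near: N; exact: n_infty.
have e1 : 0 < e^-1 by rewrite invr_gt0.
rewrite sub0r normrN ger0_norm ?invr_ge0// -[leRHS]invrK lef_pV2 ?posrE//; last by lra.
by lra.
Unshelve. all: by end_near. Qed.

(** The mean itself need not be o(1/n), but its square is: values above x t contribute order n n^-2,
    those below at most 2 K x^(2 - alpha) in the limit. *)
Lemma cvg_truncation_mean_sqr : (n N)%:R * truncation_mean N ^+ 2 @[N --> \oo] --> (0 : R).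
Proof.
have /andP[_ a2] := alpha02.
have [K K0 HK] := second_moment_quantile; apply: cvg_sandwich => e e0.
(* Solves 2 K x^(2 - alpha) = e. *)
pose x := (e / (2 * K)) `^ ((2 - alpha)^-1).
have ek0 : 0 < e / (2 * K) by rewrite divr_gt0// mulr_gt0.
have x0 : 0 < x by rewrite powR_gt0.
have xE : x ^+ 2 * x `^ (- alpha) = e / (2 * K).
  rewrite -powR_mulrn ?(ltW x0)// -powRD; last by rewrite (gt_eqF x0) implybT.
  by rewrite -powRrM mulVf ?powRr1 ?(ltW ek0)// subr_eq0 gt_eqF.
have [s sl sb] := HK x x0.
pose ot N := (n N)%:R * open_tail nu (x * t N).
have otl : ot N @[N --> \oo] --> x `^ (- alpha) by exact: (cvg_open_tail a0 heavy n_infty).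
exists (fun=> 0), (fun N => 2 * B ^+ 2 * (ot N * (ot N * (n N)%:R^-1)) + 2 * s N).
exists 0, (2 * B ^+ 2 * (x `^ (- alpha) * (x `^ (- alpha) * 0)) + 2 * (K * x ^+ 2 * x `^ (- alpha))).
split; first exact: cvg_cst.
- apply: cvgD; last by apply: cvgM => //; exact: cvg_cst.
  by apply: cvgM; [exact: cvg_cst|apply: cvgM => //; exact: (cvgM otl cvg_invn)].
- near=> N; have tN : 0 < t N by near: N; exact: t_gt0.
  have nN : 1 <= (n N)%:R :> R by near: N; exact: n_infty.
  have sN : (n N)%:R * (second_moment nu (x * t N) / t N ^+ 2) <= s N by near: N; exact: sb.
  apply/andP; split; first by rewrite mulr_ge0// sqr_ge0.
  apply: le_trans (ler_wpM2l (ler0n _ _) (truncation_mean_le tN x0)) _.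
  rewrite mulrDr; apply: lerD; last by rewrite mulrCA ler_wpM2l.
  rewrite le_eqVlt; apply/orP; left; apply/eqP; rewrite /ot.
  have : (n N)%:R != 0 :> R by rewrite gt_eqF//; lra.
  by move: ((n N)%:R : R) (open_tail _ _) => a b a1; field.
- by rewrite sub0r oppr_le0 ltW.
- rewrite !mulr0 !add0r -mulrA xE (_ : 2 * (K * (e / (2 * K))) = e)//; field.
  by rewrite gt_eqF.
Unshelve. all: by end_near. Qed.

Lemma cvg_truncation_mean : truncation_mean N @[N --> \oo] --> (0 : R).
Proof.
have L := cvg_truncation_mean_sqr; apply/cvgrPdist_le => e e0.
have e2 : 0 < e ^+ 2 by rewrite exprn_gt0.
move/cvgrPdist_le : L => /(_ _ e2) L; near=> N.
have nN : 1 <= (n N)%:R :> R by near: N; exact: n_infty.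
have : `|0 - (n N)%:R * truncation_mean N ^+ 2| <= e ^+ 2 by near: N; exact: L.
rewrite !sub0r !normrN ger0_norm; last by rewrite mulr_ge0// sqr_ge0.
move=> H; rewrite -ler_sqr ?nnegrE ?normr_ge0 ?(ltW e0)// real_normK ?num_real//.
by apply: le_trans H; rewrite ler_peMl// sqr_ge0.
Unshelve. all: by end_near. Qed.

(** Binomial expansion in the mean. Where a moment of order at least 2 remains, n times it converges
    and the powers of the mean vanish; the last two terms contain the squared mean, which absorbs n.
    Order 1 is exactly 0. *)
Lemma cvg_centered_moment m : (0 < m)%N ->
  (n N)%:R * \int[nu]_y (truncation_centered N y ^+ m) @[N --> \oo] --> stable_moment alpha theta B m.
Proof.
move=> m0; have [->|m1] := eqVneq m 1%N.
  rewrite /stable_moment eqxx; apply: (cvg_eq (g := fun=> 0)); last exact: cvg_cst.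
  move=> N; rewrite integral_bdmB; [|exact: bdm_truncation|exact: bdm_cst].
  by rewrite integral_cst1 subrr mulr0.
have m2 : (2 <= m)%N by case: m m0 m1 => [|[|]].
pose c (i : 'I_m.+1) N := (n N)%:R * ((\int[nu]_y (truncation N y ^+ (m - i)) * (- truncation_mean N) ^+ i) *+ 'C(m, i)).
have E N : (n N)%:R * \int[nu]_y (truncation_centered N y ^+ m) = \sum_(i < m.+1) c i N.
  rewrite -mulr_sumr; congr (_ * _).
  transitivity (\int[nu]_y \sum_(i < m.+1) (((- truncation_mean N) ^+ i *+ 'C(m, i)) * truncation N y ^+ (m - i))).
    by apply: eq_Rintegral => y _; rewrite exprDn; apply: eq_bigr => i _; rewrite mulrnAl mulrC.
  have b i := bdmX i (bdm_truncation N).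
  rewrite integral_bdm_sum; last by move=> i _; exact: bdmZ.
  by apply: eq_bigr => i _; rewrite integral_bdmZ// mulrnAl mulrC.
apply: (cvg_eq E).
have mb k : (- truncation_mean N) ^+ k @[N --> \oo] --> (- (0 : R)) ^+ k.
  elim: k => [|k IH]; first exact: cvg_cst.
  by under eq_fun do rewrite exprS; rewrite exprS; apply: cvgM => //; apply: cvgN; exact: cvg_truncation_mean.
have -> : stable_moment alpha theta B m = \sum_(i < m.+1) (if i == ord0 then stable_moment alpha theta B m else 0).
  by rewrite -big_mkcond /= big_pred1_eq.
apply: cvg_sum_seq => i; case: eqP => [->|i0].
  apply: (cvg_eq (g := fun N => (n N)%:R * \int[nu]_y (truncation N y ^+ m))); last exact: cvg_truncation_moment.
  by move=> N; rewrite /c subn0 expr0 mulr1 bin0 mulr1n.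
have i1 : (0 < i)%N by rewrite lt0n; apply: contra_notN i0 => /eqP H; exact: val_inj.
pose f N := (n N)%:R * (\int[nu]_y (truncation N y ^+ (m - i)) * (- truncation_mean N) ^+ i).
suff L : f N @[N --> \oo] --> (0 : R).
  apply: (cvg_eq (g := fun N => 'C(m, i)%:R * f N)).
    by move=> N; rewrite /c /f -[_ *+ 'C(m, i)]mulr_natl mulrCA.
  by rewrite -[X in _ --> X](mulr0 'C(m, i)%:R); apply: cvgM => //; exact: cvg_cst.
have im : (i <= m)%N by rewrite -ltnS.
have L2 k : (n N)%:R * truncation_mean N ^+ 2 * (- truncation_mean N) ^+ k @[N --> \oo] --> (0 : R).
  by rewrite -(mul0r ((- (0 : R)) ^+ k)); apply: cvgM => //; exact: cvg_truncation_mean_sqr.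
have [mi|mi] := leqP 2 (m - i).
  rewrite -[X in _ --> X](mulr0 (stable_moment alpha theta B (m - i))).
  rewrite -[X in _ * X](_ : (- (0 : R)) ^+ i = 0); last by rewrite oppr0 expr0n gtn_eqF.
  apply: (cvg_eq (g := fun N => (n N)%:R * \int[nu]_y (truncation N y ^+ (m - i)) * (- truncation_mean N) ^+ i)).
    by move=> N; rewrite /f mulrA.
  by apply: cvgM => //; exact: cvg_truncation_moment.
have [mi1|mi0] := eqVneq (m - i)%N 1%N.
  have ie : i = (i.-1).+1 :> nat by rewrite prednK.
  rewrite -[X in _ --> X]oppr0.
  apply: (cvg_eq (g := fun N => - ((n N)%:R * truncation_mean N ^+ 2 * (- truncation_mean N) ^+ i.-1))).
    by move=> N; rewrite /f mi1 ie /= exprS -[\int[nu]_y _]/(truncation_mean N); ring.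
  exact: cvgN.
have mi' : (m - i = 0)%N by case: (m - i)%N mi mi0 => [|[|]].
have ie : i = (m - 2).+2 :> nat by lia.
apply: (cvg_eq (g := fun N => (n N)%:R * truncation_mean N ^+ 2 * (- truncation_mean N) ^+ (m - 2))) => // N.
rewrite /f mi' ie; under eq_Rintegral do rewrite expr0.
by rewrite integral_cst1 mul1r !exprS; ring.
Qed.

End truncated_law.

(** * Supports and reflections of laws *)

Section reflection.
Context {R : realType}.

(** Each point off the support lies in a null interval with rational ends, and these are countably
    many. F enumerates pairs of rationals and keeps the null intervals. *)
Lemma bounded_support_null (mu : probability R R) (K : R) :
  (forall y, law_support mu y -> `|y| <= K) -> mu [set y : R | K < `|y|] = 0%E.
Proof.
move=> HK; pose I (ab : rat * rat) : set R := `]ratr ab.1, ratr ab.2[%classic.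
pose F n : set R := if (choice.unpickle n : option (rat * rat)) is Some ab then
  if mu (I ab) == 0%E then I ab else set0 else set0.
have nF n : mu.-negligible (F n).
  rewrite /F; case: choice.unpickle => [ab|]; last exact: negligible_set0.
  case: ifP => [/eqP I0|_]; last exact: negligible_set0.
  by exists (I ab); split=> //; exact: measurable_itv.
have [A [mA A0 FA]] := negligible_bigcup nF.
apply: (subset_measure0 _ mA _ A0); first exact: measurable_absgt.
move=> y /= Ky; apply: FA.
have /existsNP[U /not_implyP[oU /not_implyP[Uy muU]]] : ~ law_support mu y.
  by move=> /HK; rewrite leNgt Ky.
have mU0 : mu U = 0%E by apply/eqP; rewrite eq_le measure_ge0 andbT leNgt; exact/negP.
have [e /= e0 eU] := (nbhs_ballP _ _).1 (open_nbhs_nbhs (conj oU Uy)).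
have [a] : exists a : rat, ratr a \in `]y - e, y[ by apply: rat_in_itvoo; rewrite ltrBlDr ltrDl.
have [b] : exists b : rat, ratr b \in `]y, y + e[ by apply: rat_in_itvoo; rewrite ltrDl.
rewrite !in_itv /= => /andP[yb be] /andP[ea ay].
exists (choice.pickle (a, b)); first exact: Logic.I.
rewrite /F choice.pickleK.
have IU : I (a, b) `<=` U.
  move=> z; rewrite /I /= in_itv/= => /andP[az zb]; apply: eU.
  by rewrite /ball /= ltr_norml; apply/andP; split; lra.
rewrite ifT; first by rewrite /I /= in_itv/= ay.
apply/eqP; apply: (subset_measure0 _ _ IU mU0); first exact: measurable_itv.
exact: open_measurable.
Qed.

Lemma moment_le_of_support (mu : probability R R) (K : R) k : finite_moments mu -> 0 <= K ->
  (forall y, law_support mu y -> `|y| <= K) -> moment k.*2 mu <= K ^+ k.*2.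
Proof.
move=> fmu K0 HK; have N0 := bounded_support_null HK.
rewrite /moment -[leRHS](integral_cst1 mu) /Rintegral.
rewrite (@ae_eq_integral _ _ _ mu setT (fun y => (Num.min (y ^+ k.*2) (K ^+ k.*2))%:E)
  (fun y => (y ^+ k.*2)%:E) measurableT).
- have mm : measurable_fun setT (fun y : R => Num.min (y ^+ k.*2) (K ^+ k.*2)).
    apply: measurable_minr; last exact: measurable_cst.
    by apply: measurable_funX; exact: measurable_id.
  have bm : bdm (fun y : R => Num.min (y ^+ k.*2) (K ^+ k.*2)).
    split=> //; exists (K ^+ k.*2) => y; rewrite ger0_norm ?ge_min ?lexx ?orbT//.
    by rewrite le_min -!muln2 !exprM !sqr_ge0.
  rewrite -[leLHS]/(\int[mu]_y Num.min (y ^+ k.*2) (K ^+ k.*2)) -[leRHS]/(\int[mu]_y (K ^+ k.*2)).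
  apply: le_integral_bdm => //; first exact: bdm_cst.
  by move=> y; rewrite ge_min lexx orbT.
- by apply/measurable_EFinP; apply: measurable_funX; exact: measurable_id.
- apply/measurable_EFinP; apply: measurable_minr; last exact: measurable_cst.
  by apply: measurable_funX; exact: measurable_id.
- exists [set y : R | K < `|y|]; split => //; first exact: measurable_absgt.
  move=> y /= /not_implyP[_ ny]; rewrite ltNge; apply/negP => yK; apply: ny; congr EFin.
  apply/esym/min_idPl; rewrite -muln2 !exprM -(real_normK (num_real (y ^+ k))) normrX.
  by rewrite -!exprM lerXn2r ?nnegrE.
Qed.

Lemma reflected_law (mu : probability R R) : finite_moments mu -> exists nu : probability R R,
  [/\ forall A, nu A = mu (-%R @^-1` A), finite_moments nu &
      forall k, moment k nu = (-1) ^+ k * moment k mu].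
Proof.
move=> fmu.
have mX : measurable_fun setT (-%R : R -> R).
  by apply: continuous_measurable_fun; exact: opp_continuous.
pose X := HB.pack_for {mfun R >-> R} (-%R : R -> R) (isMeasurableFun.Build _ _ _ _ _ mX).
have mk k : measurable_fun setT (fun y : R => (y ^+ k)%:E).
  by apply/measurable_EFinP; apply: measurable_funX; exact: measurable_id.
have ik k : mu.-integrable setT (fun y => ((-1) ^+ k * y ^+ k)%:E).
  by have := integrableZl measurableT ((-1) ^+ k) (fmu k).
have E k : (fun y : R => (y ^+ k)%:E) \o X = fun y => ((-1) ^+ k * y ^+ k)%:E.
  by apply/funext => y /=; rewrite (exprNn y).
exists (distribution mu (X : {RV mu >-> R})); split => //.
  move=> k; apply: (@integrable_pushforward _ _ _ _ _ _ mX mu _ _ (mk k)) => //.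
  by rewrite preimage_setT (E k); exact: ik.
move=> k; transitivity (\int[mu]_y ((-1) ^+ k * y ^+ k)); last by rewrite RintegralZl//; exact: fmu.
rewrite /moment /Rintegral; congr fine.
rewrite (@integral_distribution _ _ _ _ _ mu (X : {RV mu >-> R}) _ (mk k)); last by rewrite E.
by rewrite E.
Qed.

End reflection.

(** * The limiting laws *)

Section limit_law.
Context {R : realType} (q : nat) (alpha : R).
Hypothesis alpha02 : 0 < alpha < 2.
Let a0 : 0 < alpha. Proof. by case/andP: alpha02. Qed.
Let a2 : alpha < 2. Proof. by case/andP: alpha02. Qed.

Definition limit_variance B : R := alpha / (2 - alpha) * B `^ (2 - alpha).
Definition limit_scale B : R := (Num.sqrt (limit_variance B * q`!%:R))^-1.
Definition limit_moment theta B k : R :=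
  limit_scale B ^+ k * tree_moment q (stable_moment alpha theta B) k.

Lemma limit_variance_gt0 B : 0 < B -> 0 < limit_variance B.
Proof. by move=> B0; rewrite mulr_gt0 ?powR_gt0// divr_gt0// subr_gt0. Qed.

Let vq_gt0 B : 0 < B -> 0 < limit_variance B * q`!%:R.
Proof. by move=> B0; rewrite mulr_gt0 ?limit_variance_gt0// ltr0n fact_gt0. Qed.

Lemma limit_scale_gt0 B : 0 < B -> 0 < limit_scale B.
Proof. by move=> B0; rewrite invr_gt0 sqrtr_gt0 vq_gt0. Qed.

Lemma limit_scale_sqr B : 0 < B -> limit_scale B ^+ 2 = (limit_variance B * q`!%:R)^-1.
Proof. by move=> B0; rewrite exprVn sqr_sqrtr// ltW// vq_gt0. Qed.

Let alpha_lt_nat m : (2 <= m)%N -> alpha < m%:R.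
Proof. by move=> m2; apply: lt_le_trans a2 _; rewrite (ler_nat _ 2). Qed.

Lemma balance_norm (theta : R) m : 0 <= theta <= 1 -> `|theta + (-1) ^+ m * (1 - theta)| <= 1.
Proof.
by move=> /andP[t0 t1]; rewrite -signr_odd ler_norml; case: odd => /=; rewrite ?expr1 ?expr0; apply/andP; split; lra.
Qed.

(** The factor 1 / (m - alpha) is at most 1 / (2 - alpha); the maximum with 1 lets the constant be
    absorbed into the geometric rate. *)
Lemma stable_moment_growth theta B : 0 <= theta <= 1 -> 0 < B -> exists2 D : R, 0 < D &
  forall m, (0 < m)%N -> `|stable_moment alpha theta B m| <= D ^+ m.
Proof.
move=> t01 B0; pose E := alpha / (2 - alpha) * B `^ (- alpha).
have E0 : 0 < E by rewrite mulr_gt0 ?powR_gt0// divr_gt0// subr_gt0.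
pose D := Num.max 1 E * B.
have M0 : 0 < Num.max 1 E by rewrite lt_max ltr01.
exists D => [|m m0]; first by rewrite mulr_gt0.
rewrite /stable_moment; case: eqP => [_|/eqP m1]; first by rewrite normr0 exprn_ge0// mulr_ge0 ?(ltW M0) ?(ltW B0).
have m2 : (2 <= m)%N by case: m m0 m1 => [|[|]].
have am := alpha_lt_nat m2.
apply: (@le_trans _ _ `|alpha / (m%:R - alpha) * B `^ (m%:R - alpha)|).
  by rewrite normrM ler_piMr// balance_norm.
rewrite ger0_norm; last by rewrite mulr_ge0 ?powR_ge0// divr_ge0 ?(ltW a0)// subr_ge0 ltW.
rewrite powRD; last by rewrite (gt_eqF B0) implybT.
rewrite powR_mulrn ?(ltW B0)// exprMn mulrCA mulrC ler_wpM2r ?exprn_ge0 ?(ltW B0)//.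
apply: (@le_trans _ _ E).
  rewrite ler_wpM2r ?powR_ge0// ler_wpM2l ?(ltW a0)// lef_pV2 ?posrE ?subr_gt0//.
  by rewrite lerB// (ler_nat _ 2).
apply: (@le_trans _ _ (Num.max 1 E)); first by rewrite le_max lexx orbT.
by rewrite -[leLHS]expr1 ler_weXn2l// le_max lexx.
Qed.

Lemma limit_moment_growth theta B : 0 <= theta <= 1 -> 0 < B -> exists2 C : R, 0 < C &
  forall k, `|limit_moment theta B k| <= C ^+ k * k`!%:R.
Proof.
move=> t01 B0; have [D D0 HD] := stable_moment_growth t01 B0.
have c0 := limit_scale_gt0 B0.
exists (limit_scale B * (q.+2`!%:R * D)) => [|k].
  by rewrite !mulr_gt0// ltr0n fact_gt0.
rewrite normrM ger0_norm ?exprn_ge0 ?(ltW c0)// exprMn -mulrA ler_wpM2l ?exprn_ge0 ?(ltW c0)//.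
exact: tree_moment_growth (ltW D0) HD.
Qed.

Lemma limit_law_exists theta B : 0 <= theta <= 1 -> 0 < B ->
  exists mu : probability R R, finite_moments mu /\ forall k, moment k mu = limit_moment theta B k.
Proof.
move=> t01 B0; have [C C0 growth] := limit_moment_growth t01 B0.
apply: (moment_problem C0 growth).
  by rewrite /limit_moment tree_moment0 expr0 mul1r.
move=> W W0; rewrite -oppr_le0 -LinN.
apply: (stable_bounds alpha02 q t01 B0 (limit_scale B) (- W)).1 => y.
by rewrite hornerN oppr_le0.
Qed.

Section given_law.
Variables (theta B : R) (mu : probability R R).
Hypotheses (theta01 : 0 <= theta <= 1) (B0 : 0 < B).
Hypotheses (fmu : finite_moments mu) (mmu : forall k, moment k mu = limit_moment theta B k).

Let growth : exists2 C : R, 0 < C & forall k, `|moment k mu| <= C ^+ k * k`!%:R.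
Proof.
by have [C C0 H] := limit_moment_growth theta01 B0; exists C => // k; rewrite mmu.
Qed.

Lemma limit_law_determinate : moment_determinate mu.
Proof. by have [C C0 H] := growth; apply: (moments_determinate C0). Qed.

(** Points to the heavier tail. Reflecting when theta < 1/2 makes all stable moments nonnegative, so
    that tree moments are bounded below by those of selected walks. *)
Let sg : R := if 2^-1 <= theta then 1 else -1.

Let sgE k : sg ^+ k * (theta + (-1) ^+ k * (1 - theta)) = if odd k then `|2 * theta - 1| else 1.
Proof.
have -> : sg ^+ k = if odd k then sg else 1.
  rewrite /sg; case: ifP => _; first by rewrite expr1n if_same.
  by rewrite -signr_odd; case: odd; rewrite ?expr1.
rewrite -(signr_odd _ k); case: odd; rewrite /= ?expr1 ?expr0; last by ring.
by rewrite /sg; case: (leP 2^-1 theta) => H; [rewrite ger0_norm|rewrite ltr0_norm]; lra.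
Qed.

Lemma stable_moment_sign :
  exists2 M' : nat -> R, stable_moment alpha theta B = (fun m => sg ^+ m * M' m) &
  (forall m, (0 < m)%N -> 0 <= M' m) /\
  exists2 r : R, 0 < r & forall m, (0 < m)%N -> r ^+ m * (~~ odd m)%:R <= M' m.
Proof.
have /andP[t0 t1] := theta01.
exists (fun m => sg ^+ m * stable_moment alpha theta B m).
  apply/funext => k; rewrite mulrA -exprMn /sg; case: ifP => _; first by rewrite mulr1 expr1n mul1r.
  by rewrite mulrNN mulr1 expr1n mul1r.
have pos k : (2 <= k)%N -> 0 < alpha / (k%:R - alpha) * B `^ (k%:R - alpha).
  by move=> k2; rewrite mulr_gt0 ?powR_gt0// divr_gt0// subr_gt0 alpha_lt_nat.
have sE k : (2 <= k)%N -> sg ^+ k * stable_moment alpha theta B k =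
    alpha / (k%:R - alpha) * B `^ (k%:R - alpha) * (sg ^+ k * (theta + (-1) ^+ k * (1 - theta))).
  by move=> k2; rewrite /stable_moment (gtn_eqF k2) mulrCA.
split=> [k k0|].
  have [->|k1] := eqVneq k 1%N; first by rewrite /stable_moment eqxx mulr0.
  have k2 : (2 <= k)%N by case: k k0 k1 => [|[|]].
  by rewrite sE// mulr_ge0 ?(ltW (pos _ k2))// sgE; case: ifP.
pose E := Num.min 1 (alpha * B `^ (- alpha)).
have E0 : 0 < E by rewrite lt_min ltr01 mulr_gt0 ?powR_gt0.
(* The factor 1/2 pays for the denominator, as k - alpha <= 2^k, and E <= 1 gives E^k <= E. *)
exists (E * (B / 2)) => [|k k0]; first by rewrite mulr_gt0// divr_gt0.
case: (boolP (odd k)) => ok /=.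
  rewrite mulr0; have [->|k1] := eqVneq k 1%N; first by rewrite /stable_moment eqxx mulr0.
  have k2 : (2 <= k)%N by case: k k0 k1 {ok} => [|[|]].
  by rewrite sE// mulr_ge0 ?(ltW (pos _ k2))// sgE ok.
have k2 : (2 <= k)%N by case: k k0 ok => [|[|]].
rewrite mulr1 sE// sgE (negbTE ok) mulr1.
rewrite powRD; last by rewrite (gt_eqF B0) implybT.
rewrite powR_mulrn ?(ltW B0)// !exprMn exprVn.
have kp : 0 < k%:R - alpha by rewrite subr_gt0 alpha_lt_nat.
rewrite (_ : alpha / _ * _ = alpha * B `^ (- alpha) * B ^+ k * (k%:R - alpha)^-1); last by ring.
rewrite (_ : E ^+ k * _ = E ^+ k * B ^+ k * 2 ^- k); last by ring.
have E1 : E ^+ k <= alpha * B `^ (- alpha).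
  apply: (@le_trans _ _ E); last by rewrite ge_min lexx orbT.
  by rewrite -[leRHS]expr1 ler_wiXn2l ?(ltW E0)// ge_min lexx.
apply: ler_pM; rewrite ?mulr_ge0 ?exprn_ge0 ?invr_ge0 ?exprn_ge0 ?(ltW E0) ?(ltW B0)//.
  by rewrite ler_wpM2r ?exprn_ge0 ?(ltW B0).
rewrite lef_pV2 ?posrE ?exprn_gt0//.
apply: (@le_trans _ _ k%:R); first by rewrite gerBl ltW.
by rewrite -natrX ler_nat ltnW// ltn_expl.
Qed.

Lemma limit_law_even_moment : exists2 r : R, 0 < r & forall b, (0 < b)%N -> exists2 c : R, 0 < c &
  forall k, (b <= k)%N -> c * (r ^+ 2 * b%:R) ^+ k <= moment k.*2 mu.
Proof.
have [M' ME [M'0 [r r0 rM]]] := stable_moment_sign.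
have c0 := limit_scale_gt0 B0.
exists (limit_scale B * r) => [|b b0]; first by rewrite mulr_gt0.
have [c cp Hc] := @tree_moment_star R q b b0.
exists c => // k bk; rewrite mmu /limit_moment ME tree_moment_scale.
have -> : sg ^+ k.*2 = 1.
  by rewrite -muln2 mulnC exprM /sg; case: ifP => _; rewrite ?sqrrN !expr1n.
rewrite mul1r (_ : c * _ = limit_scale B ^+ k.*2 * (r ^+ k.*2 * (c * b%:R ^+ k))); last first.
  by rewrite -!muln2 !(mulnC _ 2) !exprM !exprMn; ring.
rewrite ler_wpM2l ?exprn_ge0 ?(ltW c0)//.
apply: (@le_trans _ _ (r ^+ k.*2 * tree_moment q (fun m => (~~ odd m)%:R) k.*2)).
  by rewrite ler_wpM2l ?exprn_ge0 ?(ltW r0)// Hc.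
rewrite -tree_moment_scale; apply: le_trans (ler_norm _) _.
apply: ler_norm_tree_moment => m m0; rewrite ger0_norm ?rM// mulr_ge0// exprn_ge0// ltW//.
Qed.

(** A support in [-K, K] bounds the moment of order 2k by K^(2k); star walks with r^2 b >= 2 K^2
    exceed this by a factor c 2^k. *)
Lemma limit_law_unbounded : ~ bounded_set (law_support mu).
Proof.
move=> [K0 [_ HK0]]; pose K := Num.max K0 0 + 1.
have KK : K0 < K by rewrite /K ltr_pwDr// le_max lexx.
have Kp : 0 < K by rewrite /K ltr_pwDr// le_max lexx orbT.
have HK y : law_support mu y -> `|y| <= K by move=> sy; exact: (HK0 K KK).
have [r r0 Hr] := limit_law_even_moment.
pose x0 := 2 * K ^+ 2 / r ^+ 2.
have x00 : 0 <= x0 by rewrite divr_ge0 ?exprn_ge0 ?(ltW r0)// mulr_ge0// exprn_ge0 ?(ltW Kp).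
pose b := (Num.Def.archi_bound x0).+1.
have xb : x0 <= b%:R by rewrite ltW// (lt_trans (archi_boundP x00))// ltr_nat.
have [c c0 Hc] := Hr b isT.
have rb : 2 * K ^+ 2 <= r ^+ 2 * b%:R.
  by rewrite [leRHS]mulrC -ler_pdivrMr// exprn_gt0.
have ub k : (b <= k)%N -> c * 2 ^+ k <= 1.
  move=> bk; have K2 : 0 < K ^+ k.*2 by rewrite exprn_gt0.
  rewrite -(ler_pM2r K2) mul1r; apply: le_trans (moment_le_of_support k fmu (ltW Kp) HK).
  apply: le_trans (Hc k bk); rewrite -mulrA ler_wpM2l ?(ltW c0)//.
  rewrite -muln2 mulnC exprM -exprMn lerXn2r ?nnegrE ?mulr_ge0 ?sqr_ge0 ?(ltW Kp) ?(ltW r0)//.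
pose k := (b + Num.Def.archi_bound c^-1)%N.
have ci : 0 <= c^-1 by rewrite invr_ge0 ltW.
have := ub k (leq_addr _ _); rewrite leNgt => /negP; apply.
rewrite -ltr_pdivrMl// mulr1; apply: lt_le_trans (archi_boundP ci) _.
rewrite -natrX ler_nat; apply: leq_trans (ltnW (ltn_expl _ (isT : (1 < 2)%N))) _.
by rewrite leq_pexp2l// leq_addl.
Qed.

(** The test function is not a polynomial: it is squeezed, and Q - W, which lies below it, is
    admissible in [stable_bounds]. *)
Lemma limit_law_mass (m eps s : R) : 0 < m -> 0 < eps -> s = (alpha + 2) / 2 ->
  \int[mu]_y Num.min 1 (y ^+ 2 / m) <= alpha / (s - alpha) * B `^ (s - alpha) *
    (eps `^ (- s) + limit_scale B ^+ 2 * q.+2`!%:R / m * eps `^ (2 - s)).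
Proof.
move=> m0 e0 sE; set bnd := _ * (_ + _); pose f y : R := Num.min 1 (y ^+ 2 / m).
have cf : continuous f.
  have -> : f = clamp 0 1 \o (fun y => y ^+ 2 / m).
    by apply/funext => y; rewrite /f /clamp /= minC max_r// le_min ler01 divr_ge0 ?sqr_ge0// ltW.
  move=> y; apply: continuous_comp; last exact: continuous_clamp.
  by apply: cvgM; [exact: exprn_continuous|exact: cvg_cst].
have fK y : `|f y| <= 1.
  by rewrite ger0_norm ?ge_min ?lexx// le_min ler01 divr_ge0 ?sqr_ge0// ltW.
have bf : bcont f by split=> //; exists 1.
have [C C0 gr] := growth.
apply/ler_addgt0Pl => e ep; have e2 : 0 < e / 2 by rewrite divr_gt0.
have [Q [W [fQ We]]] := polynomial_squeeze C0 gr cf fK e2.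
have d := integral_squeeze fmu bf fQ.
have := (stable_bounds alpha02 q theta01 B0 (limit_scale B) (Q - W)).2 m eps m0 e0.
have -> : (fun k => limit_scale B ^+ k * tree_moment q (stable_moment alpha theta B) k) = moment ^~ mu.
  by apply/funext => k; rewrite mmu.
rewrite LinB -sE -/bnd => H.
have {}H : Lin (moment^~ mu) Q - Lin (moment^~ mu) W <= bnd.
  apply: H => y; rewrite hornerD hornerN lerBlDr -lerBlDl.
  by have := fQ y; rewrite distrC => /(le_trans (ler_norm _)).
have := le_trans (ler_norm _) d; rewrite -/(f _); move: We H; lra.
Qed.

End given_law.

(** For theta = 1/2 the odd stable moments vanish, so the sequence is invariant under the signs
    (-1)^m and an odd tree moment equals its opposite. *)
Lemma limit_moment_odd B k : odd k -> limit_moment 2^-1 B k = 0.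
Proof.
move=> ok; rewrite /limit_moment.
have E : tree_moment q (stable_moment alpha 2^-1 B) k = (-1) ^+ k * tree_moment q (stable_moment alpha 2^-1 B) k.
  rewrite -tree_moment_scale; apply: eq_tree_moment => m m0.
  rewrite /stable_moment; case: eqP => _; first by rewrite mulr0.
  rewrite -signr_odd; case: odd; rewrite ?expr1 ?expr0 ?mul1r//.
  by rewrite (_ : 2^-1 + -1 * (1 - 2^-1) = 0) ?mulr0//; lra.
rewrite -signr_odd ok expr1 mulN1r in E.
by have -> : tree_moment q (stable_moment alpha 2^-1 B) k = 0; [lra|rewrite mulr0].
Qed.

(** The reflected law has the same moments, and determinacy identifies the two. *)
Lemma symmetric_limit_law B (mu : probability R R) : 0 < B -> finite_moments mu ->
  (forall k, moment k mu = limit_moment 2^-1 B k) -> symmetric_law mu.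
Proof.
move=> B0 fmu mmu A mA; have [nu [nuE fnu mnu]] := reflected_law fmu.
have h01 : 0 <= (2^-1 : R) <= 1 by apply/andP; split; lra.
have [_ det] := limit_law_determinate h01 B0 fmu mmu.
rewrite -nuE; apply: det => // k; rewrite mnu.
case: (boolP (odd k)) => ok; first by rewrite mmu limit_moment_odd// mulr0.
by rewrite -signr_odd (negbTE ok) expr0 mul1r.
Qed.

End limit_law.

(** The balances 1 and 0 are reflections of each other, so their third moments are opposite; the
    triangle walk shows that they are not 0. *)
Lemma third_moment_balance {R : realType} (q : nat) (alpha B : R) : 0 < alpha < 2 -> 0 < B ->
  limit_moment q.+1 alpha 1 B 3 <> limit_moment q.+1 alpha 0 B 3.
Proof.
move=> a02 B0; have /andP[a0 a2] := a02; have c0 := limit_scale_gt0 q.+1 a02 B0.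
pose M1 := stable_moment alpha 1 B.
have E1 m : M1 m = if m == 1%N then 0 else alpha / (m%:R - alpha) * B `^ (m%:R - alpha).
  by rewrite /M1 /stable_moment subrr mulr0 addr0 mulr1.
have E0 : tree_moment q.+1 (stable_moment alpha 0 B) 3 = - tree_moment q.+1 M1 3.
  rewrite (@eq_tree_moment _ _ _ (fun m => (-1) ^+ m * M1 m)); last first.
    by move=> m _; rewrite E1 /stable_moment; case: eqP => _; rewrite ?mulr0// add0r subr0 mulr1 mulrC.
  by rewrite tree_moment_scale -signr_odd expr1 mulN1r.
have pos m : (0 < m)%N -> 0 <= M1 m.
  move=> m0; rewrite E1; case: eqP => // /eqP m1; rewrite mulr_ge0 ?powR_ge0// divr_ge0 ?(ltW a0)//.
  by rewrite subr_ge0 (le_trans (ltW a2))// (ler_nat _ 2); case: m m0 m1 => [|[|]].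
have M3 : 0 < M1 3%N.
  by rewrite E1 /= mulr_gt0 ?powR_gt0// divr_gt0// subr_gt0 (lt_trans a2)// ltr_nat.
pose r := Num.min 1 (M1 3%N); have r0 : 0 < r by rewrite lt_min ltr01.
have r3 : r ^+ 3 <= M1 3%N.
  apply: (@le_trans _ _ r); last by rewrite ge_min lexx orbT.
  by rewrite -[leRHS]expr1 ler_wiXn2l ?(ltW r0)// ge_min lexx.
have T : r ^+ 3 <= tree_moment q.+1 M1 3.
  apply: (@le_trans _ _ (r ^+ 3 * tree_moment q.+1 (fun m => (m == 3%N)%:R) 3)).
    by rewrite ler_peMr ?exprn_ge0 ?(ltW r0)// tree_moment_triangle.
  rewrite -tree_moment_scale; apply: le_trans (ler_norm _) _.
  apply: ler_norm_tree_moment => m m0; rewrite ger0_norm ?mulr_ge0 ?exprn_ge0 ?(ltW r0)//.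
  by case: eqP => [->|_]; rewrite ?mulr1 ?mulr0 ?pos.
have Tp : 0 < tree_moment q.+1 M1 3 by apply: lt_le_trans T; rewrite exprn_gt0.
rewrite /limit_moment E0 -/M1 => /(mulfI _) H.
have := H (lt0r_neq0 (exprn_gt0 3 c0)); move: Tp; lra.
Qed.

(** * Collapse of the limit laws at 0 for large B *)

Section degenerate_limit.
Context {R : realType} (q : nat) (alpha theta : R).
Hypothesis alpha02 : 0 < alpha < 2.
Hypothesis theta01 : 0 <= theta <= 1.

Lemma powRN_small (a e : R) : 0 < a -> 0 < e -> \forall B \near +oo, B `^ (- a) <= e.
Proof.
move=> a0 e0; near=> B.
have B0 : 0 < B by near: B; exact: nbhs_pinfty_gt.
have Be : (e^-1) `^ a^-1 <= B by near: B; exact: nbhs_pinfty_ge.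
rewrite powRN -[leRHS]invrK lef_pV2 ?posrE ?invr_gt0 ?powR_gt0//.
have -> : e^-1 = ((e^-1) `^ a^-1) `^ a.
  by rewrite -powRrM mulVf ?gt_eqF// powRr1// invr_ge0 ltW.
by rewrite ge0_ler_powR ?nnegrE ?(ltW a0) ?powR_ge0 ?(ltW B0).
Unshelve. all: by end_near. Qed.

Variable mu : R -> probability R R.
Hypothesis mu_moments : forall B, 0 < B ->
  finite_moments (mu B) /\ forall k, moment k (mu B) = limit_moment q alpha theta B k.

Lemma limit_law_mass_cvg0 (m e : R) : 0 < m -> 0 < e ->
  \forall B \near +oo, \int[mu B]_y Num.min 1 (y ^+ 2 / m) <= e.
Proof.
move=> m0 e0; have /andP[a0 a2] := alpha02.
pose s := (alpha + 2) / 2; have s0 : 0 < s by rewrite /s; lra.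
have sa : alpha < s by rewrite /s; lra.
have s2 : s < 2 by rewrite /s; lra.
(* The threshold is eps = B^g. The two terms of the mass bound have exponents s - alpha - s g and
   -(2 - s) (1 - g), both negative for g strictly between 1 - alpha / s and 1; this is the midpoint,
   and the exponents become -alpha / 2 and -rho. *)
pose g := 1 - alpha / (2 * s).
pose rho := (2 - s) * (alpha / (2 * s)).
have rho0 : 0 < rho by rewrite mulr_gt0 ?subr_gt0// divr_gt0// mulr_gt0.
have ah : 0 < alpha / 2 by rewrite divr_gt0.
pose A1 := alpha / (s - alpha).
pose A2 := A1 * ((2 - alpha) / alpha / q`!%:R * q.+2`!%:R / m).
have A10 : 0 < A1 by rewrite divr_gt0// subr_gt0.
have A20 : 0 < A2.
  by rewrite !mulr_gt0 ?invr_gt0 ?subr_gt0 ?ltr0n ?fact_gt0.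
have e20 : 0 < e / 2 by rewrite divr_gt0.
near=> B; have B0 : 0 < B by near: B; exact: nbhs_pinfty_gt.
have [fmu mmu] := mu_moments B0.
have eps0 : 0 < B `^ g by rewrite powR_gt0.
apply: le_trans (limit_law_mass alpha02 theta01 B0 fmu mmu m0 eps0 (erefl s)) _.
rewrite limit_scale_sqr// /limit_variance.
have bD x y : B `^ x * B `^ y = B `^ (x + y).
  by rewrite powRD// (gt_eqF B0) implybT.
have -> : A1 * B `^ (s - alpha) * ((B `^ g) `^ (- s) + (alpha / (2 - alpha) * B `^ (2 - alpha) * q`!%:R)^-1 *
    q.+2`!%:R / m * (B `^ g) `^ (2 - s)) = A1 * B `^ (- (alpha / 2)) + A2 * B `^ (- rho).
  rewrite -!powRrM.
  have E1 : B `^ (- (alpha / 2)) = B `^ (s - alpha) * B `^ (g * (- s)).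
    by rewrite bD; congr (_ `^ _); rewrite /g; field; rewrite gt_eqF.
  have E2 : B `^ (- rho) = B `^ (s - alpha) * B `^ (- (2 - alpha)) * B `^ (g * (2 - s)).
    by rewrite !bD; congr (_ `^ _); rewrite /g /rho; field; rewrite gt_eqF.
  rewrite E1 E2 powRN /A2.
  have := powR_gt0 (2 - alpha) B0; move: (B `^ (2 - alpha)) (B `^ (s - alpha)) => x z x0.
  have : q`!%:R != 0 :> R by rewrite pnatr_eq0 -lt0n fact_gt0.
  move: (q`!%:R) (q.+2`!%:R) (B `^ (g * - s)) (B `^ (g * (2 - s))) => f f' u v f0.
  field; rewrite f0 (gt_eqF x0) (gt_eqF a0) (gt_eqF m0) /=.
  by rewrite subr_eq0 gt_eqF.
have h1 : B `^ (- (alpha / 2)) <= e / 2 / A1.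
  by near: B; exact: (powRN_small ah (divr_gt0 e20 A10)).
have h2 : B `^ (- rho) <= e / 2 / A2.
  by near: B; exact: (powRN_small rho0 (divr_gt0 e20 A20)).
rewrite [leRHS]splitr lerD//.
  by rewrite mulrC -ler_pdivlMr.
by rewrite mulrC -ler_pdivlMr.
Unshelve. all: by end_near. Qed.

(** Within distance d of 0 continuity of f suffices; elsewhere its oscillation 2 K is dominated by a
    multiple of [phi], whose integral tends to 0. *)
Theorem limit_law_degenerate : weak_cvg +oo (fun B => mu B) (\d_(0 : R) : probability R R).
Proof.
move=> f cf bf.
have [K fK] : exists K, forall y, `|f y| <= K.
  by have [K [_ HK]] := bf; exists (K + 1) => y; apply: HK => //; rewrite ltrDl.
have bdf : bcont f by split=> //; exists K.
have K0 : 0 <= K by rewrite (le_trans _ (fK 0)).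
have -> : \int[\d_(0 : R)]_y f y = f 0.
  by rewrite /Rintegral integral_dirac// ?diracT ?mul1e//; apply/measurable_EFinP; case: (bcont_bdm bdf).
apply/cvgrPdist_le => e e0; have e20 : 0 < e / 2 by rewrite divr_gt0.
have /cvgrPdist_le/(_ _ e20)/nbhs_ballP[d /= d0 Hd] := cf 0.
have d2 : 0 < d ^+ 2 by rewrite exprn_gt0.
pose phi y : R := Num.min 1 (y ^+ 2 / d ^+ 2).
have e4 : 0 < e / 2 / (2 * K + 1) by rewrite divr_gt0// ltr_pwDr// mulr_ge0.
have bphi : bdm (phi : R -> R).
  split.
    apply: measurable_minr; first exact: measurable_cst.
    apply: measurable_funM; last exact: measurable_cst.
    by apply: measurable_funX; exact: measurable_id.
  exists 1 => y; rewrite ger0_norm ?ge_min ?lexx// le_min ler01 divr_ge0 ?sqr_ge0//.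
have phi0 y : 0 <= phi y by rewrite le_min ler01 divr_ge0 ?sqr_ge0.
have key y : `|f 0 - f y| <= e / 2 + (2 * K + 1) * phi y.
  have [yd|yd] := ltP `|y| d.
    rewrite (le_trans (Hd y _))//; last by rewrite lerDl mulr_ge0 ?addr_ge0 ?mulr_ge0.
    by rewrite /ball /= sub0r normrN.
  have -> : phi y = 1.
    apply/min_idPl; rewrite ler_pdivlMr// mul1r -[leRHS]real_normK ?num_real//.
    by rewrite lerXn2r ?nnegrE ?(ltW d0).
  rewrite (le_trans (ler_normB _ _))//; have := fK 0; have := fK y; lra.
near=> B; have bf' := bcont_bdm bdf.
rewrite -(integral_cst1 (mu B) (f 0)) -integral_bdmB//; last exact: bdm_cst.
have b1 : bdm (fun y => f 0 - f y) by apply: bdmB => //; exact: bdm_cst.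
rewrite (le_trans (le_normr_Rintegral _ (bdm_integrable (mu B) b1)))//.
apply: (@le_trans _ _ (\int[mu B]_y (e / 2 + (2 * K + 1) * phi y))).
  apply: le_integral_bdm => //; first exact: bdm_norm.
  by apply: bdmD; [exact: bdm_cst|exact: bdmZ].
rewrite integral_bdmD; [|exact: bdm_cst|exact: bdmZ].
rewrite integral_cst1 integral_bdmZ// [leRHS]splitr lerD2l mulrC -ler_pdivlMr; last by rewrite ltr_pwDr// mulr_ge0.
near: B; exact: limit_law_mass_cvg0.
Unshelve. all: by end_near. Qed.

End degenerate_limit.

(** * Identification with the random tensor *)

Section model.
Context {R : realType} (q : nat) (alpha theta B : R) (nu : probability R R).
Hypothesis alpha02 : 0 < alpha < 2.
Hypothesis theta01 : 0 <= theta <= 1.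
Hypothesis B0 : 0 < B.
Hypothesis heavy : heavy_tailed alpha theta nu.
Context d (T : measurableType d) (P : probability T R) (x : seq nat -> {RV P >-> R}).
Hypothesis iid : iid_array q.+2 nu x.

Let n (N : nat) := (N.+1 ^ q.+1)%N.

Let n_infty (X : R) : \forall N \near \oo, X <= (n N)%:R.
Proof.
near=> N; apply: (@le_trans _ _ N.+1%:R).
  by rewrite -natr1 ler_wpDr//; near: N; exact: nbhs_infty_ger.
by rewrite ler_nat /n -[leqLHS]expn1 leq_pexp2l.
Unshelve. all: by end_near. Qed.

(** The expectation subtracted in [centered] is the same for all indices since all entries have law
    nu; the centred tensor becomes one deterministic function applied to the independent array. *)
Lemma centered_entry N e : sorted_indices q.+2 (sort leq e) ->
  centered q.+2 nu x B N.+1 e = fun w => truncation_centered nu B n N (x (sort leq e) w).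
Proof.
move=> se; apply/funext => w.
have tE w' : (scaling q.+2 nu N.+1)^-1 * truncated q.+2 nu x B N.+1 e w' = truncation nu B n N (x (sort leq e) w').
  by rewrite /truncated /tensor /truncation /clip /scaling /n subSS subn0.
rewrite /centered tE /truncation_centered; congr (_ - _).
have := mean_entry_pow iid (bdm_truncation nu B n) N 1 se.
rewrite /law_moment /truncation_mean /= => <-.
rewrite unlock /expectation_def; congr fine; apply: eq_integral => w' _.
Qed.

Lemma cvg_law_moment_model m : (0 < m)%N ->
  N.+1%:R ^+ q.+1 * law_moment nu (truncation_centered nu B n) N m @[N --> \oo] -->
  stable_moment alpha theta B m.
Proof.
move=> m0; have := cvg_centered_moment alpha02 heavy theta01 B0 n_infty m0.
apply: cvg_trans; apply: near_eq_cvg; apply: nearW => N.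
by rewrite /law_moment /n natrX.
Qed.

(** This is the second stable moment, where the balance factor theta + (1 - theta) is 1. *)
Lemma M2E : M2 q.+2 nu x B = limit_variance alpha B.
Proof.
rewrite /M2; apply/cvg_lim => //; rewrite -cvg_shiftS /=.
have -> : limit_variance alpha B = stable_moment alpha theta B 2.
  by rewrite /stable_moment /limit_variance /=; ring.
apply: cvg_trans (cvg_law_moment_model (isT : (0 < 2)%N)); apply: near_eq_cvg; apply: nearW => N.
have si : sorted leq (iota 0 q.+2) by exact: iota_sorted.
have se : sorted_indices q.+2 (sort leq (iota 0 q.+2)).
  by rewrite sorted_sort//; [split; rewrite ?size_iota|exact: leq_trans].
rewrite subSS subn0 /=; congr (_ * _).
rewrite -(mean_entry_pow iid (bdm_truncation_centered nu B n) N 2 se).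
rewrite unlock /expectation_def /Rintegral; congr fine; apply: eq_integral => w _.
by rewrite [centered _ _ _ _ _ _ _](congr1 (fun f => f w) (centered_entry N se)).
Qed.

Lemma contraction_mxE N w : contraction_mx q.+2 nu x B N.+1 w =
  contraction q N (limit_scale q alpha B) (entry x (truncation_centered nu B n) N w).
Proof.
apply/matrixP => a b; rewrite !mxE M2E /limit_scale subSS subSS subn0.
congr (_ * _); apply: eq_bigr => j _.
have se : sorted_indices q.+2 (sort leq (map val [:: a, b & j])).
  split; last exact: sort_sorted leq_total _.
  by rewrite size_sort /= size_map size_tuple.
by rewrite (congr1 (fun f => f w) (centered_entry N se)).
Qed.

Theorem model_weak_cvg (mu : probability R R) : finite_moments mu ->
  (forall k, moment k mu = limit_moment q alpha theta B k) ->
  weak_cvg_in_probability P (fun N w => esd (contraction_mx q.+2 nu x B N w)) mu.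
Proof.
(* The shift sets dimension 0 aside, which does not affect the limit. *)
move=> fmu mmu f cf bf e e0; rewrite -cvg_shiftS /=.
have [C C0 growth] := limit_moment_growth q alpha02 theta01 B0.
have gr k : `|moment k mu| <= C ^+ k * k`!%:R by rewrite mmu.
have := esd_weak_cvg iid (bdm_truncation_centered nu B n) cvg_law_moment_model fmu mmu C0 gr cf bf e0.
apply: cvg_trans; apply: near_eq_cvg; apply: nearW => N /=.
by congr (P _); apply/seteqP; split=> w /=; rewrite contraction_mxE.
Qed.

End model.

Unset Implicit Arguments.

Theorem theorem1p8 (R : realType) (p : nat) (alpha : R)
    (hp : (2 <= p)%N) (halpha : 0 < alpha < 2) :
  exists (mu : R -> R -> probability R R) (mu_lim : R -> probability R R),
    [/\ forall theta B : R, 0 <= theta <= 1 -> 0 < B ->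
          [/\ forall (d : measure_display) (T : measurableType d)
                  (P : probability T R) (nu : probability R R)
                  (x : seq nat -> {RV P >-> R}),
                heavy_tailed alpha theta nu -> iid_array p nu x ->
                weak_cvg_in_probability P
                  (fun N w => esd (contraction_mx p nu x B N w)) (mu theta B),
              moment_determinate (mu theta B) &
              ~ bounded_set (law_support (mu theta B))],
        forall theta : R, 0 <= theta <= 1 ->
          weak_cvg +oo (fun B => mu theta B) (mu_lim theta),
        (3 <= p)%N -> forall B : R, 0 < B ->
          exists (k : nat) (theta1 theta2 : R),
            [/\ odd k, 0 <= theta1 <= 1, 0 <= theta2 <= 1 &
                moment k (mu theta1 B) <> moment k (mu theta2 B)] &
        (forall B : R, 0 < B ->
           (forall k : nat, odd k -> moment k (mu 2^-1 B) = 0) /\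
           symmetric_law (mu 2^-1 B)) /\
        symmetric_law (mu_lim 2^-1)].
Proof.
case: p hp => [|[|q]] // _; have ha := halpha.
have /choice[mu0 Hmu0] (z : R * R) : exists mu : probability R R,
    0 <= z.1 <= 1 -> 0 < z.2 ->
    finite_moments mu /\ forall k, moment k mu = limit_moment q alpha z.1 z.2 k.
  (* Outside the range of the parameters the Dirac mass is a placeholder. *)
  have [t01|nt] := pselect (0 <= z.1 <= 1); last by exists (\d_(0 : R) : probability R R).
  have [B0|nB] := pselect (0 < z.2); last by exists (\d_(0 : R) : probability R R).
  by have [mu Hmu] := limit_law_exists q ha t01 B0; exists mu.
pose mu theta B := mu0 (theta, B).
have Hmu theta B : 0 <= theta <= 1 -> 0 < B ->
    finite_moments (mu theta B) /\ forall k, moment k (mu theta B) = limit_moment q alpha theta B k.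
  by move=> t01 B0; exact: (Hmu0 (theta, B) t01 B0).
have h01 : 0 <= (2^-1 : R) <= 1 by apply/andP; split; lra.
exists mu, (fun=> \d_(0 : R) : probability R R); split.
- move=> theta B t01 B0; have [fmu mmu] := Hmu theta B t01 B0; split.
  + by move=> d T P nu x heavy iid; exact: (model_weak_cvg ha t01 B0 heavy iid).
  + exact: (limit_law_determinate ha t01 B0 fmu mmu).
  + exact: (limit_law_unbounded ha t01 B0 fmu mmu).
- move=> theta t01; apply: (limit_law_degenerate ha t01) => B B0.
  exact: Hmu.
(* p >= 3 supplies the third vertex of the triangle walk; the witnesses are order 3 and the two
   one-sided balances. *)
- case: q mu0 Hmu0 @mu Hmu => [|q] // mu0 Hmu0 mu Hmu _ B B0.
  exists 3%N, 1, 0; split; rewrite ?lexx ?ler01//.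
  have [|_ ->] := Hmu 1 B _ B0; first by rewrite ler01 lexx.
  have [|_ ->] := Hmu 0 B _ B0; first by rewrite ler01 lexx.
  exact: third_moment_balance.
- split=> [B B0|A _].
    have [fmu mmu] := Hmu _ _ h01 B0; split=> [k ok|].
      by rewrite mmu limit_moment_odd.
    exact: (symmetric_limit_law ha B0 fmu mmu).
  rewrite /= /dirac /= !indicE.
  have -> // : (0 \in -%R @^-1` A) = (0 \in A).
  by apply/idP/idP; rewrite !inE /= oppr0.
Qed.
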